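(* Let $-A$ be the generator of a $C_0$-semigroup $(e^{-tA})_{t\ge 0}$ on a complex Banach space $X$. Assume that $$M:=\sup_{t\ge 0}\|e^{-tA}\|<\infty .$$ If $g=1/f$, where $f\in\tilde{\mathcal S}_2$, $f\neq 0$, then for every $x\in\mathrm{dom}(g(A))$, $$\|\Delta_{n,t}(A)x\|\le 12\,M\,\frac{\|g(A)x\|}{g(\sqrt n/t)},\qquad n\in\mathbb N,\ t>0.$$ In particular, (taking $g(z)=z^\alpha$) for every $\alpha\in(0,2]$ and every $x\in\mathrm{dom}(A^\alpha)$, $$\|\Delta_{n,t}(A)x\|\le 12\,M\,\|A^\alpha x\|\left(\frac{t}{\sqrt n}\right)^\alpha,\qquad n\in\mathbb N,\ t>0.$$
   Context: $\mathbb C_+=\{z\in\mathbb C:\mathrm{Re}\,z>0\}$, $\mathbb R_+=[0,\infty)$; $\mathrm{dom}$ and $\mathrm{ran}$ denote domain and range. The range of $A$ is not assumed to be dense. For $n\in\mathbb N$, $t>0$: $\Delta_{n,t}(A):=\left(1+\frac tn A\right)^{-n}-e^{-tA}$. Stieltjes functions: a function $f:(0,\infty)\to[0,\infty)$ belongs to $\mathcal S$ if $f(z)=a+\int_0^\infty\frac{\mu(d\tau)}{z+\tau}$ for $z>0$, where $a\ge 0$ and $\mu$ is a positive Radon measure on $[0,\infty)$ with $\int_0^\infty\frac{\mu(d\tau)}{1+\tau}<\infty$; $f$ is identified with its unique analytic extension to $\mathbb C\setminus(-\infty,0]$. Further, $\tilde{\mathcal S}_2:=\{f_1\cdot f_2: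 f_1,f_2\in\mathcal S\}$. Functional calculus: $M(\mathbb R_+)$ is the Banach algebra of bounded (complex) Radon measures on $\mathbb R_+$, $(\mathcal L\mu)(z)=\int_0^\infty e^{-sz}\mu(ds)$ for $z\in\mathbb C_+$, and $A^1_+(\mathbb C_+)=\{\mathcal L\mu:\mu\in M(\mathbb R_+)\}$. For $-A$ generating a bounded $C_0$-semigroup and $h=\mathcal L\mu\in A^1_+(\mathbb C_+)$, $h(A)x:=\int_0^\infty e^{-sA}x\,\mu(ds)$ for $x\in X$. If $g:\mathbb C_+\to\mathbb C$ is holomorphic and there is $e\in A^1_+(\mathbb C_+)$ (a regularizer) with $eg\in A^1_+(\mathbb C_+)$ and $e(A)$ injective, then $g(A):=e(A)^{-1}(eg)(A)$ with $\mathrm{dom}(g(A))=\{x\in X:(eg)(A)x\in\mathrm{ran}(e(A))\}$; this does not depend on the choice of $e$ (extended Hille–Phillips calculus). For $f\in\tilde{\mathcal S}_2$, $f\ne0$, the function $g=1/f$ is regularizable by $e(z)=1/(1+z)^2$. The operator $A^\alpha$ is obtained by applying this calculus to $z^\alpha$ (principal branch). *)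

(* Defs.v *)
From HB Require Import structures.
From mathcomp Require Import all_boot all_order all_algebra.
From mathcomp Require Import complex.
From mathcomp Require Import all_classical all_reals all_analysis.
Set Implicit Arguments.
Unset Strict Implicit.
Unset Printing Implicit Defensive.
Import Order.TTheory GRing.Theory Num.Theory.
Import numFieldNormedType.Exports.
Local Open Scope classical_set_scope.
Local Open Scope complex_scope.
Local Open Scope ring_scope.

Section ComplexFunctions.
Variable R : realType.
Implicit Types (z : R[i]) (f : R[i] -> R[i]).

Definition Cplus : set R[i] := [set z | 0 < complex.Re z].

Definition slit_plane : set R[i] :=
  [set z | ~ (complex.Im z = 0 /\ complex.Re z <= 0)].

(* The increments range over the scalar field R[i], so this is complex
   differentiability. *)
Definition holomorphic_on (U : set R[i]) f :=
  forall z, U z -> derivable (f : R[i]^o -> R[i]^o) z 1.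

Definition cexp z : R[i] :=
  expR (complex.Re z) * cos (complex.Im z) +i*
  (expR (complex.Re z) * sin (complex.Im z)).

(* Principal logarithm; only meant on Cplus, where Arg z = atan (Im z / Re z). *)
Definition clog z : R[i] :=
  ln (complex.Re `|z|) +i* atan (complex.Im z / complex.Re z).

Definition cpow (alpha : R) z : R[i] := cexp (alpha%:C * clog z).

End ComplexFunctions.

Section Stieltjes.
Variable R : realType.

(* A function on (0, oo) given by the Stieltjes representation, together with
   its analytic extension to the slit plane. Integrating over [0, oo) only sees
   the restriction of mu to [0, oo). *)
Definition stieltjes (f : R[i] -> R[i]) : Prop :=
  holomorphic_on (@slit_plane R) f /\
  exists (a : R) (mu : {measure set (measurableTypeR R) -> \bar R}),
    [/\ 0 <= a,
        (\int[mu]_(tau in `[0%R, +oo[) ((1 + tau)^-1)%:E < +oo)%E &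
        forall x : R, 0 < x ->
          f x%:C = (a + \int[mu]_(tau in `[0, +oo[) (x + tau)^-1)%:C].

Definition stieltjes2 (f : R[i] -> R[i]) : Prop :=
  exists f1 f2 : R[i] -> R[i],
    [/\ stieltjes f1, stieltjes f2 & f = (fun z => f1 z * f2 z)].

End Stieltjes.

Section Bochner.
Variables (R : realType) (X : normedModType R[i]).
Let RB := measurableTypeR R.

(* The list [:: (E_1, v_1); ...; (E_m, v_m)] encodes the simple function
   \1_(E_1) v_1 + ... + \1_(E_m) v_m. *)
Definition simple_eval (s : seq (set RB * X)) (t : R) : X :=
  \sum_(p <- s) (\1_(p.1) t)%:C *: p.2.

Definition simple_int (mu : {finite_measure set RB -> \bar R}) (D : set RB)
    (s : seq (set RB * X)) : X :=
  \sum_(p <- s) (fine (mu (p.1 `&` D)))%:C *: p.2.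

Definition is_bochner (mu : {finite_measure set RB -> \bar R}) (D : set RB)
    (F : R -> X) (y : X) : Prop :=
  exists s : nat -> seq (set RB * X),
    [/\ forall k p, p \in s k -> measurable p.1,
        forall t, D t -> (fun k => simple_eval (s k) t) @ \oo --> F t,
        (fun k => \int[mu]_(t in D)
           (complex.Re `|F t - simple_eval (s k) t|)%:E)%E @ \oo --> 0%E &
        (fun k => simple_int mu D (s k)) @ \oo --> y].

(* The Bochner integral, with the junk value 0 when it does not exist. *)
Definition bochner mu D (F : R -> X) : X := get (is_bochner mu D F).

End Bochner.

Section BoundedMeasures.
Variable R : realType.

(* A bounded complex measure mu on R_+ is given by a decomposition
   mu = (re_pos - re_neg) + 'i (im_pos - im_neg) into finite positive Borel
   measures, which are integrated over [0, oo) only. *)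
Record bounded_measure := BoundedMeasure {
  re_pos : {finite_measure set (measurableTypeR R) -> \bar R};
  re_neg : {finite_measure set (measurableTypeR R) -> \bar R};
  im_pos : {finite_measure set (measurableTypeR R) -> \bar R};
  im_neg : {finite_measure set (measurableTypeR R) -> \bar R} }.

Definition cintegral (mu : {finite_measure set (measurableTypeR R) -> \bar R})
    (h : R -> R[i]) : R[i] :=
  (\int[mu]_(s in `[0, +oo[) complex.Re (h s)) +i*
  (\int[mu]_(s in `[0, +oo[) complex.Im (h s)).

Definition laplace (mu : bounded_measure) (z : R[i]) : R[i] :=
  let I nu := cintegral nu (fun s => cexp (- (s%:C * z))) in
  I (re_pos mu) - I (re_neg mu) + 'i * (I (im_pos mu) - I (im_neg mu)).

End BoundedMeasures.

Section Operators.
Variables (R : realType) (X : normedModType R[i]).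

(* A possibly unbounded operator; op_fun is irrelevant outside dom. *)
Record operator := Operator { dom : set X; op_fun :> X -> X }.

Definition opnorm (S : X -> X) : \bar R :=
  ereal_sup [set (complex.Re `|S x|)%:E | x in [set x | `|x| <= 1]].

Record C0_semigroup (T : R -> X -> X) : Prop := C0Semigroup {
  C0_linear : forall t, 0 <= t -> linear (T t);
  C0_bounded : forall t, 0 <= t -> continuous (T t);
  C0_zero : forall x, T 0 x = x;
  C0_add : forall s t, 0 <= s -> 0 <= t -> forall x, T (s + t) x = T s (T t x);
  C0_strong : forall x, (fun t => T t x) @ 0^'+ --> x }.

(* The operator -A generates T. *)
Definition neg_generator (A : operator) (T : R -> X -> X) : Prop :=
  let quot x h := (h^-1)%:C *: (T h x - x) in
  (forall x, dom A x <-> exists y : X, quot x @ 0^'+ --> y) /\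
  (forall x, dom A x -> quot x @ 0^'+ --> - A x).

Definition semigroup_sup (T : R -> X -> X) : \bar R :=
  ereal_sup [set opnorm (T t) | t in [set t | 0 <= t]].

(* (1 + s A)^{-1}; everywhere defined for s > 0 when -A generates a bounded
   C_0-semigroup. *)
Definition resolvent (A : operator) (s : R) (v : X) : X :=
  get [set u | dom A u /\ u + s%:C *: A u = v].

(* Delta_{n,t}(A), with T t = e^{-tA}. *)
Definition Delta (A : operator) (T : R -> X -> X) (n : nat) (t : R) (x : X) : X :=
  iter n (resolvent A (t / n%:R)) x - T t x.

(* h(A) for h = laplace mu. *)
Definition HP (T : R -> X -> X) (mu : bounded_measure R) (x : X) : X :=
  let I nu := bochner nu `[0, +oo[ (fun s => T s x) in
  I (re_pos mu) - I (re_neg mu) + 'i *: (I (im_pos mu) - I (im_neg mu)).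

(* y = g(A) x, i.e. e(A) y = (e g)(A) x for some regularizer e = laplace mu with
   e g = laplace nu. *)
Definition eHP_graph (T : R -> X -> X) (g : R[i] -> R[i]) (x y : X) : Prop :=
  holomorphic_on (@Cplus R) g /\
  exists mu nu : bounded_measure R,
    [/\ forall z, Cplus z -> laplace nu z = laplace mu z * g z,
        injective (HP T mu) &
        HP T mu y = HP T nu x].

Definition eHP (T : R -> X -> X) (g : R[i] -> R[i]) : operator :=
  {| dom := [set x | exists y, eHP_graph T g x y];
     op_fun := fun x => get [set y | eHP_graph T g x y] |}.

End Operators.

(* Main.v *)
Require Import Defs.
From HB Require Import structures.
From mathcomp Require Import all_boot all_order all_algebra.
From mathcomp Require Import complex ring lra.
From mathcomp Require Import all_classical all_reals all_analysis measurable_realfun.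
Set Implicit Arguments.
Unset Strict Implicit.
Unset Printing Implicit Defensive.
Import Order.TTheory GRing.Theory Num.Theory.
Import numFieldNormedType.Exports.
Local Open Scope classical_set_scope.
Local Open Scope complex_scope.
Local Open Scope ring_scope.

(** The proof turns the functional calculus on measures into an algebra of
    functionals, and bounds the multiplier Delta f in that algebra.

    Call a linear functional L on bounded continuous functions
    F : [0, oo) -> X normal of norm at most N when ||L F|| <= N sup ||F|| and
    when L respects bounded pointwise convergence; its symbol is the function
    lam with L (e^(- x .) v) = lam x v for x > 0.  Integration against a finite
    measure is the main example, with the Laplace transform as symbol.  Two
    facts make symbols as good as measures.  A normal functional is determined
    by the values of its symbol at 1, 2, ... (normal_uniq): in the variable
    p = e^(- t), Bernstein polynomials approximate F boundedly and pointwise.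
    And normal functionals can be convolved (has_symbol_conv), which multiplies
    symbols and norms; no exchange of integrals is involved, since uniqueness
    of symbols already gives commutativity.  Applied to the orbits t |-> T t x,
    a functional becomes an operator, products of symbols become compositions
    (orbit_op_mul), and the operator norm is at most M N.  The resolvent
    (1 + theta A)^-1 is the operator with symbol 1 / (1 + theta x)
    (resolventE), so Delta_(n,t)(A) has the symbol
    D x = (1 + (t / n) x)^-n - e^(- t x).

    With s = sqrt n / t the functional with symbol D has norm at most 2, the
    one with symbol D / x^2 has norm at most 1 / (2 s^2) by telescoping the
    case n = 1, where the density e^(- r) - (1 - r)_+ is nonnegative, and the
    one with symbol D / x has norm at most 3 / (2 s) by a Landau inequality
    between the other two (symbol_le_euler_err_div).  Split a Stieltjes
    function f = p + q at s, with the part of the measure beyond s in p: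
    p is a symbol of norm at most 2 p(s), and x q is one of norm at most
    4 s q(s) (real_stieltjes_split).  Expanding

      D f1 f2 = D p1 p2 + (D / x) (p1 (x q2) + (x q1) p2)
                + (D / x^2) (x q1) (x q2)

    bounds the norm by 8 p1 p2 + 12 (p1 q2 + q1 p2) + 8 q1 q2 at s, which is
    at most 12 f1(s) f2(s) (symbol_le_euler_err_stieltjes).

    Finally y = g(A) x means m(A) y = (m g)(A) x for some symbol m with m(A)
    injective.  As g f1 f2 = 1, the vector v = (D f1 f2)(A) y satisfies
    m(A) v = (D f1 f2 m g)(A) x = m(A) Delta_(n,t)(A) x, so that
    Delta_(n,t)(A) x = v has norm at most 12 M f1(s) f2(s) ||y||
    (euler_bound).  For fractional powers, x^(- alpha) is the square of
    x^(- alpha / 2), a Stieltjes function for 0 < alpha / 2 <= 1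
    (real_stieltjes_power). *)

(** * The norm as a real number *)

Section Norm.
Variables (R : realType) (X : normedModType R[i]).
Implicit Types (v w : X).

(** Norms in [X] take values in [R[i]]; integrals and limits of norms live
    in [R]. *)
Definition rnorm v : R := complex.Re `|v|.

Lemma rnormE v : `|v| = (rnorm v)%:C.
Proof.
have : 0 <= `|v| by [].
by rewrite lecE /rnorm => /andP[/= /eqP h _]; case: `|v| h => a b /= ->.
Qed.

Lemma rnorm_ge0 v : 0 <= rnorm v.
Proof. by have : 0 <= `|v| by []; rewrite rnormE lecR. Qed.

Lemma rnormD v w : rnorm (v + w) <= rnorm v + rnorm w.
Proof. by have := ler_normD v w; rewrite !rnormE -rmorphD lecR. Qed.

Lemma rnormN v : rnorm (- v) = rnorm v.
Proof. by rewrite /rnorm normrN. Qed.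

Lemma rnorm_distC v w : rnorm (v - w) = rnorm (w - v).
Proof. by rewrite /rnorm distrC. Qed.

Lemma rnorm0 : rnorm 0 = 0.
Proof. by rewrite /rnorm normr0. Qed.

Lemma rnorm0_eq0 v : rnorm v = 0 -> v = 0.
Proof. by move=> h; apply/eqP; rewrite -normr_eq0 rnormE h. Qed.

Lemma rnormZ (c : R) v : rnorm (c%:C *: v) = `|c| * rnorm v.
Proof.
rewrite /rnorm normrZ rnormE; have -> : `|c%:C| = `|c|%:C :> R[i].
  by rewrite normc_def /= expr0n /= addr0 sqrtr_sqr.
by rewrite -rmorphM.
Qed.

Lemma rnormZC (c : R[i]) v : rnorm (c *: v) = complex.Re `|c| * rnorm v.
Proof.
rewrite /rnorm normrZ rnormE.
by case: `|c| => a b; rewrite /= mulr0 subr0.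
Qed.

Lemma cvg_rnormP (u : nat -> X) l :
  (fun n => rnorm (u n - l)) @ \oo --> (0 : R) <-> u @ \oo --> l.
Proof.
split.
  move/cvgrPdist_lt => H; apply/cvgrPdist_lt => e e0.
  have e0' : 0 < complex.Re e by move: e0; rewrite ltcE => /andP[_].
  have [N _ HN] := H _ e0'; exists N => // n /HN /=.
  rewrite sub0r normrN ger0_norm ?rnorm_ge0// distrC rnormE => h.
  move: e0; rewrite !ltcE/= => /andP[-> _]; exact: h.
move/cvgrPdist_lt => H; apply/cvgrPdist_lt => e e0.
have e0' : 0 < e%:C by rewrite ltcR.
have [N _ HN] := H _ e0'; exists N => // n /HN /=.
by rewrite sub0r normrN ger0_norm ?rnorm_ge0// distrC rnormE ltcR.
Qed.

Lemma cvg_rnorm (u : nat -> X) l : u @ \oo --> l ->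
  (fun n => rnorm (u n)) @ \oo --> rnorm l.
Proof.
move=> /cvg_rnormP ul; apply/cvgrPdist_lt => e e0.
move/cvgrPdist_lt : ul => /(_ _ e0) [N _ H]; exists N => // n /H /=.
rewrite sub0r normrN ger0_norm ?rnorm_ge0// => h; apply: le_lt_trans h.
rewrite ler_distl; apply/andP; split.
  rewrite lerBlDr -[X in rnorm X <= _](subrK l) addrC.
  by rewrite (le_trans (rnormD _ _)).
by rewrite -[X in rnorm X <= _](subrK (u n)) (le_trans (rnormD _ _))// addrC lerD2l
  rnorm_distC.
Qed.

Lemma cvg_scale_real (u : nat -> X) (l : X) (c : nat -> R) (d : R) : u @ \oo --> l ->
  c @ \oo --> d ->
  (fun n => (c n)%:C *: u n) @ \oo --> d%:C *: l.
Proof.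
move=> ul cd; apply: cvgZ => //.
apply/cvgrPdist_lt => e e0.
have e0' : 0 < complex.Re e by move: e0; rewrite ltcE => /andP[_].
move/cvgrPdist_lt : cd => /(_ _ e0') [N _ H]; exists N => // n /H /= h.
rewrite -rmorphB normc_def /= expr0n /= addr0 sqrtr_sqr.
by move: e0; rewrite !ltcE/= => /andP[-> _].
Qed.

End Norm.

(** * Integrals of simple functions *)

Section Simple.
Variables (R : realType) (X : normedModType R[i]).
Let RB := measurableTypeR R.
Local Notation simple := (seq (set RB * X)).

Definition measurable_simple (s : simple) := forall p, p \in s -> measurable p.1.

Lemma measurable_simple_cons p s : measurable_simple (p :: s) ->
  measurable p.1 /\ measurable_simple s.
Proof.
move=> h; split; first by apply: h; rewrite mem_head.
by move=> q qs; apply: h; rewrite inE qs orbT.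
Qed.

Lemma simple_eval_nil t : simple_eval ([::] : simple) t = 0.
Proof. by rewrite /simple_eval big_nil. Qed.

Lemma simple_eval_cons p (s : simple) t :
  simple_eval (p :: s) t = (\1_(p.1) t)%:C *: p.2 + simple_eval s t.
Proof. by rewrite /simple_eval big_cons. Qed.

Lemma simple_eval_cat (s s' : simple) t :
  simple_eval (s ++ s') t = simple_eval s t + simple_eval s' t.
Proof. by rewrite /simple_eval big_cat. Qed.

Lemma simple_int_cat mu D (s s' : simple) :
  simple_int mu D (s ++ s') = simple_int mu D s + simple_int mu D s'.
Proof. by rewrite /simple_int big_cat. Qed.

Definition simple_map (f : X -> X) (s : simple) : simple := [seq (p.1, f p.2) | p <- s].

Lemma measurable_simple_map f s : measurable_simple s -> measurable_simple (simple_map f s).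
Proof. by move=> h p /mapP[q /h mq ->]. Qed.

Lemma measurable_simple_cat s s' : measurable_simple s -> measurable_simple s' ->
  measurable_simple (s ++ s').
Proof. by move=> h h' p; rewrite mem_cat => /orP[/h|/h']. Qed.

Section Linear.
Variable f : {linear X -> X}.
Lemma simple_eval_map s t : simple_eval (simple_map f s) t = f (simple_eval s t).
Proof.
by rewrite /simple_eval big_map linear_sum; apply: eq_bigr => p _; rewrite linearZ.
Qed.
Lemma simple_int_map mu D s : simple_int mu D (simple_map f s) = f (simple_int mu D s).
Proof.
by rewrite /simple_int big_map linear_sum; apply: eq_bigr => p _; rewrite linearZ.
Qed.
End Linear.

(** The shift [w] makes the induction go through: removing the first cell of
    the list replaces [w] by [p.2 + w] on that cell. *)
Lemma measurable_rnorm_simple (s : simple) (w : X) : measurable_simple s ->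
  measurable_fun [set: RB] (fun t => rnorm (simple_eval s t + w)).
Proof.
elim: s w => [|p s IH] w ms.
  rewrite (_ : (fun _ => _) = cst (rnorm w)); first exact: measurable_cst.
  by apply/funext => t; rewrite simple_eval_nil add0r.
have [mp {}ms] := measurable_simple_cons ms.
rewrite (_ : (fun t => _) = (fun t => if t \in p.1 then rnorm (simple_eval s t + (p.2 + w))
   else rnorm (simple_eval s t + w))).
  apply: (@measurable_fun_ifT _ _ RB _ _ _ (fun t : RB => t \in p.1));
    [|exact: IH|exact: IH].
  apply: (measurable_fun_bool true); rewrite setTI.
  rewrite (_ : _ @^-1` _ = p.1)//; apply/seteqP; split => t;
    [exact: set_mem|exact: mem_set].
apply/funext => t; rewrite simple_eval_cons indicE; case: ifPn => tp.
  by rewrite scale1r addrCA addrA.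
by rewrite scale0r add0r.
Qed.

(** The cells of a simple function may overlap, so no disjoint normal form is
    available.  Cutting [D] along the first cell of the list turns its value
    into a constant [w] on one of the two pieces. *)
Lemma simple_int_le (mu : {finite_measure set RB -> \bar R}) (D : set RB) (s :
  simple) (w : X) :
  measurable D -> measurable_simple s ->
  ((rnorm (simple_int mu D s + (fine (mu D))%:C *: w))%:E <=
    \int[mu]_(t in D) (rnorm (simple_eval s t + w))%:E)%E.
Proof.
elim: s D w => [|p s IH] D w mD ms.
  under eq_integral do rewrite simple_eval_nil add0r.
  rewrite integral_cst// /simple_int big_nil add0r rnormZ ger0_norm ?fine_ge0//.
  rewrite mulrC EFinM fineK// fin_num_measure//.
have [mp {}ms] := measurable_simple_cons ms.
have mE : measurable (D `&` p.1) by exact: measurableI.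
have mE' : measurable (D `\` p.1) by exact: measurableD.
set F := fun t => (rnorm (simple_eval (p :: s) t + w))%:E.
have -> : (\int[mu]_(t in D) F t =
  \int[mu]_(t in D `&` p.1) F t + \int[mu]_(t in D `\` p.1) F t)%E.
  rewrite -ge0_integral_setU//; first by rewrite setUIDK.
- apply/measurable_EFinP; apply: measurable_funTS; apply: measurable_rnorm_simple => q.
  by rewrite inE => /orP[/eqP -> //|/ms].
- by move=> t _; rewrite lee_fin rnorm_ge0.
- by rewrite disj_set2E; apply/eqP; rewrite setDE setIACA setICr setI0.
have := leeD (IH _ (p.2 + w) mE ms) (IH _ w mE' ms).
rewrite -EFinD => h; apply: (le_trans _ (le_trans h _)).
  rewrite lee_fin; apply: le_trans (rnormD _ _); rewrite le_eqVlt; apply/orP; left;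
    apply/eqP.
  congr rnorm; rewrite /simple_int big_cons.
  have D1 A : measurable A -> (fine (mu (A `&` D)))%:C =
    (fine (mu (A `&` (D `&` p.1))))%:C + (fine (mu (A `&` (D `\` p.1))))%:C :> R[i].
    move=> mA; rewrite -rmorphD -fineD ?fin_num_measure//; try exact: measurableI.
    rewrite -measureU//; try exact: measurableI.
      by rewrite -setIUr setUIDK.
    by rewrite setIACA (_ : (D `&` p.1) `&` (D `\` p.1) =
      set0) ?setI0// setDE setIACA setICr setI0.
  have -> : \sum_(j <- s) (fine (mu (j.1 `&` D)))%:C *: j.2 =
    \sum_(j <- s) (fine (mu (j.1 `&` (D `&` p.1))))%:C *: j.2 +
    \sum_(j <- s) (fine (mu (j.1 `&` (D `\` p.1))))%:C *: j.2.
    rewrite -big_split/= big_seq [RHS]big_seq; apply: eq_bigr => q qs.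
    by rewrite -scalerDl -D1//; exact: ms.
  have := D1 _ measurableT; rewrite !setTI => ->.
  rewrite scalerDr scalerDl [p.1 `&` D]setIC.
  by rewrite -addrA addrCA [RHS]addrACA; congr (_ + _); rewrite addrA.
apply: leeD.
  rewrite le_eqVlt; apply/orP; left; apply/eqP; apply: eq_integral => t.
  rewrite inE /F => -[_ tp]; rewrite simple_eval_cons indicE mem_set// scale1r.
  by rewrite -addrA addrCA.
rewrite le_eqVlt; apply/orP; left; apply/eqP; apply: eq_integral => t.
rewrite inE /F => -[_ tp]; rewrite simple_eval_cons indicE memNset// scale0r.
by rewrite add0r.
Qed.

End Simple.

(** * Norm bound, linearity and uniqueness of the Bochner integral *)

Section BochnerBasics.
Variables (R : realType) (X : normedModType R[i]).
Let RB := measurableTypeR R.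
Variables (mu : {finite_measure set RB -> \bar R}) (D : set RB).
Hypothesis mD : measurable D.
Local Notation simple := (seq (set RB * X)).
Implicit Types (s : simple) (F G : R -> X).

Lemma simple_eval_sub s s' t :
  simple_eval (s ++ simple_map -%R s') t = simple_eval s t - simple_eval s' t.
Proof. by rewrite simple_eval_cat (simple_eval_map -%R). Qed.

(** The shift [w] makes the induction go through: removing the first cell of
    the list replaces [w] by [p.2 + w] on that cell. *)
Lemma measurable_rnorm_simpleB s s' : measurable_simple s -> measurable_simple s' ->
  measurable_fun D (fun t => rnorm (simple_eval s t - simple_eval s' t)).
Proof.
move=> ms ms'.
rewrite (_ : (fun _ => _) = (fun t => rnorm (simple_eval (s ++ simple_map -%R s') t + 0))).
  by apply: measurable_funTS; apply: measurable_rnorm_simple;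
    apply: measurable_simple_cat => //; exact: measurable_simple_map.
by apply/funext => t; rewrite addr0 simple_eval_sub.
Qed.

Lemma simple_int_dist s s' : measurable_simple s -> measurable_simple s' ->
  ((rnorm (simple_int mu D s - simple_int mu D s'))%:E <=
   \int[mu]_(t in D) (rnorm (simple_eval s t - simple_eval s' t))%:E)%E.
Proof.
move=> ms ms'; have := @simple_int_le R X mu D (s ++ simple_map -%R s') 0 mD.
rewrite simple_int_cat (simple_int_map -%R) scaler0 addr0.
move=> /(_ (measurable_simple_cat ms (measurable_simple_map ms'))) /le_trans; apply.
rewrite le_eqVlt; apply/orP; left; apply/eqP; apply: eq_integral => t _.
by rewrite addr0 simple_eval_sub.
Qed.

Lemma measurable_rnorm_limB F (s : nat -> simple) s' :
  (forall k, measurable_simple (s k)) -> measurable_simple s' ->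
  (forall t, D t -> (fun k => simple_eval (s k) t) @ \oo --> F t) ->
  measurable_fun D (fun t => rnorm (F t - simple_eval s' t)).
Proof.
move=> ms ms' sF.
apply: (@measurable_fun_cvg _ RB _ _ (fun k t => rnorm (simple_eval (s k) t - simple_eval
  s' t))).
  by move=> k; exact: measurable_rnorm_simpleB.
by move=> t Dt /=; apply: cvg_rnorm; apply: cvgB; [exact: sF|exact: cvg_cst].
Qed.

Lemma measurable_rnorm_lim F (s : nat -> simple) :
  (forall k, measurable_simple (s k)) ->
  (forall t, D t -> (fun k => simple_eval (s k) t) @ \oo --> F t) ->
  measurable_fun D (fun t => rnorm (F t)).
Proof.
move=> ms sF; have ms0 : measurable_simple ([::] : simple) by [].
have := measurable_rnorm_limB ms ms0 sF.
by under eq_fun do rewrite simple_eval_nil subr0.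
Qed.

(** Passing to the limit in [simple_int_dist] keeps the inequality, because the
    simple functions converge in mean. *)
Lemma bochner_norm_le F y : is_bochner mu D F y ->
  ((rnorm y)%:E <= \int[mu]_(t in D) (rnorm (F t))%:E)%E.
Proof.
move=> [s [ms sF intF sy]]; have ms0 : measurable_simple ([::] : simple) by [].
have mF := measurable_rnorm_lim ms sF.
have le k : ((rnorm (simple_int mu D (s k)))%:E <= \int[mu]_(t in D) (rnorm (F t))%:E +
   \int[mu]_(t in D) (rnorm (F t - simple_eval (s k) t))%:E)%E.
  have := simple_int_dist (ms k) ms0.
  rewrite [simple_int mu D [::]]big_nil subr0 => /le_trans; apply.
  have mFs := measurable_rnorm_limB ms (ms k) sF.
  rewrite -ge0_integralD//; last 4 first.
  - by move=> t _; rewrite lee_fin rnorm_ge0.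
  - exact/measurable_EFinP.
  - by move=> t _; rewrite lee_fin rnorm_ge0.
  - exact/measurable_EFinP.
  apply: ge0_le_integral => //.
  - by move=> t _; rewrite lee_fin rnorm_ge0.
  - apply/measurable_EFinP. exact: (measurable_rnorm_simpleB (ms k) ms0).
  - by apply: emeasurable_funD; apply/measurable_EFinP.
  move=> t _; rewrite simple_eval_nil subr0 -EFinD lee_fin.
  rewrite -{1}[simple_eval (s k) t](subrK (F t)) addrC.
  by rewrite (le_trans (rnormD _ _))// lerD2l rnorm_distC.
have c1 : (fun k => (rnorm (simple_int mu D (s k)))%:E) @ \oo --> (rnorm y)%:E.
  by apply: cvg_EFin; [exact: nearW|exact: cvg_rnorm].
have c2 : (fun k => \int[mu]_(t in D) (rnorm (F t))%:E +
   \int[mu]_(t in D) (rnorm (F t - simple_eval (s k) t))%:E)%E @ \oo -->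
   (\int[mu]_(t in D) (rnorm (F t))%:E + 0)%E.
  by apply: cvgeD => //; [rewrite fin_num_adde_defl|exact: cvg_cst].
rewrite -[leRHS]adde0 -(cvg_lim _ c1)// -(cvg_lim _ c2)//.
apply: lee_lim; [exact: cvgP c1|exact: cvgP c2|exact: nearW].
Qed.

Lemma is_bochnerD F G y z : is_bochner mu D F y -> is_bochner mu D G z ->
  is_bochner mu D (fun t => F t + G t) (y + z).
Proof.
move=> [s [ms sF intF sy]] [s' [ms' sG intG sz]].
exists (fun k => s k ++ s' k); split.
- by move=> k; exact: (measurable_simple_cat (ms k) (ms' k)).
- move=> t Dt; under eq_fun do rewrite simple_eval_cat.
  by apply: cvgD; [exact: sF|exact: sG].
- have c : (fun k => \int[mu]_(t in D) (rnorm (F t - simple_eval (s k) t))%:E +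
     \int[mu]_(t in D) (rnorm (G t - simple_eval (s' k) t))%:E)%E @ \oo --> 0%E.
    rewrite -[X in _ --> X]adde0; exact: cvgeD.
  apply: (squeeze_cvge _ (cvg_cst 0%E) c); apply: nearW => k.
  have m1 := measurable_rnorm_limB ms (ms k) sF.
  have m2 := measurable_rnorm_limB ms' (ms' k) sG.
  have m3 : measurable_fun D (fun t => rnorm (F t + G t - simple_eval (s k ++ s' k) t)).
    apply: (@measurable_rnorm_limB _ (fun k => s k ++ s' k)).
    + by move=> j; exact: (measurable_simple_cat (ms j) (ms' j)).
    + exact: (measurable_simple_cat (ms k) (ms' k)).
    + move=> t Dt; under eq_fun do rewrite simple_eval_cat.
      by apply: cvgD; [exact: sF|exact: sG].
  rewrite integral_ge0 ?andTb; last by move=> t _; rewrite lee_fin; exact: rnorm_ge0.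
  rewrite -ge0_integralD//; last 4 first.
  - by move=> t _; rewrite lee_fin rnorm_ge0.
  - exact/measurable_EFinP.
  - by move=> t _; rewrite lee_fin rnorm_ge0.
  - exact/measurable_EFinP.
  apply: ge0_le_integral => //.
  - by move=> t _; rewrite lee_fin rnorm_ge0.
  - exact/measurable_EFinP.
  - by apply: emeasurable_funD; apply/measurable_EFinP.
  move=> t _; rewrite -EFinD lee_fin simple_eval_cat opprD addrACA.
  exact: rnormD.
- under eq_fun do rewrite simple_int_cat.
  exact: cvgD.
Qed.

Lemma is_bochner_linear (f : {linear X -> X}) (C : R) F y :
  0 <= C -> (forall v, rnorm (f v) <= C * rnorm v) ->
  is_bochner mu D F y -> is_bochner mu D (fun t => f (F t)) (f y).
Proof.
move=> C0 fC [s [ms sF intF sy]].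
have fc u l : u @ \oo --> l -> (fun n => f (u n)) @ \oo --> f l.
  move=> /cvg_rnormP ul; apply/cvg_rnormP.
  have c : (fun n => C * rnorm (u n - l)) @ \oo --> (0 : R).
    by rewrite -(mulr0 C); apply: cvgMr.
  apply: (squeeze_cvgr _ (cvg_cst 0) c); apply: nearW => n.
  by rewrite rnorm_ge0 -linearB fC.
exists (fun k => simple_map f (s k)); split.
- by move=> k; exact: (@measurable_simple_map _ _ f _ (ms k)).
- by move=> t Dt; under eq_fun do rewrite simple_eval_map; apply: fc; exact: sF.
- have c : (fun k => C%:E * \int[mu]_(t in D) (rnorm (F t - simple_eval (s k) t))%:E)%E @
  \oo --> 0%E.
    rewrite -(mule0 C%:E); apply: cvgeMl => //.
  apply: (squeeze_cvge _ (cvg_cst 0%E) c); apply: nearW => k.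
  have m1 := measurable_rnorm_limB ms (ms k) sF.
  have m3 : measurable_fun D (fun t => rnorm (f (F t) - simple_eval (simple_map f (s k))
    t)).
    apply: (@measurable_rnorm_limB _ (fun k => simple_map f (s k))).
    + by move=> j; exact: (@measurable_simple_map _ _ f _ (ms j)).
    + exact: (@measurable_simple_map _ _ f _ (ms k)).
    + by move=> t Dt; under eq_fun do rewrite simple_eval_map; apply: fc; exact: sF.
  rewrite integral_ge0 ?andTb; last by move=> t _; rewrite lee_fin; exact: rnorm_ge0.
  have mC : measurable_fun D (fun t => (C * rnorm (F t - simple_eval (s k) t))%:E).
    by apply/measurable_EFinP; apply: measurable_funM.
  have CC : (\int[mu]_(t in D) (C * rnorm (F t - simple_eval (s k) t))%:E =
     C%:E * \int[mu]_(t in D) (rnorm (F t - simple_eval (s k) t))%:E)%E.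
    under eq_integral do rewrite EFinM.
    rewrite ge0_integralZl//; first exact/measurable_EFinP.
    by move=> t _; rewrite lee_fin rnorm_ge0.
  rewrite -CC; apply: ge0_le_integral => //.
  - by move=> t _; rewrite lee_fin rnorm_ge0.
  - exact/measurable_EFinP.
  by move=> t _; rewrite lee_fin simple_eval_map -linearB fC.
- by under eq_fun do rewrite simple_int_map; apply: fc.
Qed.

(** The norm bound applied to the difference, which represents the integral of
    zero. *)
Lemma bochner_uniq F y z : is_bochner mu D F y -> is_bochner mu D F z -> y = z.
Proof.
move=> Fy Fz.
have Fz' : is_bochner mu D (fun t => - F t) (- z).
  by apply: (@is_bochner_linear -%R 1) => // v; rewrite  mul1r rnormN.
have := bochner_norm_le (is_bochnerD Fy Fz').
rewrite integral0_eq; last by move=> t _; rewrite subrr rnorm0.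
rewrite lee_fin => h; apply/eqP; rewrite -subr_eq0; apply/eqP/rnorm0_eq0.
by apply/eqP; rewrite eq_le h rnorm_ge0.
Qed.

Lemma bochnerE F y : is_bochner mu D F y -> bochner mu D F = y.
Proof. by move=> h; apply: (bochner_uniq _ h); apply: getI h. Qed.

End BochnerBasics.

(** * Existence of the Bochner integral *)

Section Grid.
Variable R : realType.
Let RB := measurableTypeR R.

(** Continuity at [t] relative to [0, oo), in the sequential form that
    dominated convergence produces and consumes. *)
Definition seqcont_at (X : normedModType R[i]) (F : R -> X) (t : R) :=
  forall u : nat -> R, (forall n, 0 <= u n) -> u @ \oo --> t ->
    (fun n => F (u n)) @ \oo --> F t.

(** Cells of length 1 / (k + 1) covering [0, k + 1), each with its left endpoint;
    that endpoint stays in [0, oo), where the integrands are controlled. *)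
Definition grid (k : nat) : seq (set RB * R) :=
  [seq (`[j%:R / k.+1%:R, j.+1%:R / k.+1%:R[%classic : set RB, j%:R / k.+1%:R) |
     j <- iota 0 (k.+1 * k.+1)].

Definition grid_pt k (t : R) : R := (Num.truncn (t * k.+1%:R))%:R / k.+1%:R.

Lemma mem_cell (j k : nat) (t : R) : 0 <= t ->
  (t \in (`[j%:R / k.+1%:R, j.+1%:R / k.+1%:R[%classic : set RB)) =
  (j == Num.truncn (t * k.+1%:R)).
Proof.
move=> t0; rewrite mem_setE in_itv/= ler_pdivrMr ?ltr0n// ltr_pdivlMr ?ltr0n//.
apply/idP/eqP => [h|->]; first by rewrite (Num.Theory.truncn_def h).
by apply: Num.Theory.truncn_itv; rewrite mulr_ge0// ler0n.
Qed.

Lemma grid_sum (V : zmodType) (G : R -> V) k (t : R) : 0 <= t ->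
  \sum_(p <- grid k) (if t \in p.1 then G p.2 else 0) =
  if (Num.truncn (t * k.+1%:R) < k.+1 * k.+1)%N then G (grid_pt k t) else 0.
Proof.
move=> t0; rewrite big_map.
under eq_bigr do rewrite /= mem_cell//.
case: ifPn => h.
  have mi : Num.truncn (t * k.+1%:R) \in iota 0 (k.+1 * k.+1) by rewrite mem_iota.
  rewrite (bigD1_seq _ mi (iota_uniq _ _))/= eqxx.
  by rewrite big1 ?addr0// => i /negbTE ->.
rewrite big_seq big1// => i; rewrite mem_iota/= add0n => ik.
by case: eqP => // ei; move: h; rewrite -ei ik.
Qed.

Lemma grid_pt_ge0 k t : 0 <= grid_pt k t.
Proof. by rewrite divr_ge0// ler0n. Qed.

Lemma grid_pt_cvg t : 0 <= t -> (fun k => grid_pt k t) @ \oo --> t.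
Proof.
move=> t0; apply: (@squeeze_cvgr _ _ _ _ (fun k => t - k.+1%:R^-1) (cst t)).
- apply: nearW => k /=; have k0 : 0 < k.+1%:R :> R by rewrite ltr0n.
  have /andP[h1 h2] := Num.Theory.truncn_itv (mulr_ge0 t0 (ltW k0)).
  rewrite /grid_pt ler_pdivrMr// h1 andbT ler_pdivlMr// mulrBl mulVf ?gt_eqF//.
  by rewrite lerBlDr natr1 ltW.
- rewrite -[X in _ --> X]subr0; apply: cvgB; first exact: cvg_cst.
  exact: (@cvg_harmonic R).
- exact: cvg_cst.
Qed.

Lemma grid_near (t : R) : 0 <= t ->
  \forall k \near \oo, (Num.truncn ((t * k.+1%:R) : R) < k.+1 * k.+1)%N.
Proof.
move=> t0; exists (Num.truncn (t : R)).+1 => // k /= kt.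
have k0 : 0 < k.+1%:R :> R by rewrite ltr0n.
have /andP[h1 h2] := Num.Theory.truncn_itv (mulr_ge0 t0 (ltW k0)).
rewrite -(ltr_nat R); apply: le_lt_trans h1 _; rewrite natrM ltr_pM2r//.
have /andP[_ ht] := Num.Theory.truncn_itv t0.
by apply: lt_le_trans ht _; rewrite ler_nat; exact: leqW.
Qed.

Lemma measurable_grid k p : p \in grid k -> measurable p.1.
Proof. by move=> /mapP[j _ ->]; exact: measurable_itv. Qed.

Variable X : normedModType R[i].
Definition grid_simple (F : R -> X) k : seq (set RB * X) :=
  [seq (p.1, F p.2) | p <- grid k].

Lemma measurable_grid_simple F k : measurable_simple (grid_simple F k).
Proof. by move=> p /mapP[q /measurable_grid h ->]. Qed.

Lemma grid_simpleE F k t : 0 <= t -> simple_eval (grid_simple F k) t =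
  if (Num.truncn (t * k.+1%:R) < k.+1 * k.+1)%N then F (grid_pt k t) else 0.
Proof.
move=> t0; rewrite -grid_sum// /simple_eval big_map.
apply: eq_bigr => p _ /=; rewrite indicE; case: ifP => _.
  by rewrite scale1r.
by rewrite scale0r.
Qed.

Lemma grid_simple_cvg F t : 0 <= t -> seqcont_at F t ->
  (fun k => simple_eval (grid_simple F k) t) @ \oo --> F t.
Proof.
move=> t0 Ft.
have := Ft _ (fun k => grid_pt_ge0 k t) (grid_pt_cvg t0).
apply: cvg_trans; apply: near_eq_cvg.
by apply: filterS (grid_near t0) => k h; rewrite grid_simpleE// h.
Qed.

Lemma grid_simple_le F K k t : (forall t, 0 <= t -> rnorm (F t) <= K) -> 0 <= t ->
  rnorm (simple_eval (grid_simple F k) t) <= K.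
Proof.
move=> FK t0; rewrite grid_simpleE//; case: ifP => _.
  by apply: FK; exact: grid_pt_ge0.
by rewrite rnorm0 (le_trans _ (FK 0 _))// rnorm_ge0.
Qed.

End Grid.

Section Existence.
Variables (R : realType).
Let RB := measurableTypeR R.
Variables (mu : {finite_measure set RB -> \bar R}) (D : set RB).
Hypotheses (mD : measurable D) (D0 : forall t, D t -> 0 <= t).

Lemma bounded_convergence (f_ : nat -> R -> R) (f : R -> R) (K : R) :
  (forall n, measurable_fun (D : set RB) (f_ n)) ->
  (forall t, D t -> (fun n => f_ n t) @ \oo --> f t) ->
  (forall n t, D t -> `|f_ n t| <= K) ->
  [/\ measurable_fun (D : set RB) f,
   mu.-integrable D (EFin \o f),
   forall n, mu.-integrable D (EFin \o f_ n) &
   (fun n => \int[mu]_(t in D) f_ n t) @ \oo --> \int[mu]_(t in D) f t].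
Proof.
move=> mf_ f_f fK.
have mf : measurable_fun D f by exact: measurable_fun_cvg f_f.
have iK : mu.-integrable D (EFin \o cst K) by exact: finite_measure_integrable_cst.
have K0 n t : D t -> (`|(f_ n t)%:E| <= (EFin \o cst K) t)%E.
  by move=> Dt; rewrite /= lee_fin fK.
have [| | | | |i1 _ c] := @dominated_convergence _ _ _ mu D mD (fun n => EFin \o f_ n)
  (EFin \o f) (EFin \o cst K).
- by move=> n; exact/measurable_EFinP.
- exact/measurable_EFinP.
- by apply: aeW => t Dt; apply: cvg_EFin; [exact: nearW|exact: f_f].
- by [].
- by apply: aeW => t n Dt; exact: K0.
split => //.
  move=> n; apply: le_integrable iK => //; first exact/measurable_EFinP.
  by move=> t Dt; rewrite /= lee_fin (le_trans (fK _ _ Dt))// ler_norm.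
by apply: fine_cvg; rewrite fineK//; apply: integrable_fin_num.
Qed.

Definition real_simple_eval (s : seq (set RB * R)) (t :
  R) := \sum_(p <- s) \1_(p.1) t * p.2.
Definition real_simple_int (s : seq (set RB * R)) := \sum_(p <- s) fine (mu (p.1 `&` D))
  * p.2.

Lemma real_simple_intE s : (forall p, p \in s -> measurable p.1) ->
  [/\ measurable_fun (D : set RB) (real_simple_eval s),
    mu.-integrable D (EFin \o real_simple_eval s) &
   \int[mu]_(t in D) real_simple_eval s t = real_simple_int s].
Proof.
elim: s => [|p s IH] ms.
  have -> : real_simple_eval [::] = cst 0 by apply/funext => t;
    rewrite /real_simple_eval big_nil.
  split; [exact: measurable_cst|exact: finite_measure_integrable_cst|].
  by rewrite /real_simple_int big_nil Rintegral_cst// mul0r.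
have [|m1 i1 e1] := IH; first by move=> q qs; apply: ms; rewrite inE qs orbT.
have mp : measurable p.1 by apply: ms; rewrite mem_head.
have -> : real_simple_eval (p :: s) = (fun t => \1_(p.1) t * p.2 + real_simple_eval s t).
  by apply/funext => t; rewrite /real_simple_eval big_cons.
have mi : measurable_fun D (\1_(p.1) : RB -> R) by exact: measurable_indic.
have ii : mu.-integrable D (EFin \o (\1_(p.1) : RB -> R)).
  apply: (le_integrable _ _ _ (finite_measure_integrable_cst mu 1 mD)) => //.
    exact/measurable_EFinP.
  by move=> t _; rewrite /= normr1 lee_fin indicE; case: (_ \in _); rewrite ?normr1 ?normr0.
have ip : mu.-integrable D (EFin \o (fun t => \1_(p.1) t * p.2)).
  have := integrableZr mD p.2 ii; apply: eq_integrable => // t _.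
split.
- by apply: measurable_funD => //; apply: measurable_funM => //.
- by have := integrableD mD ip i1; apply: eq_integrable.
rewrite RintegralD// e1 /real_simple_int big_cons; congr (_ + _).
rewrite RintegralZr//; congr (_ * _).
by rewrite /Rintegral integral_indic.
Qed.

(** Besides the convergence of Riemann sums, this gives the measurability of
    functions that are only sequentially continuous on [D]. *)
Lemma grid_real_integral (h : R -> R) (K : R) :
  (forall t, 0 <= t -> `|h t| <= K) ->
  (forall t, D t -> forall u : nat -> R, (forall n, 0 <= u n) -> u @ \oo --> t ->
    (fun n => h (u n)) @ \oo --> h t) ->
  [/\ measurable_fun (D : set RB) h, mu.-integrable D (EFin \o h) &
  (fun k => real_simple_int [seq (p.1,
    h p.2) | p <- grid R k]) @ \oo --> \int[mu]_(t in D) h t].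
Proof.
move=> hK hc.
have ms k p : p \in [seq (p.1, h p.2) | p <- grid R k] -> measurable p.1.
  by move=> /mapP[q /measurable_grid mq ->].
have E k t : 0 <= t -> real_simple_eval [seq (p.1, h p.2) | p <- grid R k] t =
  if (Num.truncn (t * k.+1%:R) < k.+1 * k.+1)%N then h (grid_pt k t) else 0.
  move=> t0; rewrite -grid_sum// /real_simple_eval big_map; apply: eq_bigr => p _ /=.
  by rewrite indicE; case: ifP => _; rewrite ?mul1r ?mul0r.
have [|||m1 i1 _ c] := @bounded_convergence (fun k => real_simple_eval [seq (p.1,
  h p.2) | p <- grid R k]) h K.
- by move=> k; have [] := real_simple_intE (ms k).
- move=> t Dt; have t0 := D0 Dt.
  have := hc _ Dt _ (fun k => grid_pt_ge0 k t) (grid_pt_cvg t0).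
  apply: cvg_trans; apply: near_eq_cvg.
  by apply: filterS (grid_near t0) => k hh; rewrite E// hh.
- move=> k t /D0 t0; rewrite E//; case: ifP => _; first exact/hK/grid_pt_ge0.
  by rewrite normr0 (le_trans _ (hK 0 _)).
split=> //; move: c; under eq_fun do rewrite (let: And3 _ _ e := real_simple_intE (ms _)
  in e).
by [].
Qed.

Variable X : completeNormedModType R[i].

Lemma grid_L1_cvg (F : R -> X) (K : R) :
  (forall t, 0 <= t -> rnorm (F t) <= K) -> (forall t, D t -> seqcont_at F t) ->
  (fun k => \int[mu]_(t in D) (rnorm (F t - simple_eval (grid_simple F k) t))%:E)%E @ \oo
    --> 0%E.
Proof.
move=> FK Fc.
have gc t : D t -> (fun k => simple_eval (grid_simple F k) t) @ \oo --> F t.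
  by move=> Dt; apply: grid_simple_cvg; [exact: D0|exact: Fc].
have [|||_ _ iF c] := @bounded_convergence (fun k t => rnorm (F t - simple_eval
  (grid_simple F k) t)) (cst 0) (K + K).
- move=> k; apply: (measurable_rnorm_limB _ _ gc) => //; [|exact: measurable_grid_simple].
  by move=> j; exact: measurable_grid_simple.
- move=> t Dt; have /cvg_rnormP := gc _ Dt; by under eq_fun do rewrite rnorm_distC.
- move=> k t Dt; rewrite ger0_norm ?rnorm_ge0// (le_trans (rnormD _ _))// rnormN lerD
  ?FK//; first exact: D0.
  by apply: grid_simple_le => //; exact: D0.
move: c; rewrite Rintegral_cst// mul0r => c.
apply/fine_cvgP; split=> //; apply: nearW => k.
exact: integrable_fin_num (iF k).
Qed.

Lemma grid_bochner (F : R -> X) (K : R) y :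
  (forall t, 0 <= t -> rnorm (F t) <= K) -> (forall t, D t -> seqcont_at F t) ->
  (fun k => simple_int mu D (grid_simple F k)) @ \oo --> y -> is_bochner mu D F y.
Proof.
move=> FK Fc Fy; exists (grid_simple F); split => //.
- by move=> k; exact: measurable_grid_simple.
- by move=> t Dt; apply: grid_simple_cvg; [exact: D0|exact: Fc].
- exact: grid_L1_cvg FK Fc.
Qed.

(** The Riemann sums over the grids are Cauchy, because the corresponding
    simple functions converge in mean. *)
Lemma bochner_ex (F : R -> X) (K : R) :
  (forall t, 0 <= t -> rnorm (F t) <= K) -> (forall t, D t -> seqcont_at F t) ->
  exists y, is_bochner mu D F y.
Proof.
move=> FK Fc.
suff /cvg_ex[y hy] : cvgn (fun k => simple_int mu D (grid_simple F k)).
  by exists y; exact: grid_bochner FK Fc hy.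
have /fine_cvgP[[N1 _ fN] /cvgrPdist_lt c] := grid_L1_cvg FK Fc.
apply: cauchy_cvg; apply: cauchy_exP => e e0.
have e0' : 0 < complex.Re e / 2 by rewrite divr_gt0//; move: e0; rewrite ltcE => /andP[_].
have [N2 _ cN] := c _ e0'.
pose N := maxn N1 N2; exists (simple_int mu D (grid_simple F N)).
exists N => // n /= Nn.
rewrite -ball_normE /ball_/= rnormE.
move: e0 (e0'); rewrite !ltcE => /andP[/eqP -> _] _ /=; rewrite eqxx /=.
have ms k := @measurable_grid_simple R X F k.
have gc t : D t -> (fun k => simple_eval (grid_simple F k) t) @ \oo --> F t.
  by move=> Dt; apply: grid_simple_cvg; [exact: D0|exact: Fc].
have a k : (maxn N1 N2 <= k)%N ->
  (\int[mu]_(t in D) (rnorm (F t - simple_eval (grid_simple F k) t))%:E < (complex.Re e /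
  2)%:E)%E.
  rewrite geq_max => /andP[k1 k2]; have := cN _ k2; rewrite /= sub0r normrN.
  rewrite ger0_norm ?fine_ge0 ?integral_ge0// => [|t _]; last by rewrite lee_fin;
    exact: rnorm_ge0.
  by rewrite -lte_fin fineK//; apply: fN.
rewrite -lte_fin [complex.Re e]splitr EFinD.
apply: le_lt_trans (lteD (a N (leqnn _)) (a n Nn)).
apply: le_trans (simple_int_dist mu mD (ms N) (ms n)) _.
rewrite -ge0_integralD//; last 4 first.
- by move=> t _; rewrite lee_fin; exact: rnorm_ge0.
- by apply/measurable_EFinP; exact: measurable_rnorm_limB.
- by move=> t _; rewrite lee_fin; exact: rnorm_ge0.
- by apply/measurable_EFinP; exact: measurable_rnorm_limB.
apply: ge0_le_integral => //.
- by move=> t _; rewrite lee_fin; exact: rnorm_ge0.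
- by apply/measurable_EFinP; exact: measurable_rnorm_simpleB.
- by apply: emeasurable_funD; apply/measurable_EFinP; exact: measurable_rnorm_limB.
move=> t _; rewrite -EFinD lee_fin.
rewrite [X in _ <= X + _]rnorm_distC; apply: le_trans (rnormD _ _).
by rewrite addrA subrK.
Qed.

(** Along the grids, the simple integrals of [h v] are real Riemann sums of [h]
    times [v]. *)
Lemma bochner_scalar (h : R -> R) (K : R) (v : X) :
  (forall t, 0 <= t -> `|h t| <= K) ->
  (forall t, D t -> forall u : nat -> R, (forall n, 0 <= u n) -> u @ \oo --> t ->
    (fun n => h (u n)) @ \oo --> h t) ->
  is_bochner mu D (fun t => (h t)%:C *: v) ((\int[mu]_(t in D) h t)%:C *: v).
Proof.
move=> hK hc; have [_ _ c] := grid_real_integral hK hc.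
apply: (@grid_bochner _ (K * rnorm v)).
- by move=> t t0; rewrite rnormZ ler_wpM2r ?rnorm_ge0// hK.
- by move=> t Dt u u0 ut; apply: cvg_scale_real; [exact: cvg_cst|exact: hc].
have -> : (fun k => simple_int mu D (grid_simple (fun t => (h t)%:C *: v) k)) =
   (fun k => (real_simple_int [seq (p.1, h p.2) | p <- grid R k])%:C *: v).
  apply/funext => k; rewrite /simple_int /real_simple_int !big_map rmorph_sum scaler_suml.
  by apply: eq_bigr => p _; rewrite /= rmorphM scalerA.
by apply: cvg_scale_real => //; exact: cvg_cst.
Qed.

End Existence.

(** * Normal functionals and uniqueness of symbols *)

Section Normal.
Variables (R : realType) (X : completeNormedModType R[i]).
Let RB := measurableTypeR R.
Implicit Types (F G : R -> X) (K N : R) (L : (R -> X) -> X).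

Definition bdd_seqcont K F := (forall t, 0 <= t -> rnorm (F t) <= K) /\
  (forall t, 0 <= t -> seqcont_at F t).

Definition exp_vec (x : R) (v : X) (t : R) : X := (expR (- (x * t)))%:C *: v.

(** The abstract form of integration against a bounded measure, in which
    convolution is composition and needs no product measure. *)
Record normal_functional N L : Prop := Normal {
  normal_ge0 : 0 <= N;
  normalD : forall K K' F G, bdd_seqcont K F -> bdd_seqcont K' G ->
    L (fun t => F t + G t) = L F + L G;
  normalZ : forall K F c, bdd_seqcont K F -> L (fun t => c%:C *: F t) = c%:C *: L F;
  normal_le : forall K F, bdd_seqcont K F -> rnorm (L F) <= N * K;
  normal_dct : forall K (Fn : nat -> R -> X) F, (forall n, bdd_seqcont K (Fn n)) ->
    bdd_seqcont K F ->
    (forall t, 0 <= t -> (fun n => Fn n t) @ \oo --> F t) ->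
    (fun n => L (Fn n)) @ \oo --> L F }.

(** The Laplace transform of the functional, restricted to the positive reals. *)
Definition symbol L (lam : R -> R[i]) :=
  forall x v, 0 < x -> L (exp_vec x v) = lam x *: v.

Lemma bdd_seqcont_ge0 K F : bdd_seqcont K F -> 0 <= K.
Proof. by move=> [h _]; apply: le_trans (h 0 _); rewrite ?rnorm_ge0. Qed.

Lemma bdd_seqcontD K K' F G : bdd_seqcont K F -> bdd_seqcont K' G ->
  bdd_seqcont (K + K') (fun t => F t + G t).
Proof.
move=> [h c] [h' c']; split=> t t0; first by rewrite (le_trans (rnormD _ _))// lerD ?h ?h'.
by move=> u u0 ut; apply: cvgD; [exact: c|exact: c'].
Qed.

Lemma bdd_seqcontZ K F c : bdd_seqcont K F -> bdd_seqcont (`|c| * K) (fun t => c%:C *: F t).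
Proof.
move=> [h d]; split=> t t0; first by rewrite rnormZ ler_wpM2l ?h.
by move=> u u0 ut; apply: cvg_scale_real; [exact: d|exact: cvg_cst].
Qed.

Lemma bdd_seqcontN K F : bdd_seqcont K F -> bdd_seqcont K (fun t => - F t).
Proof.
move=> [h d]; split=> t t0; first by rewrite rnormN h.
by move=> u u0 ut; apply: cvgN; exact: d.
Qed.

Lemma bdd_seqcont_le K K' F : K <= K' -> bdd_seqcont K F -> bdd_seqcont K' F.
Proof. by move=> KK [h c]; split=> // t t0; exact: le_trans (h _ t0) KK. Qed.

Lemma bdd_seqcont_ext K F G : (forall t, 0 <= t -> F t = G t) -> bdd_seqcont K F ->
  bdd_seqcont K G.
Proof.
move=> FG [h c]; split=> t t0; first by rewrite -FG// h.
move=> u u0 ut; rewrite -FG// (_ : (fun n => G (u n)) = (fun n => F (u n))).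
  exact: c.
by apply/funext => n; rewrite FG.
Qed.

Lemma bdd_seqcont_cst v : bdd_seqcont (rnorm v) (fun=> v).
Proof. by split=> // t t0 u _ _; exact: cvg_cst. Qed.

Lemma bdd_seqcont_exp_vec x v : 0 < x -> bdd_seqcont (rnorm v) (exp_vec x v).
Proof.
move=> x0; split=> t t0.
  rewrite rnormZ ger0_norm ?expR_ge0// ler_piMl ?rnorm_ge0// -expR0 ler_expR.
  by rewrite oppr_le0 mulr_ge0// ltW.
move=> u u0 ut; apply: cvg_scale_real; first exact: cvg_cst.
apply: (@cvg_comp _ _ _ (fun n => - (x * u n)) expR _ _ _ _ (@continuous_expR R _)).
by apply: cvgN; apply: cvgMr.
Qed.

Lemma bdd_seqcont_shift K F s : 0 <= s -> bdd_seqcont K F ->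
  bdd_seqcont K (fun r => F (s + r)).
Proof.
move=> s0 [h c]; split=> t t0; first by rewrite h ?addr_ge0.
move=> u u0 ut; apply: (c _ (addr_ge0 s0 t0) (fun n => s + u n)) => [n|].
  by rewrite addr_ge0.
by apply: cvgD => //; exact: cvg_cst.
Qed.

Lemma bdd_seqcont_dilate K F s : 0 <= s -> bdd_seqcont K F ->
  bdd_seqcont K (fun r => F (s * r)).
Proof.
move=> s0 [h c]; split=> t t0; first by rewrite h ?mulr_ge0.
move=> u u0 ut; apply: (c _ (mulr_ge0 s0 t0) (fun n => s * u n)) => [n|].
  by rewrite mulr_ge0.
by apply: cvgMr.
Qed.

Lemma normalN N L K F : normal_functional N L -> bdd_seqcont K F ->
  L (fun t => - F t) = - L F.
Proof.
move=> nL FK; have := normalZ nL (-1) FK.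
rewrite rmorphN1 scaleN1r => <-; congr L; apply/funext => t.
by rewrite scaleN1r.
Qed.

Lemma normal_ext N L K F G : normal_functional N L -> bdd_seqcont K F ->
  (forall t, 0 <= t -> F t = G t) -> L F = L G.
Proof.
move=> nL FK FG; have GK := bdd_seqcont_ext FG FK.
have c : bdd_seqcont 0 (fun t => F t + - G t).
  have [h c] := bdd_seqcontD FK (bdd_seqcontN GK); split=> // t t0.
  by rewrite FG// subrr rnorm0.
have := normal_le nL c; rewrite (normalD nL FK (bdd_seqcontN GK)) (normalN nL GK) mulr0
  => h.
by apply/eqP; rewrite -subr_eq0; apply/eqP/rnorm0_eq0/eqP; rewrite eq_le h rnorm_ge0.
Qed.

Lemma normal_weak N N' L : N <= N' -> normal_functional N L -> normal_functional N' L.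
Proof.
move=> NN [a b c d e]; split=> //; first exact: le_trans NN.
by move=> K F FK; rewrite (le_trans (d _ _ FK))// ler_wpM2r// (bdd_seqcont_ge0 FK).
Qed.

Lemma seqcont_eps F t : seqcont_at F t -> forall e, 0 < e ->
  exists2 d, 0 < d & forall s, 0 <= s -> `|s - t| < d -> rnorm (F s - F t) < e.
Proof.
move=> c e e0; apply: contrapT => h.
have H (n : nat) : exists s, [/\ 0 <=
  s, `|s - t| < n.+1%:R^-1 & ~~ (rnorm (F s - F t) < e)].
  apply: contrapT => h'; apply: h; exists n.+1%:R^-1; first by rewrite invr_gt0 ltr0n.
  move=> s s0 st; apply: contrapT => h''; apply: h'; exists s; split=> //.
  exact/negP.
have [u hu] := choice H.
have ut : u @ \oo --> t.
  apply: (@squeeze_cvgr _ _ _ _ (fun n => t - n.+1%:R^-1) (fun n => t + n.+1%:R^-1)).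
  - apply: nearW => n /=; have [_ + _] := hu n.
    by rewrite ltr_distl => /andP[/ltW -> /ltW ->].
  - rewrite -[X in _ --> X]subr0; apply: cvgB; first exact: cvg_cst.
    exact: (@cvg_harmonic R).
  - rewrite -[X in _ --> X]addr0; apply: cvgD; first exact: cvg_cst.
    exact: (@cvg_harmonic R).
have u0 n : 0 <= u n by have [] := hu n.
have /cvg_rnormP/cvgrPdist_lt/(_ _ e0)[n _ /(_ n (leqnn n))] := c u u0 ut.
rewrite /= sub0r normrN ger0_norm ?rnorm_ge0//.
by have [_ _ /negP] := hu n.
Qed.

(** Bernstein polynomials by de Casteljau recursion on the values [phi k] at
    k / n; binomial coefficients never appear. *)
Fixpoint bernstein n (p : R) (phi : nat -> X) : X :=
  if n is m.+1 then (1 - p)%:C *: bernstein m p phi + p%:C *: bernstein m p (phi \o S)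
  else phi 0%N.

(** The variance bound n p (1 - p) + (n p - a)^2 of the binomial law, in the form
    that survives the recursion: shifting [phi] amounts to decreasing [a]. *)
Lemma bernstein_dist n (p a A B : R) phi c : 0 <= p <= 1 ->
  (forall k, rnorm (phi k - c) <= A + B * (k%:R - a) ^+ 2) ->
  rnorm (bernstein n p phi - c) <= A + B * (n%:R * p * (1 - p) + (n%:R * p - a) ^+ 2).
Proof.
move=> /andP[p0 p1]; elim: n a phi => [|n IH] a phi H /=.
  by rewrite !mul0r add0r; exact: H.
have -> : (1 - p)%:C *: bernstein n p phi + p%:C *: bernstein n p (phi \o S) - c =
  (1 - p)%:C *: (bernstein n p phi - c) + p%:C *: (bernstein n p (phi \o S) - c).
  rewrite !scalerBr addrACA -opprD -scalerDl -rmorphD subrK scale1r.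
  by [].
have h1 := IH a phi H.
have h2 : rnorm (bernstein n p (phi \o S) - c) <=
  A + B * (n%:R * p * (1 - p) + (n%:R * p - (a - 1)) ^+ 2).
  apply: IH => k; rewrite (le_trans (H k.+1))// -natr1.
  by rewrite (_ : k%:R + 1 - a = k%:R - (a - 1))//; ring.
apply: le_trans (rnormD _ _) _; rewrite !rnormZ !ger0_norm ?subr_ge0//.
apply: le_trans (lerD (ler_wpM2l _ h1) (ler_wpM2l p0 h2)) _; first by rewrite subr_ge0.
rewrite -natr1 le_eqVlt; apply/orP; left; apply/eqP; ring.
Qed.

Lemma bernstein_le n (p K : R) phi : 0 <= p <= 1 -> (forall k, rnorm (phi k) <= K) ->
  rnorm (bernstein n p phi) <= K.
Proof.
move=> p01 H; have := @bernstein_dist n p 0 K 0 phi 0 p01.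
rewrite !mul0r addr0 subr0; apply => k; by rewrite subr0 mul0r addr0.
Qed.

(** The functions on which two functionals coincide; boundedness and continuity
    are carried along to allow linear combinations. *)
Definition agree L L' F := L F = L' F /\ exists K, bdd_seqcont K F.

Lemma agree_ext N N' L L' F G : normal_functional N L -> normal_functional N' L' ->
  agree L L' F ->
  (forall t, 0 <= t -> F t = G t) -> agree L L' G.
Proof.
move=> nL nL' [e [K FK]] FG; split; last by exists K; exact: bdd_seqcont_ext FK.
by rewrite -(normal_ext nL FK FG) -(normal_ext nL' FK FG).
Qed.

Lemma agreeB N N' L L' F G : normal_functional N L -> normal_functional N' L' ->
  agree L L' F -> agree L L' G ->
  agree L L' (fun t => F t - G t).
Proof.
move=> nL nL' [e [K FK]] [e' [K' GK]]; split; last first.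
  by exists (K + K'); exact: bdd_seqcontD FK (bdd_seqcontN GK).
by rewrite (normalD nL FK (bdd_seqcontN GK)) (normalD nL' FK (bdd_seqcontN GK)) (normalN
  nL GK) (normalN nL' GK) e e'.
Qed.

Lemma agreeD N N' L L' F G : normal_functional N L -> normal_functional N' L' ->
  agree L L' F -> agree L L' G ->
  agree L L' (fun t => F t + G t).
Proof.
move=> nL nL' [e [K FK]] [e' [K' GK]]; split; last first.
  by exists (K + K'); exact: bdd_seqcontD FK GK.
by rewrite (normalD nL FK GK) (normalD nL' FK GK) e e'.
Qed.

Section Uniq.
Variables (N N' : R) (L L' : (R -> X) -> X).
Hypotheses (nL : normal_functional N L) (nL' : normal_functional N' L').
Hypothesis LL : forall (k : nat) v, (0 < k)%N -> L (exp_vec k%:R v) = L' (exp_vec k%:R v).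

Let p (t : R) := expR (- t).

(** Everything is divisible by p = e^(- t), so only exponentials e^(- k t) with
    k >= 1 occur. *)
Lemma agree_bernstein_pos n m phi : (0 < m)%N ->
  agree L L' (fun t => (p t ^+ m)%:C *: bernstein n (p t) phi).
Proof.
elim: n m phi => [|n IH] m phi m0 /=.
  have m0R : 0 < m%:R :> R by rewrite ltr0n.
  apply: (agree_ext nL nL' (F := exp_vec m%:R (phi 0%N))).
    by split; [exact: LL|exists (rnorm (phi 0%N)); exact: bdd_seqcont_exp_vec].
  by move=> t t0; rewrite /exp_vec /p -expRM_natl mulrN.
apply: (agree_ext nL nL' (agreeD nL nL' (agreeB nL nL' (IH m phi m0) (IH m.+1 phi isT))
  (IH m.+1 (phi \o S) isT))).
move=> t t0; rewrite scalerDr !scalerA -scalerBl -!rmorphM -rmorphB.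
by rewrite mulrBr mulr1 !exprSr.
Qed.

(** The condition on [phi 0] removes the constant term of the polynomial, which
    is not a combination of decaying exponentials. *)
Lemma agree_bernstein n phi : phi 0%N = 0 -> agree L L' (fun t => bernstein n (p t) phi).
Proof.
move=> phi0; elim: n => [|n IH] /=.
  rewrite phi0; split; last by exists (rnorm (0 : X)); exact: bdd_seqcont_cst.
  have e0 : bdd_seqcont 0 (fun=> (0 : X)) by have := bdd_seqcont_cst 0; rewrite rnorm0.
  have h N0 L0 : normal_functional N0 L0 -> L0 (fun=> 0) = 0.
    move=> n0; have := normal_le n0 e0; rewrite mulr0 => h.
    by apply/rnorm0_eq0/eqP; rewrite eq_le h rnorm_ge0.
  by rewrite (h _ _ nL) (h _ _ nL').
apply: (agree_ext nL nL' (agreeD nL nL' (agreeB nL nL' IH (agree_bernstein_pos n phi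
  (ltn0Sn 0))) (agree_bernstein_pos n (phi \o S) (ltn0Sn 0)))).
by move=> t t0; rewrite expr1 rmorphB scalerBl rmorph1 scale1r.
Qed.

(** Uniqueness of the Laplace transform.  In the variable p = e^(- t) in (0, 1],
    a bounded continuous [F] is the bounded pointwise limit of Bernstein
    polynomials vanishing at p = 0, on which the functionals agree. *)
Lemma normal_uniq K F : bdd_seqcont K F -> L F = L' F.
Proof.
move=> FK; have K0 := bdd_seqcont_ge0 FK.
(* The value at y = 0 makes the constant term vanish; the maximum keeps the
   argument in [0, oo) for the nodes k > n. *)
pose H (y : R) := if y == 0 then 0 else F (Num.max 0 (- ln y)).
pose Fn n t := bernstein n.+1 (p t) (fun k => H (k%:R / n.+1%:R)).
have Hle y : rnorm (H y) <= K.
  by rewrite /H; case: ifP => _; [rewrite rnorm0|case: FK => + _; apply;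
    rewrite le_max lexx].
have H0 n : H (0%:R / n.+1%:R) = 0 by rewrite /H mul0r eqxx.
have p01 t : 0 <= t -> 0 <= p t <= 1.
  by move=> t0; rewrite expR_ge0/= -expR0 ler_expR oppr_le0.
have FnC n : bdd_seqcont K (Fn n).
  have [_ [K' [_ c]]] := @agree_bernstein n.+1 (fun k => H (k%:R / n.+1%:R)) (H0 n).
  by split=> // t t0; apply: bernstein_le => //; exact: p01.
have FnF t : 0 <= t -> (fun n => Fn n t) @ \oo --> F t.
  move=> t0; apply/cvg_rnormP.
  have [hK hc] := FK.
  have pt0 : 0 < p t by exact: expR_gt0.
  apply/cvgrPdist_lt => e e0; have e20 : 0 < e / 2 by rewrite divr_gt0.
  have [d d0 hd] := seqcont_eps (hc _ t0) e20.
  have [d' d'0 hd'] : exists2 d', 0 < d' & forall y, `|y - p t| < d' ->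
     rnorm (H y - F t) <= e / 2.
    have /cvgrPdist_lt/(_ _ d0) := continuous_ln pt0.
    move=> /nbhs_ballP[r /= r0 hr]; exists (Num.min r (p t));
      first by rewrite lt_min r0 pt0.
    move=> y; rewrite lt_min => /andP[yr yp].
    have y0 : 0 < y.
      by move: yp; rewrite ltr_distl subrr => /andP[].
    rewrite /H gt_eqF//; apply/ltW/hd; first by rewrite le_max lexx.
    have := hr y; rewrite /ball/= distrC => /(_ yr); rewrite expRK.
    rewrite !ltr_norml => /andP[h1 h2].
    by case: (leP 0 (- ln y)) => hy; apply/andP; split; lra.
  (* Away from p the distance is at most 2 K, and there (y - p)^2 >= d'^2. *)
  pose B := 2 * K / d' ^+ 2.
  have B0 : 0 <= B by rewrite divr_ge0 ?mulr_ge0 ?exprn_ge0// ltW.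
  have key n : rnorm (Fn n t - F t) <= e / 2 + B / n.+1%:R.
    have n0 : 0 < n.+1%:R :> R by rewrite ltr0n.
    have := @bernstein_dist n.+1 (p t) (n.+1%:R * p t) (e / 2) (B / n.+1%:R ^+ 2)
      (fun k => H (k%:R / n.+1%:R)) (F t) (p01 _ t0).
    have h k : rnorm (H (k%:R / n.+1%:R) - F t) <=
      e / 2 + B / n.+1%:R ^+ 2 * (k%:R - n.+1%:R * p t) ^+ 2.
      have -> : B / n.+1%:R ^+ 2 * (k%:R - n.+1%:R * p t) ^+ 2 =
        B * (k%:R / n.+1%:R - p t) ^+ 2.
        by field; rewrite gt_eqF.
      have [h|h] := ltP `|k%:R / n.+1%:R - p t| d'.
        by rewrite (le_trans (hd' _ h))// lerDl mulr_ge0// sqr_ge0.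
      rewrite (le_trans (rnormD _ _))// rnormN (le_trans (lerD (Hle _) (hK _ t0)))//.
      rewrite -[leLHS]add0r lerD ?(ltW e20)// -mulr2n -[K *+ 2]mulr_natl /B.
      rewrite (_ : forall b c : R, 2 * K / b * c = 2 * K * (c / b)); last by move=> b c;
        ring.
      rewrite ler_peMr ?mulr_ge0// ler_pdivlMr ?exprn_gt0// mul1r.
      by rewrite -[X in _ <= X]real_normK ?num_real// lerXn2r// ?nnegrE ?normr_ge0// ltW.
    move=> /(_ h) /le_trans; apply; rewrite subrr expr0n addr0 lerD2l.
    have /andP[q0 q1] := p01 _ t0.
    have -> : B / n.+1%:R ^+ 2 * (n.+1%:R * p t * (1 - p t)) =
      B / n.+1%:R * (p t * (1 - p t)).
      by field; rewrite gt_eqF.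
    apply: ler_piMr; first by rewrite divr_ge0// ler0n.
    by rewrite mulr_ile1// ?subr_ge0// gerBl.
  have [n0 Hn0] : exists n0, forall n, (n0 <= n)%N -> B / n.+1%:R < e / 2.
    exists (Num.truncn (B / (e / 2))) => n nn.
    rewrite ltr_pdivrMr ?ltr0n// mulrC -ltr_pdivrMr//.
    have /andP[_ h] := Num.Theory.truncn_itv (divr_ge0 B0 (ltW e20)).
    by apply: lt_le_trans h _; rewrite ler_nat ltnS.
  exists n0 => // n /= /Hn0 h; rewrite sub0r normrN ger0_norm ?rnorm_ge0//.
  by rewrite (le_lt_trans (key n))// [ltRHS]splitr ltrD2l.
have c := normal_dct nL FnC FK FnF; have c' := normal_dct nL' FnC FK FnF.
have ee : (fun n => L (Fn n)) = (fun n => L' (Fn n)).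
  by apply/funext => n; have [] := @agree_bernstein n.+1 (fun k => H (k%:R / n.+1%:R))
    (H0 n).
rewrite ee in c.
exact: (cvg_unique _ c c').
Qed.
End Uniq.

End Normal.

(** * The algebra of symbols *)

Section Symbols.
Variables (R : realType) (X : completeNormedModType R[i]).
Let RB := measurableTypeR R.
Implicit Types (F G : R -> X) (K N : R) (L : (R -> X) -> X) (lam : R -> R[i]).

Definition has_symbol N lam L := normal_functional N L /\ symbol L lam.

Lemma has_symbol_uniq N lam L N' lam' L' K F : has_symbol N lam L ->
  has_symbol N' lam' L' ->
  (forall x, 0 < x -> lam x = lam' x) -> bdd_seqcont K F -> L F = L' F.
Proof.
move=> [nL sL] [nL' sL'] e; apply: (normal_uniq nL nL') => k v k0.
by rewrite sL ?sL' ?e ?ltr0n.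
Qed.

Lemma has_symbol_delta t : 0 <= t ->
  has_symbol 1 (fun x => (expR (- (x * t)))%:C) (fun F => F t).
Proof.
move=> t0; split; last by [].
split=> //.
- by move=> K F [h _]; rewrite mul1r h.
- by move=> K Fn F _ _; apply.
Qed.

Lemma has_symbol_add N lam L N' lam' L' : has_symbol N lam L -> has_symbol N' lam' L' ->
  has_symbol (N + N') (fun x => lam x + lam' x) (fun F => L F + L' F).
Proof.
move=> [[a b c d e] f] [[a' b' c' d' e'] f']; split.
  split.
  - exact: addr_ge0.
  - by move=> K K' F G FK GK; rewrite (b _ _ _ _ FK GK) (b' _ _ _ _ FK GK) addrACA.
  - by move=> K F z FK; rewrite (c _ _ _ FK) (c' _ _ _ FK) scalerDr.
  - by move=> K F FK; rewrite (le_trans (rnormD _ _))// mulrDl lerD ?d ?d'.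
  - by move=> K Fn F h h' h''; apply: cvgD; [exact: e h h' h''|exact: e' h h' h''].
by move=> x v x0; rewrite f// f'// scalerDl.
Qed.

Lemma has_symbol_scale N lam L (c : R[i]) : has_symbol N lam L ->
  has_symbol (complex.Re `|c| * N) (fun x => c * lam x) (fun F => c *: L F).
Proof.
move=> [[a b z d e] f]; split.
  split.
  - by rewrite mulr_ge0//; have := normr_ge0 c; rewrite lecE => /andP[].
  - by move=> K K' F G FK GK; rewrite (b _ _ _ _ FK GK) scalerDr.
  - by move=> K F y FK; rewrite (z _ _ _ FK) !scalerA mulrC.
  - move=> K F FK; rewrite rnormZC -mulrA ler_wpM2l ?d//.
    by have := normr_ge0 c; rewrite lecE => /andP[].
  - by move=> K Fn F h h' h''; apply: cvgZ; [exact: cvg_cst|exact: e h h' h''].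
by move=> x v x0; rewrite f// scalerA.
Qed.

Lemma has_symbol_scaleR N lam L (c : R) : has_symbol N lam L ->
  has_symbol (`|c| * N) (fun x => c%:C * lam x) (fun F => c%:C *: L F).
Proof.
by move=> h; have := has_symbol_scale c%:C h;
  rewrite normc_def /= expr0n /= addr0 sqrtr_sqr.
Qed.

Lemma normal_shift N L K F : normal_functional N L -> bdd_seqcont K F ->
  bdd_seqcont (N * K) (fun s => L (fun r => F (s + r))).
Proof.
move=> nL FK; split=> t t0; first exact: normal_le (bdd_seqcont_shift t0 FK).
move=> u u0 ut; apply: (normal_dct nL (K := K)).
- by move=> n; exact: bdd_seqcont_shift.
- exact: bdd_seqcont_shift.
- move=> r r0; case: FK => _ c; apply: (c _ (addr_ge0 t0 r0) (fun n => u n + r)) => [n|].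
    by rewrite addr_ge0.
  by apply: cvgD => //; exact: cvg_cst.
Qed.

(** Convolution.  Bounded convergence makes [s |-> L' (F (s + .))] continuous, so
    that [L] can be applied to it. *)
Lemma has_symbol_conv N lam L N' lam' L' : has_symbol N lam L -> has_symbol N' lam' L' ->
  has_symbol (N * N') (fun x => lam x * lam' x)
    (fun F => L (fun s => L' (fun r => F (s + r)))).
Proof.
move=> [nL f] [nL' f']; have [a b c d e] := nL; have [a' b' c' d' e'] := nL'.
split.
  split.
  - exact: mulr_ge0.
  - move=> K K' F G FK GK.
    have h1 := normal_shift nL' FK; have h2 := normal_shift nL' GK.
    rewrite -(b _ _ _ _ h1 h2); apply: (normal_ext nL).
      exact: normal_shift nL' (bdd_seqcontD FK GK).
    by move=> s s0; rewrite (b' _ _ _ _ (bdd_seqcont_shift s0 FK) (bdd_seqcont_shift s0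
      GK)).
  - move=> K F z FK; have h1 := normal_shift nL' FK.
    rewrite -(c _ _ _ h1); apply: (normal_ext nL).
      exact: normal_shift nL' (bdd_seqcontZ z FK).
    by move=> s s0; rewrite (c' _ _ _ (bdd_seqcont_shift s0 FK)).
  - by move=> K F FK; rewrite -mulrA d//; exact: normal_shift nL' FK.
  - move=> K Fn F h h' h''.
    apply: (e (N' * K) (fun n s => L' (fun r => Fn n (s + r))) (fun s => L' (fun r => F
      (s + r)))).
    + by move=> n; exact: normal_shift nL' (h n).
    + exact: normal_shift nL' h'.
    move=> t t0; apply: (e' K (fun n r => Fn n (t + r)) (fun r => F (t + r))).
    + by move=> n; exact: bdd_seqcont_shift.
    + exact: bdd_seqcont_shift.
    by move=> r r0; apply: h''; rewrite addr_ge0.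
move=> x v x0.
have E s : L' (fun r => exp_vec x v (s + r)) = exp_vec x (lam' x *: v) s.
  have -> : (fun r => exp_vec x v (s + r)) =
    (fun r => (expR (- (x * s)))%:C *: exp_vec x v r).
    by apply/funext => r; rewrite /exp_vec scalerA -rmorphM -expRD mulrDr opprD.
  by rewrite (c' _ _ _ (bdd_seqcont_exp_vec v x0)) f'.
rewrite (_ : (fun s => _) = exp_vec x (lam' x *: v)); last exact/funext.
by rewrite f// scalerA.
Qed.

Lemma has_symbol_dilate N lam L (th : R) : 0 < th -> has_symbol N lam L ->
  has_symbol N (fun x => lam (th * x)) (fun F => L (fun r => F (th * r))).
Proof.
move=> th0 [[a b c d e] f]; split.
  split=> //.
  - by move=> K K' F G FK GK; rewrite (b _ _ _ _ (bdd_seqcont_dilate (ltW th0) FK)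
    (bdd_seqcont_dilate (ltW th0) GK)).
  - by move=> K F z FK; rewrite (c _ _ _ (bdd_seqcont_dilate (ltW th0) FK)).
  - by move=> K F FK; apply: d; exact: bdd_seqcont_dilate (ltW th0) FK.
  - move=> K Fn F h h' h''; apply: (e K (fun n r => Fn n (th * r)) (fun r => F (th * r))).
    + by move=> n; exact: bdd_seqcont_dilate (ltW th0) (h n).
    + exact: bdd_seqcont_dilate (ltW th0) h'.
    + by move=> t t0; apply: h''; rewrite mulr_ge0// ltW.
move=> x v x0; rewrite -f ?mulr_gt0//; congr L; apply/funext => r.
by rewrite /exp_vec mulrA [x * th]mulrC.
Qed.

Lemma has_symbol_ext N lam lam' L : (forall x, 0 < x -> lam x = lam' x) ->
  has_symbol N lam L -> has_symbol N lam' L.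
Proof. by move=> e [a b]; split=> // x v x0; rewrite b// e. Qed.

Lemma has_symbol_weak N N' lam L : N <= N' -> has_symbol N lam L -> has_symbol N' lam L.
Proof. by move=> NN [a b]; split=> //; exact: normal_weak a. Qed.

Section BoundedOperator.
Variables (S : X -> X) (C : R).
Hypotheses (C0 : 0 <= C) (SD : forall v w, S (v + w) = S v + S w)
  (SZ : forall (c : R[i]) v, S (c *: v) = c *: S v) (SC :
    forall v, rnorm (S v) <= C * rnorm v).

Lemma bounded_op_cvg (u : nat -> X) l : u @ \oo --> l -> (fun n => S (u n)) @ \oo --> S l.
Proof.
move=> /cvg_rnormP ul; apply/cvg_rnormP.
have c : (fun n => C * rnorm (u n - l)) @ \oo --> (0 : R).
  by rewrite -(mulr0 C); apply: cvgMr.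
apply: (squeeze_cvgr _ (cvg_cst 0) c); apply: nearW => n.
by rewrite rnorm_ge0 -scaleN1r -SZ -SD scaleN1r SC.
Qed.

Lemma bounded_op_seqcont K F : bdd_seqcont K F -> bdd_seqcont (C * K) (fun t => S (F t)).
Proof.
move=> [h c]; split=> t t0; first by rewrite (le_trans (SC _))// ler_wpM2l// h.
by move=> u u0 ut; apply: bounded_op_cvg; exact: c.
Qed.

(** Both sides are normal functionals of [F] with the same values on
    exponentials. *)
Lemma normal_bounded N lam L K F : has_symbol N lam L -> bdd_seqcont K F ->
  L (fun t => S (F t)) = S (L F).
Proof.
move=> [nL sL] FK; have [a b c d e] := nL.
apply: (@normal_uniq R X (N * C) (C * N) (fun G => L (fun t => S (G t))) (fun G => S (L
  G)) _ _ _ _ _ FK).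
- split.
  + exact: mulr_ge0.
  + move=> K1 K2 G H GK HK; rewrite -(b _ _ _ _ (bounded_op_seqcont GK)
    (bounded_op_seqcont HK)).
    by congr L; apply/funext => t; rewrite SD.
  + move=> K1 G z GK; rewrite -(c _ _ _ (bounded_op_seqcont GK)).
    by congr L; apply/funext => t; rewrite SZ.
  + by move=> K1 G GK; rewrite -mulrA d//; exact: bounded_op_seqcont GK.
  + move=> K1 Fn G h h' h''; apply: (e (C * K1) (fun n t => S (Fn n t)) (fun t => S (G t))).
    * by move=> n; exact: bounded_op_seqcont (h n).
    * exact: bounded_op_seqcont h'.
    * by move=> t t0; apply: bounded_op_cvg; exact: h''.
- split.
  + exact: mulr_ge0.
  + by move=> K1 K2 G H GK HK; rewrite (b _ _ _ _ GK HK) SD.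
  + by move=> K1 G z GK; rewrite (c _ _ _ GK) SZ.
  + by move=> K1 G GK; rewrite (le_trans (SC _))// -mulrA ler_wpM2l// d.
  + by move=> K1 Fn G h h' h''; apply: bounded_op_cvg; exact: e h h' h''.
move=> k v k0; rewrite sL ?ltr0n// SZ -(sL _ (S v)) ?ltr0n//.
by congr L; apply/funext => t; rewrite /exp_vec SZ.
Qed.
End BoundedOperator.

(** A Bochner integral over [D] of normal functionals [H . t] is normal: this
    covers measures, mixtures of dilations and reflected differences alike. *)
Section Mixture.
Variables (mu : {finite_measure set RB -> \bar R}) (D : set RB).
Hypotheses (mD : measurable D) (D0 : forall t, D t -> 0 <= t).
Variables (N : R) (H : (R -> X) -> R -> X).
Hypotheses (N0 : 0 <= N)
  (H_le : forall K F, bdd_seqcont K F -> forall t, 0 <= t -> rnorm (H F t) <= N * K)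
  (H_cont : forall K F, bdd_seqcont K F -> forall t, D t -> seqcont_at (H F) t)
  (HD : forall K K' F G, bdd_seqcont K F -> bdd_seqcont K' G -> forall t, D t ->
     H (fun s => F s + G s) t = H F t + H G t)
  (HZ : forall K F (c : R), bdd_seqcont K F -> forall t, D t ->
     H (fun s => c%:C *: F s) t = c%:C *: H F t)
  (H_dct : forall K (Fn : nat -> R -> X) F, (forall n, bdd_seqcont K (Fn n)) ->
    bdd_seqcont K F ->
    (forall t, 0 <= t -> (fun n => Fn n t) @ \oo --> F t) ->
    forall t, D t -> (fun n => H (Fn n) t) @ \oo --> H F t).

Lemma is_bochner_ext F G y : (forall t, D t -> F t = G t) -> is_bochner mu D F y ->
  is_bochner mu D G y.
Proof.
move=> FG [s [a b c d]]; exists s; split=> //.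
  by move=> t Dt; rewrite -FG//; exact: b.
move: c; rewrite (_ : (fun k => _) =
  (fun k => \int[mu]_(t in D) (complex.Re `|G t - simple_eval (s k) t|)%:E)%E)//.
by apply/funext => k; apply: eq_integral => t; rewrite inE => Dt; rewrite FG.
Qed.

Lemma bochner_measurable F y : is_bochner mu D F y ->
  measurable_fun D (fun t => rnorm (F t)).
Proof. by move=> [s [ms sF _ _]]; exact: (measurable_rnorm_lim ms sF). Qed.

Lemma mix_bochner K F : bdd_seqcont K F -> is_bochner mu D (H F) (bochner mu D (H F)).
Proof.
move=> FK; have [y hy] := bochner_ex mu mD D0 (H_le FK) (H_cont FK).
by rewrite (bochnerE mD hy).
Qed.

Lemma bochnerZ F c y : is_bochner mu D F y -> is_bochner mu D (fun t => c *: F t) (c *: y).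
Proof.
move=> hy; apply: (@is_bochner_linear R X mu D mD ( *:%R c) (complex.Re `|c|)) => //.
  by have := normr_ge0 c; rewrite lecE => /andP[].
by move=> v; rewrite rnormZC.
Qed.

Lemma normal_mix : normal_functional (fine (mu D) * N) (fun F => bochner mu D (H F)).
Proof.
have mu0 : 0 <= fine (mu D) by rewrite fine_ge0.
split.
- by rewrite mulr_ge0.
- move=> K K' F G FK GK; apply: (bochnerE mD).
  apply: is_bochner_ext (is_bochnerD mD (mix_bochner FK) (mix_bochner GK)).
  by move=> t Dt; rewrite (HD FK GK).
- move=> K F c FK; apply: (bochnerE mD).
  apply: is_bochner_ext (bochnerZ c%:C (mix_bochner FK)).
  by move=> t Dt; rewrite (HZ _ FK).
- move=> K F FK; rewrite -lee_fin; apply: le_trans (bochner_norm_le mD (mix_bochner FK)) _.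
  have mF := bochner_measurable (mix_bochner FK).
  rewrite -mulrA mulrC EFinM fineK ?fin_num_measure//.
  rewrite -integral_cst//; apply: ge0_le_integral => //.
  + by move=> t _; rewrite lee_fin; exact: rnorm_ge0.
  + exact/measurable_EFinP.
  + by move=> t Dt; rewrite lee_fin; apply: H_le => //; exact: D0.
- move=> K Fn F FnK FK FnF; apply/cvg_rnormP.
  have hb n : is_bochner mu D (fun t => H (Fn n) t + - H F t) (bochner mu D (H (Fn n)) -
    bochner mu D (H F)).
    apply: is_bochnerD => //; first exact: mix_bochner (FnK n).
    apply: (@is_bochner_linear R X mu D mD -%R 1) => //; last exact: mix_bochner FK.
    by move=> v; rewrite mul1r rnormN.
  have [|||_ _ i c] := @bounded_convergence R mu D mD (fun n t => rnorm (H (Fn n) t + - H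
    F t)) (cst 0) (N * K + N * K).
  + by move=> n; exact: bochner_measurable (hb n).
  + by move=> t Dt; apply/cvg_rnormP; exact: H_dct FnK FK FnF _ Dt.
  + move=> n t Dt; rewrite ger0_norm ?rnorm_ge0// (le_trans (rnormD _ _))// rnormN.
    by rewrite lerD// (H_le _ (D0 Dt)).
  move: c; rewrite Rintegral_cst// mul0r => c.
  apply: (squeeze_cvgr _ (cvg_cst 0) c); apply: nearW => n.
  rewrite rnorm_ge0/= -lee_fin /Rintegral fineK; last exact: integrable_fin_num (i n).
  exact: bochner_norm_le (hb n).
Qed.

Lemma has_symbol_mix (h : R -> R -> R) (K : R) :
  (forall x, 0 < x -> forall t, 0 <= t -> `|h x t| <= K) ->
  (forall x, 0 < x -> forall t, D t -> forall u : nat -> R, (forall n, 0 <= u n) ->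
    u @ \oo --> t ->
    (fun n => h x (u n)) @ \oo --> h x t) ->
  (forall x v t, 0 < x -> D t -> H (exp_vec x v) t = (h x t)%:C *: v) ->
  has_symbol (fine (mu D) * N) (fun x => (\int[mu]_(t in D) h x t)%:C)
    (fun F => bochner mu D (H F)).
Proof.
move=> hK hc Hh; split; first exact: normal_mix.
move=> x v x0; apply: (bochnerE mD).
apply: is_bochner_ext (bochner_scalar mu mD D0 v (hK _ x0) (hc _ x0)).
by move=> t Dt; rewrite Hh.
Qed.
End Mixture.

Lemma has_symbol_measure (mu : {finite_measure set RB -> \bar R}) (D : set RB) :
  measurable D -> (forall t, D t -> 0 <= t) ->
  has_symbol (fine (mu D)) (fun x => (\int[mu]_(t in D) expR (- (x * t)))%:C)
    (fun F => bochner mu D F).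
Proof.
move=> mD D0; rewrite -[fine _]mulr1.
apply: (@has_symbol_mix mu D mD D0 1 id _ _ _ _ _ _ (fun x t => expR (- (x * t))) 1) => //.
- by move=> K F [h _] t t0; rewrite mul1r h.
- by move=> K F [_ h] t Dt; apply: h; exact: D0.
- by move=> K Fn F _ _ h t Dt; apply: h; exact: D0.
- move=> x x0 t t0; rewrite ger0_norm ?expR_ge0// -expR0 ler_expR.
  by rewrite oppr_le0 mulr_ge0// ltW.
- move=> x x0 t Dt u u0 ut.
  apply: (@cvg_comp _ _ _ (fun n => - (x * u n)) expR _ _ _ _ (@continuous_expR R _)).
  by apply: cvgN; apply: cvgMr.
Qed.

End Symbols.

(** * Measures with a density *)

Section Density.
Variables (R : realType).
Let RB := measurableTypeR R.
Variables (m : {measure set RB -> \bar R}) (k : RB -> R).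

(** The two proofs are arguments so that the measure structure can be inferred
    from the term. *)
Definition density_of of measurable_fun setT k & (forall t, 0 <= k t) :=
  fun V : set RB => (\int[m]_(t in V) (k t)%:E)%E.

Hypotheses (mk : measurable_fun setT k) (k0 : forall t, 0 <= k t).
Local Notation density := (density_of mk k0).

Let density0 : density set0 = 0%E.
Proof. by rewrite /density_of integral_set0. Qed.

Let density_ge0 A : (0 <= density A)%E.
Proof. by apply: integral_ge0 => t _; rewrite lee_fin. Qed.

Let density_sigma_additive : semi_sigma_additive density.
Proof.
move=> /= F mF tF mUF; rewrite /density_of; apply: cvg_toP.
  apply: ereal_nondecreasing_is_cvgn => a b ab.
  apply: lee_sum_nneg_natr => // n _ _; apply: integral_ge0 => /= x Fkx.
  by rewrite lee_fin.
rewrite ge0_integral_bigcup//=.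
- by apply/measurable_EFinP; exact: measurable_funTS.
- by move=> x _; rewrite lee_fin.
Qed.

HB.instance Definition _ := isMeasure.Build _ _ _ density density0 density_ge0
  density_sigma_additive.

Import HBNNSimple.

Let integral_densityT (h : RB -> R) : measurable_fun setT h -> (forall t, 0 <= h t) ->
  (\int[density]_t (h t)%:E = \int[m]_t (h t * k t)%:E)%E.
Proof.
move=> mh h0.
have mh' : measurable_fun setT (EFin \o h) by exact/measurable_EFinP.
pose g := nnsfun_approx measurableT mh'.
have gh t : (EFin \o g ^~ t) @ \oo --> (h t)%:E.
  by apply: (@cvg_nnsfun_approx _ _ _ _ measurableT _ mh' _ t I) => x _; rewrite lee_fin.
have c1 : (\int[density]_t (g n t)%:E)%E @[n --> \oo] --> (\int[density]_t (h t)%:E)%E.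
  have -> : (\int[density]_t (h t)%:E = \int[density]_t (limn (fun n => (g n t)%:E)))%E.
    by apply: eq_integral => t _; apply/esym/cvg_lim => //; exact: gh.
  apply: cvg_monotone_convergence => //.
  - by move=> n; exact/measurable_EFinP.
  - by move=> n x _; rewrite lee_fin.
  - by move=> x _ a b ab; rewrite lee_fin; exact/lefP/nd_nnsfun_approx.
have c2 : (\int[m]_t (g n t * k t)%:E)%E @[n --> \oo] --> (\int[m]_t (h t * k t)%:E)%E.
  have -> : (\int[m]_t (h t * k t)%:E = \int[m]_t (limn (fun n => (g n t * k t)%:E)))%E.
    apply: eq_integral => t _; apply/esym/cvg_lim => //.
    rewrite EFinM; under eq_fun do rewrite EFinM.
    by apply: cvgeZr => //; exact: gh.
  apply: cvg_monotone_convergence => //.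
  - by move=> n; apply/measurable_EFinP; exact: measurable_funM.
  - by move=> n x _; rewrite lee_fin mulr_ge0.
  - by move=> x _ a b ab; rewrite lee_fin ler_wpM2r//; exact/lefP/nd_nnsfun_approx.
have e : (fun n => \int[density]_t (g n t)%:E)%E = (fun n => \int[m]_t (g n t * k t)%:E)%E.
  apply/funext => n; rewrite integralT_nnsfun sintegralE.
  transitivity (\int[m]_t (\sum_(y \in range (g n)) (y * \1_(g n @^-1` [set y]) t * k
    t)%:E))%E; last first.
    apply: eq_integral => t _; rewrite fsumEFin//; congr EFin.
    by rewrite [in RHS](fimfunE (g n) t) -mulr_fsuml.
  rewrite ge0_integral_fsum//; last 2 first.
  - move=> y; apply/measurable_EFinP; apply: measurable_funM => //.
    by apply: measurable_funM => //; exact: measurable_indic.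
  - move=> y t _; rewrite lee_fin mulr_ge0//.
    by have := nnfun_muleindic_ge0 (g n) y t; rewrite -EFinM lee_fin.
  apply: eq_fsbigr => y yr; rewrite /density_of.
  have y0 : 0 <= y by move: yr; rewrite inE => -[t _ <-].
  rewrite -ge0_integralZl//; last 2 first.
  - by apply/measurable_EFinP; exact: measurable_funTS.
  - by move=> t _; rewrite lee_fin.
  rewrite integral_mkcond; apply: eq_integral => t _.
  rewrite patchE indicE; case: ifPn => _; first by rewrite mulr1.
  by rewrite mulr0 mul0r.
rewrite e in c1; exact: (cvg_unique _ c1 c2).
Qed.

Lemma integral_density (D : set RB) (h : RB -> R) : measurable D -> measurable_fun D h ->
  (forall t, D t -> 0 <= h t) ->
  (\int[density]_(t in D) (h t)%:E = \int[m]_(t in D) (h t * k t)%:E)%E.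
Proof.
move=> mD mh h0; rewrite integral_mkcond [RHS]integral_mkcond.
have mhD := (measurable_restrictT h mD).1 mh.
have hD0 t : 0 <= (h \_ D) t by apply: restrict_ge0 => x /h0.
have E := integral_densityT mhD hD0.
transitivity (\int[density]_t ((h \_ D) t)%:E)%E; last rewrite E.
  by apply: eq_integral => t _; rewrite !patchE; case: ifPn.
by apply: eq_integral => t _; rewrite !patchE; case: ifPn; rewrite ?mul0r.
Qed.

End Density.

Section DensityCalc.
Variable R : realType.
Let RB := measurableTypeR R.
Variables (m : {measure set RB -> \bar R}) (D : set RB) (k : R -> R).
Hypotheses (mD : measurable D) (mk : measurable_fun D k) (k0 : forall t, D t -> 0 <= k t).

Let kD : RB -> R := k \_ D.
Let mkD : measurable_fun setT kD.
Proof. exact: (measurable_restrictT k mD).1 mk. Qed.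
Let kD0 t : 0 <= kD t.
Proof. by apply: restrict_ge0 => x /k0. Qed.

Let density_formula (E : set RB) (h : R -> R) :
  measurable E -> measurable_fun E h -> (forall t, E t -> 0 <= h t) ->
  (\int[density_of m mkD kD0]_(t in E) (h t)%:E =
   \int[m]_(t in E `&` D) (h t * k t)%:E)%E.
Proof.
move=> mE mh h0; rewrite integral_density// integral_mkcondr.
apply: eq_integral => t _; rewrite patchE /kD patchE; case: ifPn => // _.
by rewrite mulr0.
Qed.

Lemma density_measure : exists nu : {measure set RB -> \bar R},
  forall (E : set RB) (h : R -> R),
  measurable E -> measurable_fun E h -> (forall t, E t -> 0 <= h t) ->
  (\int[nu]_(t in E) (h t)%:E = \int[m]_(t in E `&` D) (h t * k t)%:E)%E.
Proof. by exists (density_of m mkD kD0). Qed.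

Hypothesis fin : (\int[m]_(t in D) (k t)%:E < +oo)%E.

Let kfin : fin_num_fun (density_of m mkD kD0).
Proof.
apply: lty_fin_num_fun.
rewrite /density_of; apply: le_lt_trans fin; rewrite [leRHS]integral_mkcond.
rewrite le_eqVlt; apply/orP; left; apply/eqP.
by apply: eq_integral => t _; rewrite /kD !patchE; case: ifPn.
Qed.

HB.instance Definition _ :=
  @Measure_isFinite.Build _ _ _ (density_of m mkD kD0) kfin.

Lemma density_finite_measure : exists nu : {finite_measure set RB -> \bar R},
  nu D = (\int[m]_(t in D) (k t)%:E)%E /\
  forall (E : set RB) (h : R -> R),
  measurable E -> measurable_fun E h -> (forall t, E t -> 0 <= h t) ->
  (\int[nu]_(t in E) (h t)%:E = \int[m]_(t in E `&` D) (h t * k t)%:E)%E.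
Proof.
exists (density_of m mkD kD0); split; last by [].
have := density_formula mD (measurable_cst (1 : R)) (fun _ _ => ler01).
rewrite setIid /= integral_cst// mul1e => ->.
by apply: eq_integral => t _; rewrite mul1r.
Qed.

End DensityCalc.

(** * Integrals computed from antiderivatives *)

Section Ftc.
Variable R : realType.
Let RB := measurableTypeR R.
Notation mu := (@lebesgue_measure R).

Lemma dfun_add (f g : R -> R) (x a b : R) : is_derive x 1 f a -> is_derive x 1 g b ->
  is_derive x 1 (fun t => f t + g t) (a + b).
Proof. by move=> h1 h2; exact: is_deriveD. Qed.

Lemma dfun_mul (f g : R -> R) (x a b : R) : is_derive x 1 f a -> is_derive x 1 g b ->
  is_derive x 1 (fun t => f t * g t) (f x * b + g x * a).
Proof. by move=> h1 h2; exact: is_deriveM. Qed.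

Lemma dfun_opp (f : R -> R) (x a : R) : is_derive x 1 f a ->
  is_derive x 1 (fun t => - f t) (- a).
Proof. by move=> h; exact: is_deriveN. Qed.

Lemma dfun_cst (c x : R) : is_derive x 1 (fun=> c : R) 0.
Proof. exact: is_derive_cst. Qed.

Lemma dfun_id (x : R) : is_derive x 1 (fun t : R => t) 1.
Proof. exact: is_derive_id. Qed.

Lemma dfun_expR (f : R -> R) (x a : R) : is_derive x 1 f a ->
  is_derive x 1 (fun t => expR (f t)) (a * expR (f x)).
Proof. by move=> h; have := is_derive1_comp (is_derive_expR (f x)) h; rewrite mulrC. Qed.

Lemma dfun_eq (f : R -> R) (x a b : R) : is_derive x 1 f a -> a = b -> is_derive x 1 f b.
Proof. by move=> h <-. Qed.

Lemma dfun_continuous (f : R -> R) (f' : R ->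
  R) : (forall x : R, is_derive x 1 f (f' x)) -> continuous f.
Proof.
move=> h x; apply/differentiable_continuous/derivable1_diffP.
by have [] := h x.
Qed.

(** The fundamental theorem of calculus for an antiderivative on the whole line,
    which makes the boundary conditions automatic. *)
Lemma integral_dfun_itv (F f : R -> R) (a b : R) : a < b ->
  (forall x : R, is_derive x 1 F (f x)) ->
  continuous f ->
  (\int[mu]_(x in `[a, b]) (f x)%:E = (F b - F a)%:E)%E.
Proof.
move=> ab dF cf; rewrite (continuous_FTC2 ab (F := F))//.
- exact: continuous_subspaceT.
- split.
  + by move=> x _; have [] := dF x.
  + by apply: cvg_at_right_filter; exact: (dfun_continuous dF).
  + by apply: cvg_at_left_filter; exact: (dfun_continuous dF).
- by move=> x _; rewrite derive1E; have [_ ->] := dF x.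
Qed.

Lemma integral_dfun_itvy (F f : R -> R) (a l : R) : (forall x, a <= x -> 0 <= f x) ->
  (forall x : R, is_derive x 1 F (f x)) -> continuous f -> F x @[x --> +oo%R] --> l ->
  (\int[mu]_(x in `[a, +oo[) (f x)%:E = (l - F a)%:E)%E.
Proof.
move=> f0 dF cf Fl; rewrite (@ge0_continuous_FTC2y _ f F a l)//.
- exact: continuous_subspaceT.
- by apply: cvg_at_right_filter; exact: (dfun_continuous dF).
- by move=> x _; rewrite derive1E; have [_ ->] := dF x.
Qed.

Lemma dfun_expNM (c x : R) : is_derive x 1 (fun t => expR (- (c * t))) (- c * expR (- (c
  * x))).
Proof.
apply: (dfun_eq (dfun_expR (dfun_opp (dfun_mul (dfun_cst c x) (dfun_id x))))).
by congr (_ * _); ring.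
Qed.

Lemma continuous_expNM (c : R) : continuous (fun t => expR (- (c * t))).
Proof. exact: (dfun_continuous (dfun_expNM c)). Qed.

Lemma integral_exp (c : R) : 0 < c ->
  (\int[mu]_(t in `[0%R, +oo[) (expR (- (c * t)))%:E = (c^-1)%:E)%E.
Proof.
move=> c0.
have dF (x : R) : is_derive x 1 (fun t => - c^-1 * expR (- (c * t))) (expR (- (c * x))).
  apply: (dfun_eq (dfun_mul (dfun_cst _ x) (dfun_expNM c x))).
  by field; rewrite gt_eqF.
rewrite (integral_dfun_itvy (l := 0) _ dF (@continuous_expNM c)).
- by rewrite mulr0 oppr0 expR0; congr EFin; ring.
- by move=> x _; exact: expR_ge0.
- rewrite -(mulr0 (- c^-1)); apply: cvgMr.
  apply: (@cvg_comp _ _ _ (fun t => c * t) (fun z => expR (- z)) _ (pinfty_nbhs R));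
    last exact: cvgr_expR.
  exact: gt0_cvgMry.
Qed.

Lemma integral_exp01 (c : R) : 0 < c ->
  (\int[mu]_(t in `[0%R, 1%R]) (expR (- (c * t)))%:E = ((1 - expR (- c)) / c)%:E)%E.
Proof.
move=> c0.
have dF (x : R) : is_derive x 1 (fun t => - c^-1 * expR (- (c * t))) (expR (- (c * x))).
  apply: (dfun_eq (dfun_mul (dfun_cst _ x) (dfun_expNM c x))).
  by field; rewrite gt_eqF.
rewrite (integral_dfun_itv ltr01 dF (@continuous_expNM c)).
by rewrite mulr0 oppr0 expR0 mulr1; congr EFin; ring.
Qed.

Lemma integral_exp_lin (c : R) : 0 < c ->
  (\int[mu]_(t in `[0%R, 1%R]) (expR (- (c * t)) * (1 - t))%:E =
    (c^-1 - (1 - expR (- c)) / c ^+ 2)%:E)%E.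
Proof.
move=> c0.
have dF (x : R) : is_derive x 1 (fun t => (- c^-1 + c^-2 + c^-1 * t) * expR (- (c * t)))
    (expR (- (c * x)) * (1 - x)).
  apply: (dfun_eq (dfun_mul (dfun_add (dfun_cst _ x) (dfun_mul (dfun_cst _ x) (dfun_id
    x))) (dfun_expNM c x))).
  by field; rewrite gt_eqF.
have cf := dfun_continuous (fun x => dfun_mul (dfun_expNM c x) (dfun_add (dfun_cst 1 x)
  (dfun_opp (dfun_id x)))).
rewrite (integral_dfun_itv ltr01 dF cf).
by rewrite !mulr0 oppr0 expR0 !mulr1; congr EFin; field; rewrite gt_eqF.
Qed.

Lemma integral_lin : (\int[mu]_(t in `[0%R, 1%R]) ((1 - t))%:E = (2^-1 : R)%:E)%E.
Proof.
have dF (x : R) : is_derive x 1 (fun t => t + - 2^-1 * (t * t)) (1 - x).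
  apply: (dfun_eq (dfun_add (dfun_id x) (dfun_mul (dfun_cst _ x) (dfun_mul (dfun_id x)
    (dfun_id x))))).
  by field.
have cf := dfun_continuous (fun x => dfun_add (dfun_cst 1 x) (dfun_opp (dfun_id x))).
by rewrite (integral_dfun_itv ltr01 dF cf); congr EFin; field.
Qed.

Lemma integral_half_id : (\int[mu]_(t in `[0%R, 1%R]) (2^-1 * t)%:E = (4^-1 : R)%:E)%E.
Proof.
have dF (x : R) : is_derive x 1 (fun t => 4^-1 * (t * t)) (2^-1 * x).
  apply: (dfun_eq (dfun_mul (dfun_cst _ x) (dfun_mul (dfun_id x) (dfun_id x)))).
  by field.
have cf := dfun_continuous (fun x => dfun_mul (dfun_cst (2^-1) x) (dfun_id x)).
by rewrite (integral_dfun_itv ltr01 dF cf); congr EFin; field.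
Qed.

Lemma integral_landau (c : R) : 0 < c ->
  (\int[mu]_(t in `[0%R, 1%R]) ((expR (- (c * t)) - expR (- (c * (2 - t)))) * (2^-1 *
    t))%:E =
   ((1 - expR (- (2 * c))) / (2 * c ^+ 2) - expR (- c) / c)%:E)%E.
Proof.
move=> c0.
have e2 t : expR (- (c * (2 - t))) = expR (- (2 * c)) * expR (- (- c * t)).
  by rewrite -expRD; congr expR; ring.
under eq_integral do rewrite e2.
have dF (x : R) : is_derive x 1 (fun t => - (2 * c)^-1 * ((t + c^-1) * expR (- (c * t))) +
   - expR (- (2 * c)) * ((2 * c)^-1 * ((t + - c^-1) * expR (- (- c * t)))))
   ((expR (- (c * x)) - expR (- (2 * c)) * expR (- (- c * x))) * (2^-1 * x)).
  apply: (dfun_eq (dfun_add (dfun_mul (dfun_cst _ x) (dfun_mul (dfun_add (dfun_id x)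
    (dfun_cst _ x)) (dfun_expNM c x)))
    (dfun_mul (dfun_cst _ x) (dfun_mul (dfun_cst _ x) (dfun_mul (dfun_add (dfun_id x)
      (dfun_cst _ x)) (dfun_expNM (- c) x)))))).
  by field; rewrite gt_eqF.
have cf := dfun_continuous (fun x => dfun_mul (dfun_add (dfun_expNM c x) (dfun_opp
  (dfun_mul (dfun_cst (expR (- (2 * c))) x) (dfun_expNM (- c) x))))
  (dfun_mul (dfun_cst (2^-1) x) (dfun_id x))).
rewrite (integral_dfun_itv ltr01 dF cf).
have e1 : expR (- (- c * 1)) = (expR (- c))^-1 by rewrite -expRN; congr expR; ring.
have e3 : expR (- (2 * c)) = expR (- c) * expR (- c) by rewrite -expRD; congr expR; ring.
rewrite !mulr0 !oppr0 expR0 e1 e3 !mulr1; congr EFin.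
by field; rewrite !gt_eqF ?expR_gt0.
Qed.

End Ftc.

(** * Basic symbols *)

Section SymbolBounds.
Variables (R : realType) (X : completeNormedModType R[i]).
Let RB := measurableTypeR R.
Implicit Types (F G : R -> X) (K N : R) (s : R -> R).
Notation mu := (@lebesgue_measure R).

(** Real symbols of normal functionals, with a bound on the norm.  The functional
    is hidden: by uniqueness it is determined by the symbol. *)
Definition symbol_le N s := exists L : (R -> X) -> X, has_symbol N (fun x => (s x)%:C) L.

Lemma symbol_le_ext N s s' : (forall x, 0 < x -> s x = s' x) -> symbol_le N s ->
  symbol_le N s'.
Proof. by move=> e [L h]; exists L; apply: has_symbol_ext h => x x0; rewrite e. Qed.

Lemma symbol_le_weak N N' s : N <= N' -> symbol_le N s -> symbol_le N' s.
Proof. by move=> e [L h]; exists L; exact: has_symbol_weak h. Qed.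

Lemma symbol_le_add N N' s s' : symbol_le N s -> symbol_le N' s' ->
  symbol_le (N + N') (fun x => s x + s' x).
Proof.
move=> [L h] [L' h']; exists (fun F => L F + L' F).
by apply: has_symbol_ext (has_symbol_add h h') => x _; rewrite -rmorphD.
Qed.

Lemma symbol_le_mul N N' s s' : symbol_le N s -> symbol_le N' s' ->
  symbol_le (N * N') (fun x => s x * s' x).
Proof.
move=> [L h] [L' h']; eexists.
by apply: has_symbol_ext (has_symbol_conv h h') => x _; rewrite -rmorphM.
Qed.

Lemma symbol_le_scale N s c : symbol_le N s -> symbol_le (`|c| * N) (fun x => c * s x).
Proof.
move=> [L h]; eexists.
by apply: has_symbol_ext (has_symbol_scaleR c h) => x _; rewrite -rmorphM.
Qed.

Lemma symbol_le_sub N N' s s' : symbol_le N s -> symbol_le N' s' ->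
  symbol_le (N + N') (fun x => s x - s' x).
Proof.
move=> h /(symbol_le_scale (-1)); rewrite normrN normr1 mul1r => h'.
by apply: symbol_le_ext (symbol_le_add h h') => x _; rewrite mulN1r.
Qed.

Lemma symbol_le_dilate N s th : 0 < th -> symbol_le N s ->
  symbol_le N (fun x => s (th * x)).
Proof. by move=> t0 [L h]; eexists; exact: (has_symbol_dilate t0 h). Qed.

Lemma symbol_le_delta t : 0 <= t -> symbol_le 1 (fun x => expR (- (x * t))).
Proof. by move=> t0; eexists; exact: has_symbol_delta. Qed.

Lemma symbol_le1 : symbol_le 1 (fun=> 1).
Proof.
by apply: symbol_le_ext (symbol_le_delta (lexx 0)) => x _; rewrite mulr0 oppr0 expR0.
Qed.

Lemma symbol_le_measure (nu : {finite_measure set RB -> \bar R}) (D : set RB) (c : R) s :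
  measurable D -> (forall t, D t -> 0 <= t) ->
  nu D = c%:E ->
  (forall x, 0 < x -> (\int[nu]_(t in D) (expR (- (x * t)))%:E = (s x)%:E)%E) ->
  symbol_le c s.
Proof.
move=> mD D0 nuD ns; eexists.
have -> : c = fine (nu D) by rewrite nuD.
apply: has_symbol_ext (has_symbol_measure X nu mD D0) => x x0.
by rewrite /Rintegral ns.
Qed.

Lemma measurable_expNM (D : set RB) (x : R) : measurable_fun D (fun t :
  R => expR (- (x * t))).
Proof.
apply: measurable_funTS; apply: continuous_measurable_fun; exact: (@continuous_expNM R x).
Qed.

Lemma symbol_le_density (m : {measure set RB -> \bar R}) (D : set RB) (k : R ->
  R) (c : R) s :
  measurable D -> (forall t, D t -> 0 <= t) ->
  measurable_fun D k -> (forall t, D t -> 0 <= k t) ->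
  (\int[m]_(t in D) (k t)%:E = c%:E)%E ->
  (forall x, 0 < x -> (\int[m]_(t in D) (expR (- (x * t)) * k t)%:E = (s x)%:E)%E) ->
  symbol_le c s.
Proof.
move=> mD D0 mk k0 kc ks.
have [|nu [nuD hnu]] := density_finite_measure (m := m) mD mk k0.
  by rewrite kc ltry.
apply: (symbol_le_measure (nu := nu) mD D0); first by rewrite nuD.
move=> x x0; rewrite hnu//; last exact: measurable_expNM.
by rewrite setIid ks.
Qed.

Lemma symbol_le_exponential : symbol_le 1 (fun x => (1 + x)^-1).
Proof.
apply: (@symbol_le_density mu `[0, +oo[%classic (fun t => expR (- (1 * t)))) => //.
- by move=> t /=; rewrite in_itv/= andbT.
- exact: measurable_expNM.
- by rewrite integral_exp// invr1.
- move=> x x0; rewrite -integral_exp ?addr_gt0//.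
  by apply: eq_integral => t _; rewrite -expRD; congr (expR _)%:E; ring.
Qed.

Lemma symbol_le_resolvent th : 0 < th -> symbol_le 1 (fun x => (1 + th * x)^-1).
Proof. by move=> t0; exact: (symbol_le_dilate t0 symbol_le_exponential). Qed.

Lemma symbol_le_uniform : symbol_le 1 (fun x => (1 - expR (- x)) / x).
Proof.
apply: (@symbol_le_density mu `[0, 1]%classic (fun t => 1)) => //.
- by move=> t /=; rewrite in_itv/= => /andP[].
- rewrite integral_cst//= lebesgue_measure_itv/= lte01 -EFinB subr0 mul1e//.
- by move=> x x0; under eq_integral do rewrite mulr1; exact: integral_exp01.
Qed.

Lemma max0_continuous : continuous (Num.max (0 : R)).
Proof.
move=> y; apply/cvgrPdist_lt => e e0; near=> z.
have h : `|y - z| < e by near: z; exact: cvgr_dist_lt.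
apply: le_lt_trans h; rewrite ler_norml.
have := ler_norm (y - z); have := ler_norm (- (y - z)); rewrite normrN => h1 h2.
by case: (leP 0 y) => hy; case: (leP 0 z) => hz; apply/andP; split; lra.
Unshelve. all: by end_near. Qed.

(** The density whose Laplace transform is (1 / (1 + x) - e^(- x)) / x^2, the
    case n = 1 of the Euler error divided by x^2. *)
Definition euler_kernel (t : R) := expR (- (1 * t)) - Num.max 0 (1 - t).

Lemma euler_kernel_ge0 t : 0 <= euler_kernel t.
Proof.
rewrite /euler_kernel subr_ge0 ge_max expR_ge0/= mul1r.
by rewrite (le_trans _ (expR_ge1Dx _)).
Qed.

Let maxm : measurable_fun [set: RB] (fun t : R => Num.max 0 (1 - t)).
Proof.
apply: (@measurable_maxr _ RB) => //.
by apply: measurable_funB => //; exact: measurable_cst.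
Qed.

Lemma measurable_euler_kernel (D : set RB) : measurable_fun D euler_kernel.
Proof.
apply: measurable_funB; first exact: measurable_expNM.
by apply: measurable_funTS; exact: maxm.
Qed.

(** The value [b] of the second integral is a parameter so that x = 0, which
    gives the total mass, is covered as well. *)
Lemma integral_euler_kernel (x b : R) : 0 <= x ->
  (\int[mu]_(t in `[0%R, 1%R]) (expR (- (x * t)) * (1 - t))%:E = b%:E)%E ->
  (\int[mu]_(t in `[0%R, +oo[) (expR (- (x * t)) * euler_kernel t)%:E =
    ((1 + x)^-1 - b)%:E)%E.
Proof.
move=> x0 hb.
have h1 : (\int[mu]_(t in `[0%R, +oo[) (expR (- (x * t)) * Num.max 0 (1 - t))%:E = b%:E)%E.
  rewrite -hb integral_mkcond [RHS]integral_mkcond; apply: eq_integral => t _.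
  rewrite !patchE; case: ifPn; rewrite mem_setE in_itv/= andbT => t0;
    case: ifPn; rewrite mem_setE in_itv/=.
  - by move=> /andP[_ t1]; rewrite max_r// subr_ge0.
  - by rewrite t0/= -ltNge => t1; rewrite max_l ?mulr0// subr_le0 ltW.
  - by move=> /andP[t0']; rewrite t0' in t0.
  - by [].
have h2 : (\int[mu]_(t in `[0%R, +oo[) (expR (- (x * t)) * euler_kernel t)%:E + b%:E =
  ((1 + x)^-1)%:E)%E.
  rewrite -h1 -ge0_integralD//.
  - rewrite -integral_exp ?ltr_wpDr//; apply: eq_integral => t _; rewrite -EFinD;
    congr EFin.
    rewrite -mulrDr /euler_kernel subrK -expRD; congr expR; ring.
  - by move=> t _; rewrite lee_fin mulr_ge0 ?expR_ge0 ?euler_kernel_ge0.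
  - by apply/measurable_EFinP; apply: measurable_funM;
    [exact: measurable_expNM|exact: measurable_euler_kernel].
  - by move=> t _; rewrite lee_fin mulr_ge0 ?expR_ge0// le_max lexx.
  - apply/measurable_EFinP; apply: measurable_funM; first exact: measurable_expNM.
    by apply: measurable_funTS; exact: maxm.
by rewrite EFinB -h2 addeK.
Qed.

(** Since the density is nonnegative, the norm is its integral 1 - 1/2. *)
Lemma symbol_le_euler_kernel : symbol_le (2^-1) (fun x => (1 + x)^-1 - x^-1 + (1 - expR
  (- x)) / x ^+ 2).
Proof.
apply: (@symbol_le_density mu `[0, +oo[%classic euler_kernel) => //.
- by move=> t /=; rewrite in_itv/= andbT.
- exact: measurable_euler_kernel.
- by move=> t _; exact: euler_kernel_ge0.
- have := @integral_euler_kernel 0 (2^-1) (lexx 0) _.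
  rewrite addr0 invr1 (_ : 1 - 2^-1 = 2^-1); last by field.
  move=> <-; first by apply: eq_integral => t _; rewrite mul0r oppr0 expR0 mul1r.
  by rewrite -integral_lin; apply: eq_integral => t _; rewrite mul0r oppr0 expR0 mul1r.
- move=> x x0; rewrite (integral_euler_kernel (ltW x0) (integral_exp_lin x0)).
  by congr EFin; ring.
Qed.

(** The kernel of Landau's inequality: convolved with the second derivative of a
    function, it gives the derivative translated by 1 minus a central difference
    of step 1.  Its density is - r / 2 on [0, 1], continued oddly about 1, so up
    to the sign it averages F r - F (2 - r) against r / 2; hence the norm
    2 * 1/4. *)
Lemma symbol_le_landau : symbol_le (2^-1) (fun x => expR (- x) / x - (1 - expR (- (2 *
  x))) / (2 * x ^+ 2)).
Proof.
pose D := `[0, 1]%classic : set RB.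
have mD : measurable D by exact: measurable_itv.
have mk : measurable_fun D (fun t : R => 2^-1 * t).
  by apply: measurable_funM => //; exact: measurable_cst.
have k0 (t : R) : D t -> 0 <= 2^-1 * t.
  by rewrite /D/= in_itv/= => /andP[t0 _]; rewrite mulr_ge0 ?invr_ge0.
have [|nu [nuD hnu]] := density_finite_measure (m := mu) mD mk k0.
  by rewrite integral_half_id ltry.
rewrite integral_half_id in nuD.
have D0 t : D t -> 0 <= t by rewrite /D/= in_itv/= => /andP[].
have D2 t : D t -> Num.max 0 (2 - t) = 2 - t.
  by rewrite /D/= in_itv/= => /andP[_ t1]; rewrite max_r// subr_ge0 (le_trans t1)// ler1n.
have m0 (t : R) : 0 <= Num.max 0 (2 - t) by rewrite le_max lexx.
have mcv (u : nat -> R) t : u @ \oo --> t ->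
  (fun n => Num.max 0 (2 - u n)) @ \oo --> Num.max 0 (2 - t).
  move=> ut; apply: (@cvg_comp _ _ _ (fun n => 2 - u n) (Num.max 0) _ (nbhs (2 - t))).
    by apply: cvgB => //; exact: cvg_cst.
  exact: max0_continuous.
have h : symbol_le (fine (nu D) * 2) (fun x => \int[nu]_(t in D) (expR (- (x * t)) - expR
  (- (x * Num.max 0 (2 - t))))).
  eexists; apply: (@has_symbol_mix R X nu D mD D0 2 (fun F t => F t - F (Num.max 0 (2 -
    t))) _ _ _ _ _ _
    (fun x t => expR (- (x * t)) - expR (- (x * Num.max 0 (2 - t)))) 1) => //.
  - move=> K F [h _] t t0; rewrite (le_trans (rnormD _ _))// rnormN mulrDl mul1r lerD ?h//.
  - move=> K F [_ h] t Dt u u0 ut; apply: cvgB; first exact: (h _ (D0 _ Dt)).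
    by apply: (h _ (m0 t) (fun n => Num.max 0 (2 - u n))) => //; exact: mcv.
  - by move=> K K' F G _ _ t _; rewrite opprD addrACA.
  - by move=> K F c _ t _; rewrite scalerBr.
  - by move=> K Fn F _ _ h t Dt; apply: cvgB; apply: h => //; exact: D0.
  - move=> x x0 t t0; have e01 y : 0 <= y -> 0 <= expR (- (x * y)) <= 1.
      by move=> y0; rewrite expR_ge0/= -expR0 ler_expR oppr_le0 mulr_ge0// ltW.
    have /andP[a b] := e01 _ t0; have /andP[c d] := e01 _ (m0 t).
    by rewrite ler_norml; apply/andP; split; lra.
  - move=> x x0 t Dt u u0 ut; apply: cvgB.
      apply: (@cvg_comp _ _ _ (fun n => - (x * u n)) expR _ _ _ _ (@continuous_expR R _)).
      by apply: cvgN; apply: cvgMr.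
    apply: (@cvg_comp _ _ _ (fun n => - (x * Num.max 0 (2 - u n))) expR _ _ _ _
      (@continuous_expR R _)).
    by apply: cvgN; apply: cvgMr; exact: mcv.
  - by move=> x v t x0 Dt; rewrite /exp_vec -scalerBl -rmorphB.
have := symbol_le_scale (-1) h; rewrite normrN normr1 mul1r nuD/=.
rewrite (_ : 4^-1 * 2 = 2^-1); last by field.
apply: symbol_le_ext => x x0.
have -> : \int[nu]_(t in D) (expR (- (x * t)) - expR (- (x * Num.max 0 (2 - t)))) =
    \int[nu]_(t in D) (expR (- (x * t)) - expR (- (x * (2 - t)))).
  by apply: eq_Rintegral => t; rewrite inE => /D2 ->.
rewrite /Rintegral hnu//.
- rewrite setIid (integral_landau x0)/=; ring.
- apply: measurable_funB; first exact: measurable_expNM.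
  apply: measurable_funTS; apply: continuous_measurable_fun.
  exact: (dfun_continuous (fun t => dfun_expR (dfun_opp (dfun_mul (dfun_cst x t)
    (dfun_add (dfun_cst 2 t) (dfun_opp (dfun_id t))))))).
- move=> t; rewrite /D/= in_itv/= => /andP[t0 t1].
  rewrite subr_ge0 ler_expR lerN2 ler_wpM2l ?(ltW x0)//; lra.
Qed.

End SymbolBounds.

(** * Symbols of the Euler approximation error *)

Section Delta.
Variables (R : realType) (X : completeNormedModType R[i]).
Let RB := measurableTypeR R.
Local Notation symbol_le := (@symbol_le R X).

Definition euler_err (n : nat) (th x :
  R) := (1 + th * x)^-1 ^+ n - expR (- (x * (n%:R * th))).

(** Telescoping: the error of [n + 1] steps is one implicit step applied to the
    error of [n] steps, plus the error of one step followed by a translation. *)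
Lemma euler_errS n th x : euler_err n.+1 th x =
  (1 + th * x)^-1 * euler_err n th x + ((1 + th * x)^-1 - expR (- (x * th))) * expR (- (x
    * (n%:R * th))).
Proof.
rewrite /euler_err -natr1 (_ : - (x * ((n%:R + 1) * th)) =
  - (x * th) + - (x * (n%:R * th))).
  by rewrite expRD exprS; ring.
ring.
Qed.

Lemma symbol_le_resolventX n th : 0 < th -> symbol_le 1 (fun x => (1 + th * x)^-1 ^+ n).
Proof.
move=> th0; elim: n => [|n IH]; first exact: symbol_le1.
apply: symbol_le_ext (symbol_le_weak _ (symbol_le_mul (symbol_le_resolvent X th0) IH)) =>
  [x _|].
  by rewrite exprS.
by rewrite mulr1.
Qed.

Lemma symbol_le_euler_err n th : 0 < th -> symbol_le 2 (euler_err n th).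
Proof.
move=> th0; have h := symbol_le_resolventX n th0.
rewrite (_ : 2 = 1 + 1 :> R)//.
apply: (symbol_le_sub h); apply: symbol_le_delta; by rewrite mulr_ge0 ?ler0n// ltW.
Qed.

(** Implicit steps and translations are contractions, so the errors of the [n]
    steps add up. *)
Lemma symbol_le_euler_err_mul (phi : R -> R) N n th : 0 < th ->
  symbol_le N (fun x => ((1 + th * x)^-1 - expR (- (x * th))) * phi x) ->
  symbol_le (n%:R * N) (fun x => euler_err n th x * phi x).
Proof.
move=> th0 hN; elim: n => [|n IH].
  have := symbol_le_scale 0 (symbol_le1 X); rewrite normr0 !mul0r;
    apply: symbol_le_ext => x _.
  by rewrite /euler_err !mul0r mulr0 oppr0 expR0 expr0 subrr mul0r.
have h2 := symbol_le_mul hN (@symbol_le_delta R X (n%:R * th) (mulr_ge0 (ler0n _ _) (ltW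
  th0))).
apply: symbol_le_ext (symbol_le_weak _ (symbol_le_add (symbol_le_mul (symbol_le_resolvent
  X th0) IH) h2)) => [x x0|].
  by rewrite euler_errS; ring.
by rewrite -natr1 mulrDl mul1r mulr1 mul1r.
Qed.

(** The bound t^2 / (2 n) for t = n theta. *)
Lemma symbol_le_euler_err_div2 n th : 0 < th ->
  symbol_le (n%:R * (th ^+ 2 / 2)) (fun x => euler_err n th x / x ^+ 2).
Proof.
move=> th0; apply: symbol_le_euler_err_mul => //.
have := symbol_le_scale (th ^+ 2) (symbol_le_dilate th0 (symbol_le_euler_kernel X)).
rewrite ger0_norm ?sqr_ge0//; apply: symbol_le_ext => x x0.
rewrite [x * th]mulrC; field.
by rewrite !gt_eqF//= ?ltr_pwDr// ?mulr_gt0.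
Qed.

(** Telescoping loses the factor sqrt n here; this bound is only used to know
    that the functional exists. *)
Lemma symbol_le_euler_err_div_crude n th : 0 < th ->
  symbol_le (n%:R * (th + th)) (fun x => euler_err n th x / x).
Proof.
move=> th0; apply: symbol_le_euler_err_mul => //.
have h1 := symbol_le_scale th (symbol_le_dilate th0 (symbol_le_uniform X)).
have h2 := symbol_le_scale th (symbol_le_resolvent X th0).
have := symbol_le_sub h1 h2; rewrite ger0_norm ?ltW// !mulr1; apply: symbol_le_ext => x x0.
rewrite [x * th]mulrC; field.
by rewrite !gt_eqF//= ?ltr_pwDr// ?mulr_gt0.
Qed.

(** Translating a measure to the right preserves its norm.  For functionals:
    translating the continuation of [F] to the left by the constant [F 0] gives
    [F] back, and the continuation has the same bound. *)
Lemma symbol_le_translate N N' a s : 0 <= a -> symbol_le N s ->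
  symbol_le N' (fun x => expR (- (x * a)) * s x) -> symbol_le N' s.
Proof.
move=> a0 [L [nL sL]] [L' h']; have [nL' sL'] := h'.
exists L; split=> //; split; [exact: normal_ge0 nL'|exact: normalD nL|exact: normalZ nL|
  |exact: normal_dct nL].
move=> K F FK; pose F' r := F (Num.max 0 (r - a)).
have F'K : bdd_seqcont K F'.
  case: FK => hF cF; split=> t t0; first by rewrite hF// le_max lexx.
  move=> u u0 ut; apply: (cF _ _ (fun n => Num.max 0 (u n - a))).
  - by rewrite le_max lexx.
  - by move=> n; rewrite le_max lexx.
  - apply: (@cvg_comp _ _ _ (fun n => u n - a) (Num.max 0) _ (nbhs (t - a))).
      by apply: cvgB => //; exact: cvg_cst.
    exact: max0_continuous.
have cL : has_symbol N (fun x => (s x)%:C) L by [].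
have E : L (fun r => F' (a + r)) = L' F'.
  apply: (has_symbol_uniq (has_symbol_conv (has_symbol_delta X a0) cL) h' _ F'K) => x x0.
  by rewrite -rmorphM.
rewrite (normal_ext nL FK (G := fun r => F' (a + r))) ?E;
  first exact: normal_le nL' _ _ F'K.
by move=> r r0; rewrite /F' [a + r]addrC addrK max_r.
Qed.

(** Landau's inequality between the error and its quotient by x^2.  With the step
    a, the translate by a of D / x is a central difference of D / x^2 plus D times
    the Landau kernel, of norm at most n theta^2 / (2 a) + a; the choice
    a = theta sqrt n gives 3 a / 2. *)
Lemma symbol_le_euler_err_div n th : 0 < th -> (0 < n)%N ->
  symbol_le (3 / 2 * (th * Num.sqrt n%:R)) (fun x => euler_err n th x / x).
Proof.
move=> th0 n0; set a := th * _.
have a0 : 0 < a by rewrite mulr_gt0// sqrtr_gt0 ltr0n.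
have a2 : a ^+ 2 = n%:R * th ^+ 2 by rewrite exprMn sqr_sqrtr ?ler0n// mulrC.
apply: (symbol_le_translate (ltW a0) (symbol_le_euler_err_div_crude n th0)).
have h1 := symbol_le_mul (symbol_le_euler_err_div2 n th0) (symbol_le_scale (2 * a)^-1
  (symbol_le_sub (symbol_le1 X) (symbol_le_delta X (mulr_ge0 (ler0n _ 2) (ltW a0))))).
have h2 := symbol_le_mul (symbol_le_euler_err n th0) (symbol_le_scale a (symbol_le_dilate
  a0 (symbol_le_landau X))).
apply: symbol_le_ext (symbol_le_weak _ (symbol_le_add h1 h2)) => [x x0|].
  rewrite [x * a]mulrC (_ : x * (2 * a) = 2 * (a * x)); last by ring.
  by field; rewrite !gt_eqF.
rewrite (_ : n%:R * (th ^+ 2 / 2) = a ^+ 2 / 2); last by rewrite a2; ring.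
have a20 : 0 <= 2 * a by rewrite mulr_ge0// ltW.
rewrite normfV (ger0_norm a20) (ger0_norm (ltW a0)).
rewrite le_eqVlt; apply/orP; left; apply/eqP; field; by rewrite gt_eqF.
Qed.

End Delta.

(** * Stieltjes functions *)

Section Stieltjes.
Variables (R : realType) (X : completeNormedModType R[i]).
Let RB := measurableTypeR R.
Local Notation symbol_le := (@symbol_le R X).

Lemma cvgV_pos (u : nat -> R) (t : R) : 0 < t -> u @ \oo --> t ->
  (fun n => (u n)^-1) @ \oo --> t^-1.
Proof. by move=> t0 ut; apply: cvgV => //; rewrite gt_eqF. Qed.

(** The functionals [F |-> L (F (. / t))] have the symbols s0 (x / t).  They depend
    continuously on t > 0 but not at t = 0, hence the condition on [D]. *)
Lemma symbol_le_dilate_mix (m : {measure set RB -> \bar R}) (D : set RB) (k : R ->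
  R) (c N K : R) (s0 s : R -> R) :
  measurable D -> (forall t, D t -> 0 < t) ->
  measurable_fun D k -> (forall t, D t -> 0 <= k t) ->
  (\int[m]_(t in D) (k t)%:E = c%:E)%E ->
  symbol_le N s0 -> (forall y, 0 <= y -> 0 <= s0 y <= K) ->
  (forall y, 0 < y -> {for y, continuous s0}) ->
  (forall x, 0 < x -> (\int[m]_(t in D) (s0 (t^-1 * x) * k t)%:E = (s x)%:E)%E) ->
  symbol_le (c * N) s.
Proof.
move=> mD D0 mk k0 kc [L [nL sL]] s0K s0c hs.
have [|nu [nuD hnu]] := density_finite_measure (m := m) mD mk k0.
  by rewrite kc ltry.
rewrite kc in nuD.
have D0' t : D t -> 0 <= t by move=> /D0/ltW.
have hK x : 0 < x -> forall t, 0 <= t -> `|s0 (t^-1 * x)| <= K.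
  move=> x0 t t0; have tx : 0 <= t^-1 * x by rewrite mulr_ge0 ?invr_ge0// ltW.
  by have /andP[h1 h2] := s0K _ tx; rewrite ger0_norm.
have hcont x : 0 < x -> forall t, D t -> forall u : nat -> R, (forall n, 0 <= u n) ->
  u @ \oo --> t ->
    (fun n => s0 ((u n)^-1 * x)) @ \oo --> s0 (t^-1 * x).
  move=> x0 t Dt u u0 ut.
  apply: (@cvg_comp _ _ _ (fun n => (u n)^-1 * x) s0 _ (nbhs (t^-1 * x))).
    by apply: cvgMl; apply: cvgV_pos => //; exact: D0.
  by apply: s0c; rewrite mulr_gt0// invr_gt0 D0.
rewrite (_ : c = fine (nu D)); last by rewrite nuD.
eexists; apply: has_symbol_ext; last first.
  apply: (@has_symbol_mix R X nu D mD D0' N (fun F t => L (fun r => F (t^-1 * r))) _ _ _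
    _ _ _
    (fun x t => s0 (t^-1 * x)) K) => //.
  - exact: normal_ge0 nL.
  - move=> K' F FK t t0; apply: (normal_le nL); apply: bdd_seqcont_dilate FK;
    by rewrite invr_ge0.
  - move=> K' F FK t Dt u u0 ut; have t0 := D0 _ Dt.
    apply: (normal_dct nL (K := K') (Fn := fun n r => F ((u n)^-1 * r)) (F := fun r => F
      (t^-1 * r))).
    + by move=> n; apply: bdd_seqcont_dilate FK; rewrite invr_ge0.
    + by apply: bdd_seqcont_dilate FK; rewrite invr_ge0 ltW.
    + move=> r r0; case: FK => _ cF; apply: (cF _ _ (fun n => (u n)^-1 * r)).
      * by rewrite mulr_ge0// invr_ge0 ltW.
      * by move=> n; rewrite mulr_ge0// invr_ge0.
      * by apply: cvgMl; exact: cvgV_pos.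
  - move=> K1 K2 F G FK GK t /D0' t0; rewrite -invr_ge0 in t0.
    exact: (normalD nL (bdd_seqcont_dilate t0 FK) (bdd_seqcont_dilate t0 GK)).
  - move=> K1 F z FK t /D0' t0; rewrite -invr_ge0 in t0.
    exact: (normalZ nL z (bdd_seqcont_dilate t0 FK)).
  - move=> K' Fn F h h' h'' t /D0' t0; rewrite -invr_ge0 in t0.
    apply: (normal_dct nL (K := K') (Fn := fun n r => Fn n (t^-1 * r)) (F := fun r => F
      (t^-1 * r))).
    + by move=> n; exact: bdd_seqcont_dilate.
    + exact: bdd_seqcont_dilate.
    + by move=> r r0; apply: h''; rewrite mulr_ge0.
  - move=> x v t x0 /D0 t0; rewrite -sL ?mulr_gt0 ?invr_gt0//.
    congr L; apply/funext => r; rewrite /exp_vec; congr ((expR (- _))%:C *: _); ring.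
move=> x x0 /=; congr (_%:C).
have [mh _ _] := grid_real_integral nu mD D0' (hK _ x0) (hcont _ x0).
rewrite /Rintegral hnu//; last first.
  move=> t /D0 t0; have tx : 0 <= t^-1 * x by rewrite mulr_ge0 ?invr_ge0// ltW.
  by have /andP[] := s0K _ tx.
by rewrite setIid hs.
Qed.

Definition real_stieltjes (f : R -> R) := exists (a : R) (mu : {measure set RB -> \bar R}),
  [/\ 0 <= a, (\int[mu]_(tau in `[0%R, +oo[) ((1 + tau)^-1)%:E < +oo)%E &
   forall x, 0 < x -> f x = a + \int[mu]_(tau in `[0, +oo[) (x + tau)^-1].

Section Split.
Variables (a : R) (mu : {measure set RB -> \bar R}).
Hypotheses (a0 : 0 <= a) (fin : (\int[mu]_(tau in `[0%R, +oo[) ((1 + tau)^-1)%:E < +oo)%E).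

Lemma measurable_inv_shift (D : set RB) (x : R) : 0 < x -> measurable D ->
  D `<=` `[0, +oo[ ->
  measurable_fun D (fun t : R => (x + t)^-1).
Proof.
move=> x0 mD D0.
apply: (@eq_measurable_fun _ _ _ _ D (fun t => (x + Num.max 0 t)^-1)).
  move=> t; rewrite inE => /D0 /=; rewrite in_itv/= andbT => t0.
  by rewrite max_r.
apply: measurable_funTS; apply: continuous_measurable_fun => t.
apply: cvgV; first by rewrite gt_eqF// ltr_pwDl// le_max lexx.
apply: cvgD; first exact: cvg_cst.
exact: max0_continuous.
Qed.

(** The integrability condition at x = 1 implies integrability for every x > 0. *)
Lemma inv_shift_le (x t : R) : 0 < x -> 0 <= t -> (x + t)^-1 <= (1 + x^-1) * (1 + t)^-1.
Proof.
move=> x0 t0; rewrite ler_pdivlMr ?ltr_pwDl// ler_pdivrMl ?ltr_pwDl//.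
rewrite mulrDr mulr1 mulrDl mulfV ?gt_eqF//.
have : 0 <= t / x by rewrite divr_ge0// ltW.
lra.
Qed.

Lemma inv_shift_integrable (x : R) (D : set RB) : 0 < x -> measurable D ->
  D `<=` `[0, +oo[ ->
  mu.-integrable D (EFin \o (fun t => (x + t)^-1)).
Proof.
move=> x0 mD D0.
have i1 : mu.-integrable `[0, +oo[ (EFin \o (fun t => (1 + t)^-1)).
  apply/integrableP; split.
    by apply/measurable_EFinP; exact: measurable_inv_shift.
  apply: le_lt_trans fin; rewrite le_eqVlt; apply/orP; left; apply/eqP.
  apply: eq_integral => t; rewrite inE/= in_itv/= andbT => t0.
  by rewrite ger0_norm// invr_ge0 addr_ge0.
have mI : measurable (`[0, +oo[%classic : set RB) by exact: measurable_itv.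
have i2 := integrableZl mI (1 + x^-1) i1.
apply: (le_integrable mD _ _ (integrableS mI mD D0 i2)).
  by apply/measurable_EFinP; exact: measurable_inv_shift.
move=> t /D0 /=; rewrite in_itv/= andbT => t0.
rewrite lee_fin !ger0_norm ?mulr_ge0 ?invr_ge0 ?addr_ge0 ?invr_ge0 ?(ltW x0)//.
exact: inv_shift_le.
Qed.

Variable s : R.
Hypothesis s0 : 0 < s.
Let lo : set RB := `[0, s].
Let hi : set RB := `]s, +oo[.

Definition stieltjes_hi x := a + \int[mu]_(t in hi) (x + t)^-1.
Definition stieltjes_lo x := \int[mu]_(t in lo) (x + t)^-1.

Lemma lo_sub : lo `<=` `[0, +oo[.
Proof. by move=> t /=; rewrite !in_itv/= andbT => /andP[]. Qed.

Lemma hi_sub : hi `<=` `[0, +oo[.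
Proof. move=> t; rewrite /hi/= !in_itv/= !andbT => st; exact: ltW (lt_trans s0 st). Qed.

Lemma stieltjes_hi_lo x : 0 < x ->
  a + \int[mu]_(t in `[0, +oo[) (x + t)^-1 = stieltjes_hi x + stieltjes_lo x.
Proof.
move=> x0; rewrite /stieltjes_hi -addrA; congr (_ + _).
have e : (`[0, +oo[%classic : set RB) = lo `|` hi.
  apply/seteqP; split => t /=; rewrite /lo /hi /= !in_itv/= !andbT.
    by move=> t0; case: (leP t s) => h; [left; rewrite t0|right].
  by case=> [/andP[]//|st]; exact: ltW (lt_trans s0 st).
have mI : measurable (`[0, +oo[%classic : set RB) by exact: measurable_itv.
have mlo : measurable lo by exact: measurable_itv.
have mhi : measurable hi by exact: measurable_itv.
have ii := inv_shift_integrable x0 mI (@subset_refl _ _).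
rewrite e in ii *.
rewrite (Rintegral_setU mlo mhi ii); first exact: addrC.
- rewrite disj_set2E; apply/eqP/seteqP; split => t //=; rewrite /lo /hi/= !in_itv/= andbT.
  by move=> [/andP[_ ts]]; rewrite ltNge ts.
Qed.

Lemma stieltjes_part_ge0 x D : 0 < x -> D `<=` `[0, +oo[ ->
  0 <= \int[mu]_(t in D) (x + t)^-1.
Proof.
move=> x0 D0; apply: Rintegral_ge0 => t /D0 /=; rewrite in_itv/= andbT => t0.
by rewrite invr_ge0 addr_ge0// ltW.
Qed.

(** Beyond s, 1 / (x + t) is t^-1 times the resolvent symbol 1 / (1 + x / t) of
    norm 1, and t^-1 <= 2 / (s + t). *)
Lemma symbol_le_stieltjes_hi : symbol_le (2 * stieltjes_hi s) stieltjes_hi.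
Proof.
have mhi : measurable hi by exact: measurable_itv.
have hi0 t : hi t -> 0 < t by rewrite /hi /= in_itv/= andbT; exact: lt_trans.
have mk : measurable_fun hi (fun t : R => t^-1).
  apply: (@eq_measurable_fun _ _ _ _ hi (fun t => (s + Num.max 0 (t - s))^-1)).
    move=> t; rewrite inE /hi/= in_itv/= andbT => t0.
    by rewrite max_r ?subr_ge0 ?(ltW t0)// addrC subrK.
  apply: measurable_funTS; apply: continuous_measurable_fun => t.
  apply: cvgV; first by rewrite gt_eqF// ltr_pwDl// le_max lexx.
  apply: cvgD; first exact: cvg_cst.
  apply: (@cvg_comp _ _ _ (fun t => t - s) (Num.max 0) _ (nbhs (t - s)));
    last exact: max0_continuous.
  by apply: cvgB; [exact: cvg_id|exact: cvg_cst].
have i1 := inv_shift_integrable s0 mhi hi_sub.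
have le2 t : hi t -> t^-1 <= 2 * (s + t)^-1.
  move=> ht; have t0 := hi0 _ ht; move: ht; rewrite /hi/= in_itv/= andbT => st.
  rewrite ler_pdivlMr ?addr_gt0// ler_pdivrMl// ; lra.
have kfin : mu.-integrable hi (EFin \o (fun t : R => t^-1)).
  apply: (le_integrable mhi _ _ (integrableZl mhi 2 i1)); first exact/measurable_EFinP.
  move=> t ht; rewrite -EFinM lee_fin !ger0_norm ?le2// ?invr_ge0 ?mulr_ge0 ?invr_ge0
    ?addr_ge0// ?ltW// hi0//.
have h1 : symbol_le (\int[mu]_(t in hi) t^-1 * 1) (fun x => \int[mu]_(t in hi) (x + t)^-1).
  apply: (symbol_le_dilate_mix (m := mu) (D := hi) (k := fun t => t^-1) (s0 := fun y =>
    (1 + y)^-1) (K := 1)) => //.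
  - by move=> t /hi0 t0; rewrite invr_ge0 ltW.
  - rewrite /Rintegral fineK//; exact: integrable_fin_num kfin.
  - exact: symbol_le_exponential.
  - by move=> y y0; rewrite invr_ge0 addr_ge0//= invf_le1 ?lerDl// ltr_pwDl.
  - move=> y y0; apply: cvgV; first by rewrite gt_eqF// addr_gt0.
    by apply: cvgD; [exact: cvg_cst|exact: cvg_id].
  - move=> x x0; rewrite /Rintegral fineK;
    last exact: integrable_fin_num (inv_shift_integrable x0 mhi hi_sub).
    apply: eq_integral => t; rewrite inE => /hi0 t0; congr EFin.
    by field; rewrite !gt_eqF ?addr_gt0.
have h2 : symbol_le (a * 1) (fun _ => a * 1) by have := symbol_le_scale a (symbol_le1 X);
  rewrite ger0_norm.
apply: symbol_le_ext (symbol_le_weak _ (symbol_le_add h2 h1)) => [x x0|];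
  first by rewrite mulr1.
rewrite !mulr1 /stieltjes_hi mulrDr lerD//; first by rewrite ler_peMl// ler1n.
rewrite -RintegralZl//; apply: le_Rintegral => //.
exact: (integrableZl mhi 2 i1).
Qed.

(** Below s, x / (x + t) = 1 - 1 / (1 + x / t) is a symbol of norm at most 2, and
    1 <= 2 s / (s + t).  A possible atom at 0 contributes the constant [b]. *)
Lemma symbol_le_stieltjes_lo : symbol_le (4 * s * stieltjes_lo s) (fun x => x *
  stieltjes_lo x).
Proof.
pose D := `]0, s]%classic : set RB.
have mD : measurable D by exact: measurable_itv.
have D0 t : D t -> 0 < t by rewrite /D /= in_itv/= => /andP[].
have Ds : D `<=` `[0, +oo[ by move=> t /D0 t0; rewrite /= in_itv/= andbT ltW.
have mlo : measurable lo by exact: measurable_itv.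
have ilo := inv_shift_integrable s0 mlo lo_sub.
have onei : mu.-integrable lo (EFin \o (fun t : R => 1 : R)).
  apply: (le_integrable mlo _ _ (integrableZl mlo (2 * s) ilo));
    first exact/measurable_EFinP.
  move=> t; rewrite /lo/= in_itv/= => /andP[t0 ts].
  rewrite lee_fin !ger0_norm// ?mulr_ge0 ?invr_ge0 ?addr_ge0// ?(ltW s0)//.
  rewrite ler_pdivlMr ?ltr_pwDl//; lra.
have Dlo : D `<=` lo by move=> t; rewrite /D /lo/= !in_itv/= => /andP[/ltW -> ->].
have oneD := integrableS mlo mD Dlo onei.
have e : lo = [set 0] `|` D.
  apply/seteqP; split => t; rewrite /D /lo /= !in_itv/=.
    by move=> /andP[]; rewrite le_eqVlt => /orP[/eqP <-|-> ->]; [left|right].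
  by case=> [->|/andP[/ltW -> ->]//]; rewrite lexx ltW.
have dis : [disjoint [set 0] & D].
  rewrite disj_set2E; apply/eqP/seteqP; split => t //= [->].
  by rewrite /D/= in_itv/= ltxx.
have m0 : measurable ([set 0] : set RB) by exact: measurable_set1.
have S0 : [set 0] `<=` lo by move=> t ->; rewrite /lo/= in_itv/= lexx ltW.
have one0 := integrableS mlo m0 S0 onei.
have b_fin : mu [set 0] \is a fin_num.
  have := integrable_fin_num m0 one0.
  by rewrite integral_cst// mul1e.
pose b := fine (mu [set 0]).
have h1 : symbol_le (\int[mu]_(t in D) 1 * 2) (fun x => \int[mu]_(t in D) (x * (x + t)^-1)).
  apply: (symbol_le_dilate_mix (m := mu) (D := D) (k := fun t => 1) (s0 := fun y => 1 -
    (1 + y)^-1) (K := 1)) => //.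
  - rewrite /Rintegral fineK//; exact: integrable_fin_num oneD.
  - by rewrite (_ : 2 = 1 + 1 :> R)//; apply: symbol_le_sub;
    [exact: symbol_le1|exact: symbol_le_exponential].
  - move=> y y0; rewrite subr_ge0 invf_le1 ?lerDl ?y0 ?ltr_pwDl//=.
    by rewrite gerBl invr_ge0 addr_ge0.
  - move=> y y0; apply: cvgB; first exact: cvg_cst.
    apply: cvgV; first by rewrite gt_eqF// addr_gt0.
    by apply: cvgD; [exact: cvg_cst|exact: cvg_id].
  - move=> x x0; rewrite /Rintegral fineK; last first.
      by apply: integrable_fin_num => //;
        exact: (integrableZl mD x (inv_shift_integrable x0 mD Ds)).
    apply: eq_integral => t; rewrite inE => /D0 t0; congr EFin.
    by field; rewrite !gt_eqF ?addr_gt0.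
have h2 : symbol_le (b * 1) (fun _ => b * 1).
  by have := symbol_le_scale b (symbol_le1 X); rewrite ger0_norm// fine_ge0.
apply: symbol_le_ext (symbol_le_weak _ (symbol_le_add h2 h1)) => [x x0|].
  rewrite /stieltjes_lo e Rintegral_setU//; last first.
    by rewrite -e; exact: (inv_shift_integrable x0 mlo lo_sub).
  rewrite mulrDr RintegralZl//; last exact: (inv_shift_integrable x0 mD Ds).
  congr (_ + _); rewrite mulr1.
  have -> : \int[mu]_(t in [set 0]) (x + t)^-1 = \int[mu]_(t in [set 0]) x^-1.
    by apply: eq_Rintegral => t; rewrite inE => /= ->; rewrite addr0.
  by rewrite Rintegral_cst// mulrA mulfV ?gt_eqF// mul1r.
rewrite mulr1.
have : b + \int[mu]_(t in D) 1 = \int[mu]_(t in lo) 1.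
  have onei' := onei; rewrite e in onei'.
  rewrite e (Rintegral_setU m0 mD onei' dis); congr (_ + _).
  by rewrite (Rintegral_cst mu m0) mul1r.
have le : \int[mu]_(t in lo) 1 <= 2 * s * stieltjes_lo s.
  rewrite /stieltjes_lo -RintegralZl//; apply: le_Rintegral => //.
    exact: (integrableZl mlo (2 * s) ilo).
  move=> t; rewrite /lo/= in_itv/= => /andP[t0 ts].
  rewrite ler_pdivlMr ?ltr_pwDl//; lra.
have : 0 <= b by rewrite fine_ge0.
have : 0 <= \int[mu]_(t in D) 1 by apply: Rintegral_ge0.
move: (\int[mu]_(t in D) 1) (\int[mu]_(t in lo) 1) le => u v le h3 h4 h5; lra.
Qed.
End Split.

Lemma real_stieltjes_split (f : R -> R) (s : R) : real_stieltjes f -> 0 < s ->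
  exists f1 f2 : R -> R,
  [/\ forall x, 0 < x -> f x = f1 x + f2 x, symbol_le (2 * f1 s) f1,
    symbol_le (4 * s * f2 s) (fun x => x * f2 x), 0 <= f1 s & 0 <= f2 s].
Proof.
move=> [a [mu [a0 fin fE]]] s0; exists (stieltjes_hi a mu s), (stieltjes_lo mu s); split.
- by move=> x x0; rewrite fE// (stieltjes_hi_lo a fin s0).
- exact: symbol_le_stieltjes_hi.
- exact: symbol_le_stieltjes_lo.
- by rewrite addr_ge0//; apply: stieltjes_part_ge0 => //; exact: hi_sub.
- by apply: stieltjes_part_ge0 => //; exact: lo_sub.
Qed.

(** The expansion of the product of the two splittings.  The mixed terms have the
    largest constant, 3/2 * 2 * 4 = 12. *)
Lemma symbol_le_euler_err_stieltjes (f1 f2 : R -> R) n t : real_stieltjes f1 ->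
  real_stieltjes f2 -> (0 < n)%N -> 0 < t ->
  let s := Num.sqrt n%:R / t in
  symbol_le (12 * (f1 s * f2 s)) (fun x => euler_err n (t / n%:R) x * (f1 x * f2 x)).
Proof.
move=> h1 h2 n0 t0 s; have nr0 : 0 < n%:R :> R by rewrite ltr0n.
have q0 : 0 < Num.sqrt n%:R :> R by rewrite sqrtr_gt0.
have s0 : 0 < s by rewrite divr_gt0.
set th := t / n%:R; have th0 : 0 < th by rewrite divr_gt0.
have [p1 [q1 [e1 hp1 hq1 p10 q10]]] := real_stieltjes_split h1 s0.
have [p2 [q2 [e2 hp2 hq2 p20 q20]]] := real_stieltjes_split h2 s0.
have H0 := symbol_le_mul (symbol_le_euler_err X n th0) (symbol_le_mul hp1 hp2).
have H1 := symbol_le_mul (symbol_le_euler_err_div X th0 n0) (symbol_le_add (symbol_le_mul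
  hp1 hq2) (symbol_le_mul hq1 hp2)).
have H2 := symbol_le_mul (symbol_le_euler_err_div2 X n th0) (symbol_le_mul hq1 hq2).
apply: symbol_le_ext (symbol_le_weak _ (symbol_le_add (symbol_le_add H0 H1) H2)) => [x x0|].
  by rewrite e1// e2//; field; rewrite gt_eqF.
rewrite (e1 _ s0) (e2 _ s0).
have sq : Num.sqrt n%:R ^+ 2 = n%:R :> R by rewrite sqr_sqrtr ?ler0n.
have E1 : 3 / 2 * (th * Num.sqrt n%:R) * s = 3 / 2.
  rewrite /th /s (_ : _ * _ * _ = 3 / 2 * (Num.sqrt n%:R ^+ 2 / n%:R)); last first.
    by field; rewrite !gt_eqF.
  by rewrite sq mulfV ?gt_eqF// mulr1.
have E2 : n%:R * (th ^+ 2 / 2) * s ^+ 2 = 2^-1.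
  rewrite /th /s (_ : _ * _ * _ = Num.sqrt n%:R ^+ 2 / n%:R / 2); last first.
    by field; rewrite !gt_eqF.
  by rewrite sq mulfV ?gt_eqF// div1r.
have -> : 3 / 2 * (th * Num.sqrt n%:R) * (2 * p1 s * (4 * s * q2 s) + 4 * s * q1 s * (2 *
  p2 s)) =
  (3 / 2 * (th * Num.sqrt n%:R) * s) * (8 * (p1 s * q2 s + q1 s * p2 s)) by ring.
have -> : n%:R * (th ^+ 2 / 2) * (4 * s * q1 s * (4 * s * q2 s)) =
  (n%:R * (th ^+ 2 / 2) * s ^+ 2) * (16 * (q1 s * q2 s)) by ring.
rewrite E1 E2.
have : 0 <= p1 s * p2 s by rewrite mulr_ge0.
have : 0 <= q1 s * q2 s by rewrite mulr_ge0.
by move: (p1 s) (p2 s) (q1 s) (q2 s) => A B C E ? ?; lra.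
Qed.

End Stieltjes.

(** * The functional calculus of the semigroup *)

Section RightLimits.
Variables (R : realType) (X : normedModType R[i]).
Implicit Types (F : R -> X).

Lemma cvg_at_right_rnormP F (l : X) : F @ 0^'+ --> l <->
  forall e, 0 < e -> exists2 d : R, 0 < d & forall h, 0 < h < d -> rnorm (F h - l) < e.
Proof.
split.
  move=> /cvgrPdist_lt H e e0.
  have e0' : 0 < e%:C by rewrite ltcR.
  have := H _ e0'; rewrite near_withinE => /nbhs_ballP[d /= d0 hd].
  exists d => // h /andP[h0 hd'].
  have := hd h; rewrite /ball/= sub0r normrN gtr0_norm// => /(_ hd' h0).
  by rewrite distrC rnormE ltcR.
move=> H; apply/cvgrPdist_lt => e e0.
have e0' : 0 < complex.Re e by move: e0; rewrite ltcE => /andP[_].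
have [d d0 hd] := H _ e0'.
rewrite near_withinE; apply/nbhs_ballP; exists d => // h /=.
rewrite /ball/= sub0r normrN => hh h0; rewrite gtr0_norm// in hh.
have := hd h; rewrite h0 hh => /(_ isT) hn.
by rewrite distrC rnormE; move: e0; rewrite !ltcE/= => /andP[-> _].
Qed.

Lemma cvg_at_right_of_seq F (l : X) : (forall u : nat -> R, (forall n, 0 < u n) ->
  u @ \oo --> (0 : R) ->
  (fun n => F (u n)) @ \oo --> l) -> F @ 0^'+ --> l.
Proof.
move=> H; apply/cvg_at_right_rnormP => e e0; apply: contrapT => h.
have H2 (n : nat) : exists s, [/\ 0 < s, s < n.+1%:R^-1 & ~~ (rnorm (F s - l) < e)].
  apply: contrapT => h'; apply: h; exists n.+1%:R^-1; first by rewrite invr_gt0 ltr0n.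
  move=> s /andP[s0 st]; apply: contrapT => h''; apply: h'; exists s; split=> //.
  exact/negP.
have [u hu] := choice H2.
have u0 n : 0 < u n by have [] := hu n.
have ut : u @ \oo --> (0 : R).
  apply: (@squeeze_cvgr _ _ _ _ (cst 0) (fun n => n.+1%:R^-1)).
  - apply: nearW => n /=; have [/ltW -> /ltW ->] := hu n; by [].
  - exact: cvg_cst.
  - exact: (@cvg_harmonic R).
have /cvg_rnormP/cvgrPdist_lt/(_ _ e0)[n _ /(_ n (leqnn n))] := H u u0 ut.
rewrite /= sub0r normrN ger0_norm ?rnorm_ge0//.
by have [_ _ /negP] := hu n.
Qed.

Lemma cvg_seq_of_at_right F (l : X) (u : nat -> R) : F @ 0^'+ --> l ->
  (forall n, 0 < u n) -> u @ \oo --> (0 : R) ->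
  (fun n => F (u n)) @ \oo --> l.
Proof.
move=> /cvg_at_right_rnormP H u0 /cvgrPdist_lt ut; apply/cvg_rnormP/cvgrPdist_lt => e e0.
have [d d0 hd] := H _ e0; have [N _ hN] := ut _ d0; exists N => // n /hN /=.
rewrite !sub0r !normrN gtr0_norm// ger0_norm ?rnorm_ge0// => h.
by apply: hd; rewrite u0 h.
Qed.
End RightLimits.

Section Semigroup.
Variables (R : realType) (X : completeNormedModType R[i]).
Variables (A : operator X) (T : R -> X -> X) (M : R).
Hypotheses (hT : C0_semigroup T) (hA : neg_generator A T) (hM : semigroup_sup T = M%:E).

Lemma T_lin t : 0 <= t -> forall (c : R[i]) u v, T t (c *: u + v) = c *: T t u + T t v.
Proof. by move=> t0 c u v; have := C0_linear hT t0 c u v. Qed.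

Lemma T_D t u v : 0 <= t -> T t (u + v) = T t u + T t v.
Proof. by move=> t0; have := T_lin t0 1 u v; rewrite !scale1r. Qed.

Lemma T_0 t : 0 <= t -> T t 0 = 0.
Proof. by move=> t0; apply: (addrI (T t 0)); rewrite -T_D// !addr0. Qed.

Lemma T_Z t c v : 0 <= t -> T t (c *: v) = c *: T t v.
Proof. by move=> t0; have := T_lin t0 c v 0; rewrite T_0// !addr0. Qed.

Lemma T_unit t v : 0 <= t -> rnorm v <= 1 -> rnorm (T t v) <= M.
Proof.
move=> t0 v1; rewrite -lee_fin -hM.
apply: le_trans (ereal_sup_ubound _); last by exists t.
apply: ereal_sup_ubound; exists v => //=.
by rewrite rnormE -[1]/(1%:C) lecR.
Qed.

Lemma M_ge0 : 0 <= M.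
Proof. by apply: le_trans (rnorm_ge0 _) (@T_unit 0 0 (lexx _) _); rewrite rnorm0. Qed.

Lemma T_le t v : 0 <= t -> rnorm (T t v) <= M * rnorm v.
Proof.
move=> t0; have [v0|v0] := eqVneq (rnorm v) 0.
  by rewrite (rnorm0_eq0 v0) T_0// !rnorm0 mulr0.
have vp : 0 < rnorm v by rewrite lt_def v0 rnorm_ge0.
have := @T_unit t ((rnorm v)^-1%:C *: v) t0.
rewrite T_Z// !rnormZ ger0_norm ?invr_ge0 ?rnorm_ge0// mulVf// => /(_ (lexx _)).
by rewrite ler_pdivrMl// mulrC.
Qed.

Lemma T_near x (d : nat -> R) : (forall n, 0 <= d n) -> d @ \oo --> (0 : R) ->
  (fun n => T (d n) x) @ \oo --> x.
Proof.
move=> d0 /cvgrPdist_lt dn; apply/cvg_rnormP/cvgrPdist_lt => e e0.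
have /cvg_at_right_rnormP/(_ _ e0)[r r0 hr] := @C0_strong _ _ _ hT x.
have [N _ hN] := dn _ r0; exists N => // n /hN /=.
rewrite !sub0r !normrN (ger0_norm (d0 n)) ger0_norm ?rnorm_ge0// => h.
have [->|dn0] := eqVneq (d n) 0; first by rewrite (C0_zero hT) subrr rnorm0.
by apply: hr; rewrite lt_def dn0 d0 h.
Qed.

(** || T u x - T t x || <= M || T |u - t| x - x || for both orders of u and t. *)
Lemma bdd_seqcont_orbit x : bdd_seqcont (M * rnorm x) (fun t => T t x).
Proof.
split=> t t0; first exact: T_le.
move=> u u0 ut; apply/cvg_rnormP.
have dc : (fun n => `|u n - t|) @ \oo --> (0 : R).
  rewrite -(normr0 R) -(subrr t); apply: cvg_norm; apply: cvgB => //; exact: cvg_cst.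
have /cvg_rnormP c0 := @T_near x _ (fun n => normr_ge0 (u n - t)) dc.
have c : (fun n => M * rnorm (T `|u n - t| x - x)) @ \oo --> (0 : R).
  by rewrite -(mulr0 M); apply: cvgMr.
apply: (squeeze_cvgr _ (cvg_cst 0) c); apply: nearW => n; rewrite rnorm_ge0/=.
have key s d : 0 <= s -> 0 <= d -> rnorm (T (s + d) x - T s x) <= M * rnorm (T d x - x).
  move=> s0 d0; rewrite (C0_add hT)// -scaleN1r -T_Z// -T_D// scaleN1r.
  exact: T_le.
have [h|h] := leP t (u n).
  have h' : 0 <= u n - t by rewrite subr_ge0.
  by have := key t _ t0 h'; rewrite [t + _]addrC subrK ger0_norm.
have h' : 0 <= t - u n by rewrite subr_ge0 ltW.
have := key (u n) _ (u0 n) h'; rewrite (_ : u n + (t - u n) = t) 1?rnorm_distC;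
  last by ring.
by rewrite ltr0_norm ?subr_lt0// opprB.
Qed.

Definition orbit_op (L : (R -> X) -> X) (x : X) := L (fun t => T t x).

(** A normal functional commutes with the bounded operator [T s]. *)
Lemma orbit_op_commT N lam L s x : has_symbol N lam L -> 0 <= s ->
  L (fun r => T (s + r) x) = T s (orbit_op L x).
Proof.
move=> cL s0; rewrite /orbit_op -(normal_bounded M_ge0 _ _ _ cL (bdd_seqcont_orbit x)).
- apply: (normal_ext cL.1); first exact: bdd_seqcont_shift s0 (bdd_seqcont_orbit x).
  by move=> r r0; rewrite (C0_add hT).
- by move=> v w; exact: T_D.
- by move=> c v; exact: T_Z.
- by move=> v; exact: T_le.
Qed.

(** The spectral mapping property: convolution of functionals is composition of
    operators, and the symbol alone determines the operator. *)
Lemma orbit_op_mul N1 l1 L1 N2 l2 L2 N l L x : has_symbol N1 l1 L1 ->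
  has_symbol N2 l2 L2 -> has_symbol N l L ->
  (forall y, 0 < y -> l y = l1 y * l2 y) -> orbit_op L x = orbit_op L1 (orbit_op L2 x).
Proof.
move=> c1 c2 c e; rewrite /orbit_op (has_symbol_uniq c (has_symbol_conv c1 c2) e
  (bdd_seqcont_orbit x)).
apply: (normal_ext c1.1); first exact: normal_shift c2.1 (bdd_seqcont_orbit x).
by move=> s s0; rewrite (orbit_op_commT _ c2).
Qed.

Lemma orbit_op_eq N l L N' l' L' x : has_symbol N l L -> has_symbol N' l' L' ->
  (forall y, 0 < y -> l y = l' y) -> orbit_op L x = orbit_op L' x.
Proof. by move=> c c' e; rewrite /orbit_op (has_symbol_uniq c c' e (bdd_seqcont_orbit
  x)). Qed.

Lemma orbit_op_le N l L x : has_symbol N l L -> rnorm (orbit_op L x) <= N * (M * rnorm x).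
Proof. by move=> [nL _]; exact: normal_le nL _ _ (bdd_seqcont_orbit x). Qed.

Lemma orbit_opD N l L x y : has_symbol N l L ->
  orbit_op L (x + y) = orbit_op L x + orbit_op L y.
Proof.
move=> [nL _]; rewrite /orbit_op -(normalD nL (bdd_seqcont_orbit x) (bdd_seqcont_orbit y)).
apply: (normal_ext nL (bdd_seqcont_orbit _)) => t t0; exact: T_D.
Qed.

Lemma orbit_opZC N l L x (c : R[i]) : has_symbol N l L ->
  orbit_op L (c *: x) = c *: orbit_op L x.
Proof.
move=> cL; have c0 : 0 <= complex.Re `|c| by have := normr_ge0 c; rewrite lecE => /andP[].
rewrite /orbit_op -(normal_bounded (S := *:%R c) c0 _ _ _ cL (bdd_seqcont_orbit x)).
- by apply: (normal_ext cL.1 (bdd_seqcont_orbit _)) => t t0; exact: T_Z.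
- exact: scalerDr.
- by move=> d v; rewrite !scalerA mulrC.
- by move=> v; rewrite rnormZC.
Qed.

(** Constants are the limits of exponentials of exponent 1 / (n + 1). *)
Lemma normal_const N (s : R -> R) L v c : has_symbol N (fun x => (s x)%:C) L ->
  (fun n => s n.+1%:R^-1) @ \oo --> (c : R) -> L (fun=> v : X) = c%:C *: v.
Proof.
move=> [nL sL] sc.
have c1 : (fun n => L (exp_vec n.+1%:R^-1 v)) @ \oo --> L (fun=> v).
  apply: (normal_dct nL (K := rnorm v)).
  - by move=> n; apply: bdd_seqcont_exp_vec; rewrite invr_gt0 ltr0n.
  - exact: bdd_seqcont_cst.
  - move=> t t0; have ev : v = (expR (- (0 * t)))%:C *: v by rewrite mul0r oppr0 expR0
    scale1r.
    rewrite [X in _ --> X]ev.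
    apply: cvg_scale_real; first exact: cvg_cst.
    apply: (@cvg_comp _ _ _ (fun n => - (n.+1%:R^-1 * t)) expR _ _ _ _ (@continuous_expR
      R _)).
    by apply: cvgN; apply: cvgMl; exact: (@cvg_harmonic R).
have c2 : (fun n => L (exp_vec n.+1%:R^-1 v)) @ \oo --> c%:C *: v.
  have -> : (fun n => L (exp_vec n.+1%:R^-1 v)) = (fun n => (s n.+1%:R^-1)%:C *: v).
    by apply/funext => n; rewrite sL// invr_gt0 ltr0n.
  by apply: cvg_scale_real => //; exact: cvg_cst.
exact: (cvg_unique _ c1 c2).
Qed.

Lemma uniform_limit : (fun n : nat => (1 - expR (- n.+1%:R^-1)) / n.+1%:R^-1) @ \oo -->
  (1 : R).
Proof.
apply: (@squeeze_cvgr _ _ _ _ (fun n => expR (- n.+1%:R^-1)) (cst 1)).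
- apply: nearW => n /=; set y := n.+1%:R^-1.
  have y0 : 0 < y :> R by rewrite invr_gt0 ltr0n.
  apply/andP; split.
    rewrite ler_pdivlMr//.
    have h : expR (- y) * (1 + y) <= expR (- y) * expR y by rewrite ler_wpM2l ?expR_ge0
      ?expR_ge1Dx.
    by move: h; rewrite -expRD addNr expR0; lra.
  have := expR_ge1Dx (- y); rewrite ler_pdivrMr// mul1r; lra.
- have e1 : (1 : R) = expR (- 0) by rewrite oppr0 expR0.
  rewrite [X in _ --> X]e1.
  apply: (@cvg_comp _ _ _ (fun n => - (n.+1%:R^-1)) expR _ _ _ _ (@continuous_expR R _)).
  by apply: cvgN; exact: (@cvg_harmonic R).
- exact: cvg_cst.
Qed.

Section Resolvent.
Variables (th : R) (LE : (R -> X) -> X).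
Hypotheses (th0 : 0 < th) (cE : has_symbol 1 (fun x => ((1 + th * x)^-1)%:C) LE).
Let E := orbit_op LE.

Let quot x h := (h^-1)%:C *: (T h x - x).

(** The symbol identity
    ((e^(- h x) - 1) / h) / (1 + theta x) =
      - ((1 - e^(- h x)) / (h x)) (1 - 1 / (1 + theta x)) / theta
    writes the difference quotient of [E v] as minus an average of the orbit of
    (v - E v) / theta over [0, h], which converges to its value at 0. *)
Lemma quot_resolvent v : quot (E v) h @[h --> 0^'+] --> (th^-1)%:C *: (E v - v).
Proof.
have [LB cB] := symbol_le_uniform X.
pose w := (th^-1)%:C *: (v - E v).
have Bw : LB (fun=> w) = w by rewrite (normal_const w cB uniform_limit) scale1r.
have EB h : 0 < h -> quot (E v) h = - LB (fun r => T (h * r) w).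
  move=> h0; have cBh := has_symbol_dilate h0 cB.
  have c1 := has_symbol_delta X (lexx (0 : R)).
  have cA := has_symbol_scaleR h^-1 (has_symbol_add (has_symbol_delta X (ltW h0))
    (has_symbol_scaleR (-1) c1)).
  have cB1 := has_symbol_scaleR (-1) cBh.
  have cC1 := has_symbol_scaleR th^-1 (has_symbol_add c1 (has_symbol_scaleR (-1) cE)).
  have H := orbit_op_mul v cA cE (has_symbol_conv cB1 cC1).
  rewrite (orbit_op_mul v cB1 cC1 (has_symbol_conv cB1 cC1)) // in H.
  have N1 (u : X) : (-1)%:C *: u = - u by rewrite rmorphN1 scaleN1r.
  have wE : (th^-1)%:C *: (T 0 v + (-1)%:C *: E v) = w by rewrite (C0_zero hT) N1.
  rewrite /orbit_op wE !N1 (C0_zero hT) in H.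
  rewrite /quot /E /orbit_op -H // => y y0.
  rewrite -!(rmorphM, rmorphD)/=; congr (_%:C).
  rewrite mulr0 oppr0 expR0 [y * h]mulrC; field.
  by rewrite !gt_eqF//= ?ltr_pwDr// ?mulr_gt0.
apply: cvg_at_right_of_seq => u u0 ut.
have -> : (fun n => quot (E v) (u n)) = (fun n => - LB (fun r => T (u n * r) w)).
  by apply/funext => n; rewrite EB.
have -> : (th^-1)%:C *: (E v - v) = - LB (fun=> w) by rewrite Bw /w -scalerN opprB.
apply: cvgN; apply: (normal_dct cB.1 (K := M * rnorm w) (Fn := fun n r => T (u n * r) w)).
- by move=> n; apply: (bdd_seqcont_dilate (ltW (u0 n)) (bdd_seqcont_orbit w)).
- apply: bdd_seqcont_le (bdd_seqcont_cst w).
  by have := @T_le 0 w (lexx _); rewrite (C0_zero hT).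
- move=> t t0; apply: T_near => [n|]; first by rewrite mulr_ge0// ltW.
  by rewrite -(mul0r t); apply: cvgMl.
Qed.

Lemma resolvent_sol v : dom A (E v) /\ E v + th%:C *: A (E v) = v.
Proof.
have q := @quot_resolvent v.
have [d1 d2] := hA.
have dE : dom A (E v) by apply/d1; exists ((th^-1)%:C *: (E v - v)).
split=> //.
have e : (th^-1)%:C *: (E v - v) = - A (E v).
  by apply: (cvg_unique _ q (d2 _ dE)); exact: norm_hausdorff.
have eA : (th^-1)%:C *: (v - E v) = A (E v) by rewrite -opprB scalerN e opprK.
by rewrite -eA scalerA -rmorphM mulfV ?gt_eqF// scale1r addrC subrK.
Qed.

(** [E] commutes with the difference quotients, so that those of [E z] tend both
    to E z / theta and, by [quot_resolvent], to (E z - z) / theta. *)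
Lemma resolvent_zero z : quot z h @[h --> 0^'+] --> (th^-1)%:C *: z -> z = 0.
Proof.
move=> qz.
have q1 := @quot_resolvent z.
have EZ (c : R) v : E (c%:C *: v) = c%:C *: E v := orbit_opZC v c%:C cE.
have EB a b : E (a - b) = E a - E b.
  by rewrite -[- b]scaleN1r /E (orbit_opD _ _ cE) (orbit_opZC _ _ cE) scaleN1r.
have q2 : quot (E z) h @[h --> 0^'+] --> (th^-1)%:C *: E z.
  apply: cvg_at_right_of_seq => u u0 ut.
  have -> : (fun n => quot (E z) (u n)) = (fun n => E (quot z (u n))).
    apply/funext => n; rewrite /quot EZ EB.
    congr (_ *: (_ - _)).
    have cd := has_symbol_delta X (ltW (u0 n)).
    have h1 := orbit_op_mul z cd cE (has_symbol_conv cd cE) (fun _ _ => erefl).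
    have h2 := orbit_op_mul z cE cd (has_symbol_conv cd cE) (fun _ _ => mulrC _ _).
    by rewrite /orbit_op in h1 h2 *; rewrite -h1 h2.
  rewrite -EZ.
  have qz' := cvg_seq_of_at_right qz u0 ut.
  apply: (bounded_op_cvg (S := E) (C := M)) => //.
  - by move=> x y; exact: (orbit_opD _ _ cE).
  - by move=> c x; exact: (orbit_opZC _ _ cE).
  - by move=> x; have := orbit_op_le x cE; rewrite mul1r.
have e : (th^-1)%:C *: (E z - z) = (th^-1)%:C *: E z.
  by apply: (cvg_unique _ q1 q2); exact: norm_hausdorff.
have thu : (th%:C : R[i]) *: ((th^-1)%:C *: (E z - z)) =
  th%:C *: ((th^-1)%:C *: E z) by rewrite e.
rewrite !scalerA -!rmorphM mulfV ?gt_eqF// !scale1r in thu.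
by apply/eqP; rewrite -oppr_eq0; apply/eqP/(addrI (E z)); rewrite thu addr0.
Qed.

Lemma resolventE v : resolvent A th v = E v.
Proof.
have [dE sE] := resolvent_sol v.
have [/= du su] := @getI _ [set u | dom A u /\ u + th%:C *: A u = v] _ (conj dE sE).
rewrite -[get _]/(resolvent A th v) in du su *.
move: (resolvent A th v) du su => u du su.
have [_ d2] := hA.
have qu := d2 _ du; have qE := @quot_resolvent v.
apply/eqP; rewrite -subr_eq0; apply/eqP/resolvent_zero.
apply: cvg_at_right_of_seq => r r0 rt.
have c1 := cvg_seq_of_at_right qu r0 rt; have c2 := cvg_seq_of_at_right qE r0 rt.
have -> : (fun n => quot (u - E v) (r n)) = (fun n => quot u (r n) - quot (E v) (r n)).
  apply/funext => n; rewrite /quot -[- E v]scaleN1r T_D ?T_Z ?ltW// !scaleN1r -scalerBr.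
  by congr (_ *: _); rewrite !opprD !opprK addrACA.
have -> : (th^-1)%:C *: (u - E v) = - A u - (th^-1)%:C *: (E v - v).
  have eA : (th^-1)%:C *: (v - u) = A u.
    by rewrite -su addrC addKr scalerA -rmorphM mulVf ?gt_eqF// scale1r.
  by rewrite -eA -scalerN -scalerBr; congr (_ *: _); rewrite !opprB addrA subrK.
exact: cvgB c1 c2.
Qed.

Lemma iter_resolvent n N L x : has_symbol N (fun x => ((1 + th * x)^-1 ^+ n)%:C) L ->
  iter n (resolvent A th) x = orbit_op L x.
Proof.
elim: n N L => [|n IH] N L cL /=.
  rewrite (orbit_op_eq x cL (has_symbol_delta X (lexx 0)));
    first by rewrite /orbit_op (C0_zero hT).
  by move=> y _; rewrite expr0 mulr0 oppr0 expR0.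
have [Ln cn] : symbol_le X 1 (fun x => (1 + th * x)^-1 ^+ n) := symbol_le_resolventX X n
  th0.
rewrite (IH _ _ cn) resolventE; apply/esym/(orbit_op_mul x cE cn cL) => y y0.
by rewrite -rmorphM -exprS.
Qed.
End Resolvent.

Lemma Delta_op n t N L x : (0 < n)%N -> 0 < t ->
  has_symbol N (fun x => (euler_err n (t / n%:R) x)%:C) L -> Delta A T n t x = orbit_op L x.
Proof.
move=> n0 t0 cL; have nr0 : 0 < n%:R :> R by rewrite ltr0n.
have th0 : 0 < t / n%:R by rewrite divr_gt0.
have [LE cE] := symbol_le_resolvent X th0; have [Ln cn] := symbol_le_resolventX X n th0.
rewrite /Delta (iter_resolvent th0 cE x cn).
have cd := has_symbol_add cn (has_symbol_scaleR (-1) (has_symbol_delta X (ltW t0))).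
rewrite (orbit_op_eq x cL cd); first by rewrite /orbit_op rmorphN1 scaleN1r.
move=> y y0; rewrite -!(rmorphM, rmorphD)/= /euler_err mulN1r; congr (_ - expR (- _))%:C.
by field; rewrite gt_eqF.
Qed.

Definition HP_functional (mu : bounded_measure R) (F : R -> X) : X :=
  let I (nu : {finite_measure set (measurableTypeR R) -> \bar R}) := bochner nu `[0,
    +oo[ F in
  I (re_pos mu) - I (re_neg mu) + 'i *: (I (im_pos mu) - I (im_neg mu)).

Lemma HP_has_symbol mu : exists N,
  has_symbol N (fun x => laplace mu x%:C) (HP_functional mu).
Proof.
have mD : measurable (`[0, +oo[%classic : set (measurableTypeR R)) by exact: measurable_itv.
have D0 (t : R) : (`[0, +oo[%classic : set (measurableTypeR R)) t -> 0 <= t.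
  by rewrite /= in_itv/= andbT.
have cm nu := has_symbol_measure X nu mD D0.
have cB N l L N' l' L' : has_symbol N l L -> has_symbol N' l' L' ->
   has_symbol (N + complex.Re `|-1| * N') (fun x => l x - l' x) (fun F : R ->
     X => L F - L' F).
  move=> c c'; have := has_symbol_add c (has_symbol_scale (-1) c').
  have -> : (fun F : R -> X => L F + -1 *: L' F) = (fun F => L F - L' F).
    by apply/funext => F; rewrite scaleN1r.
  by apply: has_symbol_ext => x _; rewrite mulN1r.
have := has_symbol_add (cB _ _ _ _ _ _ (cm (re_pos mu)) (cm (re_neg mu)))
  (has_symbol_scale 'i (cB _ _ _ _ _ _ (cm (im_pos mu)) (cm (im_neg mu)))).
set N := (_ + _ : R) => h; exists N; apply: has_symbol_ext h => x x0.
have E (nu : {finite_measure set (measurableTypeR R) -> \bar R}) :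
    cintegral nu (fun s => cexp (- (s%:C * x%:C))) =
      (\int[nu]_(t in `[0, +oo[) expR (- (x * t)))%:C.
  have e s : cexp (- (s%:C * x%:C)) = (expR (- (x * s)))%:C.
    by rewrite -rmorphM -rmorphN /cexp /= cos0 sin0 mulr1 mulr0 mulrC.
  have -> : (fun s => cexp (- (s%:C * x%:C))) =
    (fun s => (expR (- (x * s)))%:C) by exact/funext.
  rewrite /cintegral /=; congr (_ +i* _); by rewrite Rintegral_cst// mul0r.
by rewrite /laplace !E.
Qed.

(** With m and m g the symbols of [mu] and [nu], the symbols D f1 f2 m g and
    m D coincide.  Hence [HP T mu] sends the vector (D f1 f2)(A) y and [Delta]
    to the same element, and it is injective. *)
Lemma euler_bound (f1 f2 : R -> R) (g : R[i] -> R[i]) x y n t :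
  real_stieltjes f1 -> real_stieltjes f2 -> (forall z, 0 < z ->
    g z%:C * (f1 z * f2 z)%:C = 1) ->
  eHP_graph T g x y -> (0 < n)%N -> 0 < t ->
  let s := Num.sqrt n%:R / t in
  rnorm (Delta A T n t x) <= 12 * M * (rnorm y * (f1 s * f2 s)).
Proof.
move=> h1 h2 gf [_ [mu [nu [lap inj e]]]] n0 t0 /=.
have nr0 : 0 < n%:R :> R by rewrite ltr0n.
have th0 : 0 < t / n%:R by rewrite divr_gt0.
have [Lr cr] := symbol_le_euler_err_stieltjes X h1 h2 n0 t0.
have [Ld cd] := symbol_le_euler_err X n th0.
have [Nm cm] := HP_has_symbol mu; have [Nn cn] := HP_has_symbol nu.
have HPE k v : HP T k v = orbit_op (HP_functional k) v by [].
have e' : orbit_op (HP_functional mu) y = orbit_op (HP_functional nu) x := e.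
have -> : Delta A T n t x = orbit_op Lr y.
  rewrite (Delta_op x n0 t0 cd); apply: inj; rewrite !HPE.
  have crm := has_symbol_conv cr cm.
  rewrite -(orbit_op_mul y cm cr crm) => [|z z0]; last by rewrite mulrC.
  rewrite (orbit_op_mul y cr cm crm)// e'.
  have crn := has_symbol_conv cr cn.
  rewrite -(orbit_op_mul x cr cn crn)//; apply/esym.
  apply: (orbit_op_mul x cm cd crn) => z z0.
  rewrite lap; last by rewrite /Cplus/=.
  have alg (G m F d : R[i]) : G * F = 1 -> d * F * (m * G) = m * d.
    by move=> h; rewrite mulrCA -mulrA [F * G]mulrC h mulr1.
  by rewrite rmorphM; apply: alg; exact: gf.
apply: le_trans (orbit_op_le y cr) _.
rewrite le_eqVlt; apply/orP; left; apply/eqP; ring.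
Qed.

End Semigroup.

(** * Fractional powers *)

Section Powers.
Variable R : realType.
Let RB := measurableTypeR R.
Notation leb := (@lebesgue_measure R).

Lemma pushforward_measure (m : {measure set RB -> \bar R}) (phi : RB -> RB) :
  measurable_fun setT phi -> exists nu : {measure set RB -> \bar R},
  forall (D : set RB) (f : RB -> \bar R), measurable D -> measurable_fun D f ->
  {in D, forall y, (0 <= f y)%E} ->
  (\int[nu]_(y in D) f y = \int[m]_(x in phi @^-1` D) (f (phi x)))%E.
Proof.
move=> mphi; unshelve eexists (pushforward m phi); first exact: mphi.
by move=> D f mD mf f0; exact: (ge0_integral_pushforward mphi).
Qed.

Section Beta.
Variable b : R.
Hypotheses (b0 : 0 < b) (b1 : b < 1).

(** The integrand of t^(- b) / (x + t) dt after the substitution t = e^w, which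
    removes the singularity at 0. *)
Definition power_kernel (x w : R) := (x + expR w)^-1 * expR ((1 - b) * w).

Lemma power_kernel_gt0 x w : 0 < x -> 0 < power_kernel x w.
Proof. by move=> x0; rewrite mulr_gt0 ?expR_gt0// invr_gt0 addr_gt0 ?expR_gt0. Qed.

Lemma power_kernel_cont x : 0 < x -> continuous (power_kernel x).
Proof.
move=> x0 w; apply: cvgM.
  apply: cvgV; first by rewrite gt_eqF// addr_gt0 ?expR_gt0.
  by apply: cvgD; [exact: cvg_cst|exact: continuous_expR].
apply: (@cvg_comp _ _ _ (fun w => (1 - b) * w) expR _ _ _ _ (@continuous_expR R _)).
by apply: cvgMr; exact: cvg_id.
Qed.

Definition power_integral x : \bar R := (\int[leb]_w (power_kernel x w)%:E)%E.

Lemma measurable_power_kernel x : 0 < x -> measurable_fun [set: RB] (power_kernel x).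
Proof. by move=> x0; apply: continuous_measurable_fun; exact: power_kernel_cont. Qed.

(** Substitute w + ln x for w. *)
Lemma power_integral_scale x : 0 < x ->
  power_integral x = ((x `^ (- b))%:E * power_integral 1)%E.
Proof.
move=> x0; rewrite /power_integral.
have dF (y : R) : is_derive y 1 (fun w => w + ln x) 1.
  by apply: (dfun_eq (dfun_add (dfun_id y) (dfun_cst (ln x) y))); rewrite addr0.
have dFE : derive1 (fun w : R => w + ln x) = cst 1.
  by apply/funext => y; rewrite derive1E; have [_ ->] := dF y.
rewrite (@increasing_ge0_integration_by_substitutionT R (fun w => w + ln x) (power_kernel
  x)).
- rewrite -ge0_integralZl//; last 3 first.
  + by apply/measurable_EFinP; exact: measurable_power_kernel.
  + by move=> w _; rewrite lee_fin ltW// power_kernel_gt0.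
  + by rewrite lee_fin powR_ge0.
  apply: eq_integral => w _; rewrite -EFinM dFE; congr EFin.
  rewrite fctE /= mulr1 /power_kernel /powR gt_eqF// expRD lnK ?posrE//.
  rewrite (_ : expR ((1 - b) * (w + ln x)) = expR ((1 - b) * w) * (x * expR (- b * ln x))).
    by field; rewrite !gt_eqF ?addr_gt0 ?mulr_gt0 ?expR_gt0.
  rewrite -{2}(lnK x0) -!expRD; congr expR; ring.
- by move=> y z yz; rewrite ltrD2r.
- by rewrite dFE; exact: cst_continuous.
- by rewrite dFE; apply/cvg_ex; exists 1; exact: cvg_cst.
- by rewrite dFE; apply/cvg_ex; exists 1; exact: cvg_cst.
- by move=> y; have [] := dF y.
- apply/cvgrNyPle => B; near=> w; rewrite -lerBrDr; near: w.
  by apply: nbhs_ninfty_le; exact: num_real.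
- apply/cvgryPge => B; near=> w; rewrite -lerBlDr; near: w.
  by apply: nbhs_pinfty_ge; exact: num_real.
- exact: power_kernel_cont.
- by move=> w; rewrite ltW// power_kernel_gt0.
Unshelve. all: by end_near. Qed.

(** The integrand is at most e^(- m |w|) with m = min b (1 - b). *)
Lemma power_integral1 : exists2 c : R, 0 < c & power_integral 1 = c%:E.
Proof.
pose m := Num.min b (1 - b).
have m0 : 0 < m by rewrite lt_min b0 subr_gt0.
have mb : m <= b by rewrite ge_min lexx.
have m1 : m <= 1 - b by rewrite ge_min lexx orbT.
have fin : (power_integral 1 < +oo)%E.
  pose f (w : R) := expR (- (m * `|w|)).
  have fc : continuous f.
    move=> w; apply: (@cvg_comp _ _ _ (fun w => - (m * `|w|)) expR _ _ _ _
      (@continuous_expR R _)).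
    by apply: cvgN; apply: cvgMr; apply: cvg_norm; exact: cvg_id.
  have h : (power_integral 1 <= \int[leb]_w (f w)%:E)%E.
    apply: ge0_le_integral => //.
    - by move=> w _; rewrite lee_fin ltW// power_kernel_gt0.
    - by apply/measurable_EFinP; exact: measurable_power_kernel.
    - by apply/measurable_EFinP; exact: continuous_measurable_fun.
    move=> w _; rewrite lee_fin /power_kernel /f.
    rewrite mulrC ler_pdivrMr ?addr_gt0 ?expR_gt0//.
    have [w0|w0] := leP 0 w.
      rewrite ger0_norm// mulrDr mulr1 -expRD.
      apply: le_trans (_ : expR (- (m * w) + w) <= _); last by rewrite lerDr expR_ge0.
      by rewrite ler_expR; nra.
    rewrite ltr0_norm// mulrDr mulr1 -expRD.
    apply: le_trans (_ : expR (- (m * - w)) <= _); last by rewrite lerDl expR_ge0.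
    by rewrite ler_expR; nra.
  apply: le_lt_trans h _; rewrite ge0_symfun_integralT//; last 2 first.
  - by move=> w; exact: expR_ge0.
  - by move=> w; rewrite /f /= normrN.
  rewrite (_ : [set x : R | 0 <= x] = `[0, +oo[%classic); last first.
    by apply/seteqP; split => w /=; rewrite in_itv/= andbT.
  rewrite (_ : (\int[leb]_(x in `[0%R, +oo[) (f x)%:E = (m^-1)%:E)%E).
    by rewrite -EFinM ltry.
  rewrite -(integral_exp m0); apply: eq_integral => w.
  rewrite inE/= in_itv/= andbT => w0.
  by rewrite /f ger0_norm.
have ge0 : (0 <= power_integral 1)%E by apply: integral_ge0 => w _;
  rewrite lee_fin ltW// power_kernel_gt0.
have pos : (0 < power_integral 1)%E.
  apply: lt_le_trans (_ : 0 < (1 + expR 1)^-1%:E)%E _.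
    by rewrite lte_fin invr_gt0 addr_gt0 ?expR_gt0.
  apply: (@le_trans _ _ (\int[leb]_(w in `[0%R, 1%R]) (power_kernel 1 w)%:E)%E); last first.
    apply: ge0_subset_integral => //.
    - by apply/measurable_EFinP; exact: measurable_power_kernel.
    - by move=> w _; rewrite lee_fin ltW// power_kernel_gt0.
  rewrite (_ : (1 + expR 1)^-1%:E =
    \int[leb]_(w in `[0%R, 1%R]) (cst ((1 + expR 1)^-1)%:E w))%E; last first.
    by rewrite integral_cst//= lebesgue_measure_itv/= lte01 -EFinB subr0 mule1.
  apply: ge0_le_integral => //.
  - by move=> w _; rewrite lee_fin invr_ge0 addr_ge0 ?expR_ge0.
  - by apply/measurable_EFinP; apply: measurable_funTS; exact: measurable_power_kernel.
  - move=> w /=; rewrite in_itv/= => /andP[w0 w1]; rewrite lee_fin /power_kernel.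
    rewrite -[leLHS]mulr1 ler_pM ?invr_ge0 ?addr_ge0 ?expR_ge0//.
      by rewrite lef_pV2 ?posrE ?addr_gt0 ?expR_gt0// lerD2l ler_expR.
    have h : 0 <= (1 - b) * w by rewrite mulr_ge0// subr_ge0 ltW.
    have := expR_ge1Dx ((1 - b) * w); lra.
exists (fine (power_integral 1)).
  by rewrite fine_gt0// pos fin.
by rewrite fineK// ge0_fin_numE.
Qed.

(** The representing measure is the image under exp of e^((1 - b) w) dw, normalised
    by the integral at x = 1. *)
Lemma real_stieltjes_power_lt1 : real_stieltjes (fun x : R => x `^ (- b)).
Proof.
have [c c0 bc] := power_integral1.
pose k (w : RB) := c^-1 * expR ((1 - b) * w).
have k0 (w : RB) : [set: RB] w -> 0 <= k w by move=> _;
  rewrite mulr_ge0 ?expR_ge0// invr_ge0 ltW.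
have mk : measurable_fun [set: RB] k.
  apply: continuous_measurable_fun => w; apply: cvgMr.
  apply: (@cvg_comp _ _ _ (fun w => (1 - b) * w) expR _ _ _ _ (@continuous_expR R _)).
  by apply: cvgMr; exact: cvg_id.
have [m0 hm0] := density_measure leb measurableT mk k0.
have mexp : measurable_fun [set: RB] (expR : RB -> RB).
  by apply: continuous_measurable_fun; exact: continuous_expR.
have [nu hnu] := pushforward_measure m0 mexp.
have mI : measurable (`[0, +oo[%classic : set RB) by exact: measurable_itv.
have key x : 0 < x -> (\int[nu]_(t in `[0%R, +oo[) ((x + t)^-1)%:E = (x `^ (- b))%:E)%E.
  move=> x0; rewrite hnu//; last 2 first.
  - by apply/measurable_EFinP; exact: (measurable_inv_shift x0 mI (@subset_refl _ _)).
  - by move=> t; rewrite inE/= in_itv/= andbT => t0;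
    rewrite lee_fin invr_ge0 addr_ge0// ltW.
  have -> : expR @^-1` (`[0, +oo[%classic : set RB) = [set: RB].
    by apply/seteqP; split => // w _ /=; rewrite in_itv/= andbT expR_ge0.
  rewrite (hm0 _ (fun w => (x + expR w)^-1))//; last 2 first.
  - apply: continuous_measurable_fun => w.
    apply: cvgV; first by rewrite gt_eqF// addr_gt0 ?expR_gt0.
    by apply: cvgD; [exact: cvg_cst|exact: continuous_expR].
  - by move=> w _; rewrite invr_ge0 addr_ge0 ?expR_ge0// ltW.
  rewrite setIT.
  transitivity ((c^-1)%:E * power_integral x)%E.
    rewrite -ge0_integralZl//; last 3 first.
    + by apply/measurable_EFinP; exact: measurable_power_kernel.
    + by move=> w _; rewrite lee_fin ltW// power_kernel_gt0.
    + by rewrite lee_fin invr_ge0 ltW.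
    by apply: eq_integral => w _; rewrite -EFinM /k /power_kernel; congr EFin; ring.
  by rewrite power_integral_scale// bc -!EFinM; congr EFin; field; rewrite gt_eqF.
exists 0, nu; split=> //.
- by rewrite key// ltry.
- by move=> x x0; rewrite /Rintegral key// add0r.
Qed.
End Beta.

Lemma real_stieltjes_inv : real_stieltjes (fun x : R => x `^ (- 1)).
Proof.
have mI : measurable (`[0, +oo[%classic : set RB) by exact: measurable_itv.
have d1 : \d_(0 : RB) (`[0, +oo[%classic : set RB) = 1%E :> \bar R.
  by rewrite diracE mem_set//= in_itv/= lexx.
exists 0, (\d_ (0 : RB)); split=> //.
- rewrite integral_dirac//; last by apply/measurable_EFinP;
  exact: (measurable_inv_shift ltr01 mI (@subset_refl _ _)).
  by rewrite d1 mul1e ltry.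
- move=> x x0; rewrite /Rintegral integral_dirac//; last by apply/measurable_EFinP;
  exact: (measurable_inv_shift x0 mI (@subset_refl _ _)).
  by rewrite d1 mul1e/= add0r addr0 powR_inv1// ltW.
Qed.

Lemma real_stieltjes_power b : 0 < b <= 1 -> real_stieltjes (fun x : R => x `^ (- b)).
Proof.
move=> /andP[b0]; rewrite le_eqVlt => /orP[/eqP ->|b1]; first exact: real_stieltjes_inv.
exact: real_stieltjes_power_lt1.
Qed.

(** By (y + t)^-1 >= min 1 (x / y) (x + t)^-1, positivity propagates from one
    point to all. *)
Lemma real_stieltjes_gt0 (f : R -> R) x : real_stieltjes f -> 0 < x -> f x != 0 ->
  forall y, 0 < y -> 0 < f y.
Proof.
move=> [a [mu [a0 fin fE]]] x0 fx y y0.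
have mI : measurable (`[0, +oo[%classic : set RB) by exact: measurable_itv.
have iy := inv_shift_integrable fin y0 mI (@subset_refl _ _).
have ix := inv_shift_integrable fin x0 mI (@subset_refl _ _).
(* (x + t) / (y + t) lies between 1 and x / y. *)
pose c := Num.min 1 (x / y).
have c0 : 0 < c by rewrite lt_min ltr01 divr_gt0.
have fx0 : 0 < f x.
  by rewrite lt_def fx fE// addr_ge0// stieltjes_part_ge0.
have : c * f x <= f y.
  rewrite !fE// mulrDr lerD//; first by rewrite ler_piMl// ge_min lexx.
  rewrite -RintegralZl//; apply: le_Rintegral => //.
    exact: (integrableZl mI c ix).
  move=> t /=; rewrite in_itv/= andbT => t0.
  rewrite ler_pdivrMr ?ltr_pwDl// mulrC ler_pdivlMr ?ltr_pwDl//.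
  rewrite mulrDr lerD//; last by rewrite ler_piMl// ge_min lexx.
  by rewrite -ler_pdivlMr// ge_min lexx orbT.
by apply: lt_le_trans; rewrite mulr_gt0.
Qed.

Lemma cpow_real (alpha x : R) : 0 < x -> cpow alpha x%:C = (x `^ alpha)%:C.
Proof.
move=> x0; rewrite /cpow /clog /= mul0r atan0 expr0n /= addr0 sqrtr_sqr gtr0_norm//.
rewrite (_ : alpha%:C * (ln x +i* 0) = (alpha * ln x)%:C); last by rewrite rmorphM.
by rewrite /cexp /= cos0 sin0 mulr1 mulr0 /powR gt_eqF.
Qed.
End Powers.

Theorem corollary5p3 (R : realType) (X : completeNormedModType R[i])
    (A : operator X) (T : R -> X -> X) (M : R)
    (hT : C0_semigroup T) (hA : neg_generator A T)
    (hM : semigroup_sup T = M%:E) :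
  (forall f : R[i] -> R[i], stieltjes2 f ->
     (exists2 x : R, 0 < x & f x%:C != 0) ->
     let g := fun z => (f z)^-1 in
     forall x : X, dom (eHP T g) x ->
     forall (n : nat) (t : R), (0 < n)%N -> 0 < t ->
       `|Delta A T n t x| <=
         12 * M%:C * (`|eHP T g x| / g (Num.sqrt n%:R / t)%:C)) /\
  (forall alpha : R, 0 < alpha <= 2 ->
     forall x : X, dom (eHP T (cpow alpha)) x ->
     forall (n : nat) (t : R), (0 < n)%N -> 0 < t ->
       `|Delta A T n t x| <=
         12 * M%:C * `|eHP T (cpow alpha) x| * ((t / Num.sqrt n%:R) `^ alpha)%:C).
Proof.
have graph g x : dom (eHP T g) x -> eHP_graph T g x (eHP T g x).
  by move=> [y hy]; exact: (@getI _ [set y | eHP_graph T g x y] y hy).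
have s_gt0 (n : nat) (t : R) : (0 < n)%N -> 0 < t -> 0 < Num.sqrt n%:R / t.
  by move=> n0 t0; rewrite divr_gt0// sqrtr_gt0 ltr0n.
split.
  move=> f [F1 [F2 [[_ [a1 [m1 [a10 fin1 E1]]]] [_ [a2 [m2 [a20 fin2 E2]]]] ->]]].
  move=> [x1 x10 fx] g x dx n t n0 t0; have s0 := s_gt0 _ _ n0 t0.
  pose f1 (y : R) := complex.Re (F1 y%:C); pose f2 (y : R) := complex.Re (F2 y%:C).
  have e1 y : 0 < y -> F1 y%:C = (f1 y)%:C by move=> y0; rewrite /f1 E1.
  have e2 y : 0 < y -> F2 y%:C = (f2 y)%:C by move=> y0; rewrite /f2 E2.
  have r1 : real_stieltjes f1 by exists a1, m1; split=> // y y0; rewrite /f1 E1.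
  have r2 : real_stieltjes f2 by exists a2, m2; split=> // y y0; rewrite /f2 E2.
  move: fx; rewrite e1// e2// mulf_eq0 negb_or !fmorph_eq0 => /andP[n1 n2].
  have p1 := real_stieltjes_gt0 r1 x10 n1; have p2 := real_stieltjes_gt0 r2 x10 n2.
  have gE y : 0 < y -> g y%:C = ((f1 y * f2 y)^-1)%:C.
    by move=> y0; rewrite /g e1// e2// -rmorphM -fmorphV.
  have gf y : 0 < y -> g y%:C * (f1 y * f2 y)%:C = 1.
    by move=> y0; rewrite gE// -rmorphM mulVf ?gt_eqF// ?mulr_gt0 ?p1 ?p2.
  have := euler_bound hT hA hM r1 r2 gf (graph _ _ dx) n0 t0.
  rewrite gE// !rnormE -fmorphV invrK -[12]/(12%:R) -(rmorph_nat (real_complex R))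
    -!rmorphM lecR.
  by [].
move=> alpha /andP[al0 al2] x dx n t n0 t0; have s0 := s_gt0 _ _ n0 t0.
have b : 0 < alpha / 2 <= 1 by apply/andP; split; lra.
have r := real_stieltjes_power b.
have sq y : 0 < y -> y `^ (- (alpha / 2)) * y `^ (- (alpha / 2)) = (y `^ alpha)^-1.
  move=> y0; rewrite -powRD; last by rewrite (gt_eqF y0) implybT.
  by rewrite -powRN; congr (_ `^ _); field.
have gf y : 0 < y -> cpow alpha y%:C * (y `^ (- (alpha / 2)) * y `^ (- (alpha / 2)))%:C = 1.
  by move=> y0; rewrite cpow_real// -rmorphM sq// mulfV// gt_eqF// powR_gt0.
have := euler_bound hT hA hM r r gf (graph _ _ dx) n0 t0.
rewrite /= sq// (_ : ((Num.sqrt n%:R / t) `^ alpha)^-1 = (t / Num.sqrt n%:R) `^ alpha);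
  last first.
  have -> : t / Num.sqrt n%:R = (Num.sqrt n%:R / t) `^ (- 1).
    by rewrite powR_inv1 ?invf_div// ltW.
  by rewrite -powRN -powRrM mulN1r.
rewrite !rnormE -[12]/(12%:R) -(rmorph_nat (real_complex R)) -!rmorphM lecR mulrA.
by [].
Qed.
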